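(* Let $P\in(0,\infty]$ and $\mu\in\mathbb R$. Any $P$-periodic, nonconstant and even solution $\varphi\in BUC^1(\mathbb R)$ of the steady Whitham equation $-\mu\varphi+L\varphi+\varphi^2=0$ which is nondecreasing on $(-P/2,0)$ satisfies $$\varphi'>0,\qquad \varphi<\tfrac\mu2\qquad\text{on }(-P/2,0).$$ For such a solution one necessarily has $\mu>0$. If furthermore $\varphi\in BUC^2(\mathbb R)$, then $\varphi<\frac\mu2$ everywhere and $$\varphi''(0)<0.$$ For $P<\infty$ one has $\varphi''(\pm P/2)>0$. If (still with $P<\infty$ and $\varphi \in BUC^2(\mathbb R)$) in addition $\mu\le1$ and $\varphi(0)\ge\frac\mu4$, then $$\varphi''(\tfrac P2)-\varphi''(0)\ge\tfrac12\,|K_P'(\tfrac P4)|.$$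
   Context: Let $m(\xi)=\sqrt{\tanh(\xi)/\xi}$ (with $m(0)=1$), and $K=\mathcal F^{-1}m$, i.e. $K(x)=\frac1{2\pi}\int_{\mathbb R}m(\xi)e^{ix\xi}\,d\xi$ (inverse Fourier transform of tempered distributions; $K$ is an even integrable function, smooth for $x\ne0$ with exponential decay). Let $Lf=K*f$, so $Lf(x)=\int_{\mathbb R}K(x-y)f(y)\,dy$ for bounded continuous $f$. For $P<\infty$, $K_P(x)=\sum_{n\in\mathbb Z}K(x+nP)$. A solution of the steady Whitham equation is a real-valued, bounded, continuous function $\varphi$ on $\mathbb R$ satisfying the equation. For $P=\infty$ no periodicity is required and $(-P/2,0)=(-\infty,0)$. $BUC^k(\mathbb R)$ is the space of $k$ times continuously differentiable functions on $\mathbb R$ whose derivatives of order $\le k$ are bounded and uniformly continuous. *)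

(* Defs.v *)
From HB Require Import structures.
From mathcomp Require Import all_boot all_order all_algebra.
From mathcomp Require Import all_classical all_reals all_analysis.
Set Implicit Arguments.
Unset Strict Implicit.
Unset Printing Implicit Defensive.
Import Order.TTheory GRing.Theory Num.Theory.
Import numFieldNormedType.Exports.
Local Open Scope classical_set_scope.
Local Open Scope ring_scope.

Definition tanh {R : realType} (x : R) : R :=
  (expR x - expR (- x)) / (expR x + expR (- x)).

Definition whitham_symbol {R : realType} (xi : R) : R :=
  if xi == 0 then 1 else Num.sqrt (tanh xi / xi).

Definition schwartz {R : realType} (psi : R -> R) : Prop :=
  (forall (n : nat) (x : R), derivable (derive1n n psi) x 1) /\
  (forall k n : nat, exists M : R,
     forall x : R, `|x| ^+ k * `|derive1n n psi x| <= M).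

(* Real and imaginary parts of
   (F^-1 psi)(xi) = (1 / 2 pi) \int psi(x) e^{i x xi} dx, psi real-valued. *)
Definition inv_fourier_re {R : realType} (psi : R -> R) (xi : R) : R :=
  (2 * pi)^-1 * \int[lebesgue_measure]_x (psi x * cos (x * xi)).

Definition inv_fourier_im {R : realType} (psi : R -> R) (xi : R) : R :=
  (2 * pi)^-1 * \int[lebesgue_measure]_x (psi x * sin (x * xi)).

(* K = F^-1 m as tempered distributions: <K, psi> = <m, F^-1 psi>.  The
   functions K and m are real-valued; by linearity it suffices to test against
   real-valued psi, and the complex identity splits into real and imaginary
   parts. *)
Definition is_tempered_inv_fourier {R : realType} (m K : R -> R) : Prop :=
  forall psi : R -> R, schwartz psi ->
    \int[lebesgue_measure]_x (K x * psi x) =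
      \int[lebesgue_measure]_xi (m xi * inv_fourier_re psi xi) /\
    0 = \int[lebesgue_measure]_xi (m xi * inv_fourier_im psi xi).

(* The distribution F^-1 m is an integrable function, and only determines K
   almost everywhere; continuity off the origin selects the representative.
   The value K 0 (where the kernel is singular) is left free. *)
Definition is_whitham_kernel {R : realType} (K : R -> R) : Prop :=
  [/\ (@lebesgue_measure R).-integrable setT (EFin \o K),
      forall x : R, x != 0 -> {for x, continuous K}
    & is_tempered_inv_fourier whitham_symbol K].

Definition conv_op {R : realType} (K f : R -> R) (x : R) : R :=
  \int[lebesgue_measure]_y (K (x - y) * f y).

(* \sum_(n in Z) K (x + n p), split into the terms n >= 0 and n < 0. *)
Definition periodization {R : realType} (K : R -> R) (p x : R) : R :=
  limn (series (fun n : nat => K (x + n%:R * p))) +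
  limn (series (fun n : nat => K (x - n.+1%:R * p))).

Definition BUC {R : realType} (k : nat) (f : R -> R) : Prop :=
  (forall (n : nat) (x : R), (n < k)%N -> derivable (derive1n n f) x 1) /\
  (forall n : nat, (n <= k)%N ->
     bounded_fun (derive1n n f) /\ unif_continuous (derive1n n f)).

Definition steady_whitham_solution {R : realType} (K : R -> R) (mu : R)
    (phi : R -> R) : Prop :=
  [/\ continuous phi, bounded_fun phi
    & forall x : R, - mu * phi x + conv_op K phi x + phi x ^+ 2 = 0].

(* No condition when the period is infinite. *)
Definition eperiodic {R : realType} (P : \bar R) (f : R -> R) : Prop :=
  forall p : R, P = p%:E -> periodic f p.

(* The interval (-P/2, 0), which is (-oo, 0) when P = +oo. *)
Definition left_half_period {R : realType} (P : \bar R) : set R :=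
  [set x | (- (P * (2^-1)%:E) < x%:E)%E /\ x < 0].

(* Main.v *)
(* The kernel K is a superposition of exponentials e^{-t|x|} with t >= 1 and
   nonnegative weights.  Indeed tanh(xi)/xi is a limit of rational functions of
   lam = xi^2 whose zeros and poles are negative and interlaced (quotients of the
   two halves of (1 + xi/n)^n).  The square root of such a function is a limit of
   functions of the same kind, so m is one as well, and these have partial
   fractions c + sum_j c_j/(t_j^2 + lam) with c, c_j >= 0.  On (0, oo), K is thus
   positive, decreasing, convex and differentiable, and so is, on (0, P/2], the
   periodized kernel K_P, which is symmetric about P/2.

   Differentiating the equation gives (mu - 2 phi) phi' = K * phi'.  As phi' is
   odd and periodic, the right-hand side at x in (0, P/2) folds into the integral
   over (0, P/2) of (K_P(x - y) - K_P(x + y)) phi'(y), whose kernel is positive: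
   this gives the strict signs on the half period.  For x = h and x = P/2 - h
   with h -> 0 the convexity of K_P bounds the kernel below by 2 h sigma, sigma
   being minus the slope of a chord of K_P, and dividing by h bounds phi'' at the
   crest and at the trough; chords shrinking to P/4 yield the last inequality.
   That mu > 0, and that the trough is nonpositive when mu <= 1, follows by
   comparing L phi = phi (mu - phi) with the mean property L 1 = 1. *)
Require Import Defs.
From HB Require Import structures.
From mathcomp Require Import all_boot all_order all_algebra.
From mathcomp Require Import all_classical all_reals all_analysis.
From mathcomp Require Import measurable_realfun.
From mathcomp Require Import ring lra.
Set Implicit Arguments.
Unset Strict Implicit.
Unset Printing Implicit Defensive.
Import Order.TTheory GRing.Theory Num.Theory.
Import numFieldNormedType.Exports.
Local Open Scope classical_set_scope.
Local Open Scope ring_scope.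

(** * Integrals over the real line *)

(** The measure that represents a mixture is never constructed. Being a mixture is expressed by
    duality: a finite sum of exponentials that is nonnegative for all rates [t >= 1] stays
    nonnegative when each [e^(-t x)] is replaced by [f x]. Such inequalities survive pointwise
    limits, and each property of the kernel used later (decay, monotone chord slopes,
    differentiability) comes from one well-chosen sum. The obstacle is that [K] is known only
    through pairings with test functions. Gaussians centred at [a] are used: their transforms are
    explicit, and as the width tends to 0 the pairings tend to [K a], because [K] is continuous off
    the origin. The approximants of [m], however, carry a Dirac mass at 0, which a Gaussian of
    positive width still sees; hence the inequalities before the limit have an error term, which
    vanishes with the width. The restriction [t >= 1] gives geometric convergence of the periodized
    series as well as quantitative strict monotonicity and convexity. *)

Section real_integrals.
Context {R : realType}.
Local Notation leb := (@lebesgue_measure R).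
Implicit Types f g h : R -> R.

Definition rintegrable f := leb.-integrable setT (EFin \o f).

Lemma rintegrable_measurable f : rintegrable f -> measurable_fun setT f.
Proof. by move=> /integrableP[/measurable_EFinP]. Qed.

Lemma rintegrable_lty f : measurable_fun setT f ->
  (\int[leb]_x `|f x|%:E < +oo)%E -> rintegrable f.
Proof. by move=> mf fy; apply/integrableP; split; [exact/measurable_EFinP|]. Qed.

Lemma rintegrableD f g : rintegrable f -> rintegrable g ->
  rintegrable (fun x => f x + g x).
Proof. by move=> fi gi; have := integrableD measurableT fi gi. Qed.

Lemma rintegrableB f g : rintegrable f -> rintegrable g ->
  rintegrable (fun x => f x - g x).
Proof. by move=> fi gi; have := integrableB measurableT fi gi. Qed.

Lemma rintegrableZ k f : rintegrable f -> rintegrable (fun x => k * f x).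
Proof. by move=> fi; have := integrableZl measurableT k fi. Qed.

Lemma rintegrable_norm f : rintegrable f -> rintegrable (fun x => `|f x|).
Proof. by move=> fi; have := integrable_norm fi. Qed.

Lemma le_rintegrable f g : measurable_fun setT f ->
  (forall x, `|f x| <= g x) -> rintegrable g -> rintegrable f.
Proof.
move=> mf fg gi; apply: (le_integrable measurableT _ _ gi).
  exact/measurable_EFinP.
by move=> x _ /=; rewrite lee_fin (le_trans (fg x))// ler_norm.
Qed.

Lemma rintegrableM_bounded f g (B : R) : measurable_fun setT g ->
  (forall x, `|g x| <= B) -> rintegrable f -> rintegrable (fun x => f x * g x).
Proof.
move=> mg gB fi; apply: (@le_rintegrable _ (fun x => B * `|f x|)).
- by apply: measurable_funM => //; exact: rintegrable_measurable.
- by move=> x; rewrite normrM mulrC ler_wpM2r.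
- exact/rintegrableZ/rintegrable_norm.
Qed.

Lemma rintegralZ k f : rintegrable f ->
  \int[leb]_x (k * f x) = k * \int[leb]_x f x.
Proof. by move=> fi; exact: RintegralZl. Qed.

Lemma rintegralD f g : rintegrable f -> rintegrable g ->
  \int[leb]_x (f x + g x) = \int[leb]_x f x + \int[leb]_x g x.
Proof. by move=> fi gi; exact: RintegralD. Qed.

Lemma rintegralB f g : rintegrable f -> rintegrable g ->
  \int[leb]_x (f x - g x) = \int[leb]_x f x - \int[leb]_x g x.
Proof. by move=> fi gi; exact: RintegralB. Qed.

Lemma le_rintegral f g : rintegrable f -> rintegrable g ->
  (forall x, f x <= g x) -> \int[leb]_x f x <= \int[leb]_x g x.
Proof. by move=> fi gi fg; exact: le_Rintegral. Qed.

Lemma le_norm_rintegral f : rintegrable f ->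
  `|\int[leb]_x f x| <= \int[leb]_x `|f x|.
Proof. by move=> fi; exact: le_normr_Rintegral. Qed.

Lemma rintegrable_sum (I : Type) (s : seq I) (F : I -> R -> R) :
  (forall i, rintegrable (F i)) ->
  rintegrable (fun x => \sum_(i <- s) F i x).
Proof.
move=> Fi; elim: s => [|i s ih].
  under [X in rintegrable X]funext do rewrite big_nil.
  exact: integrable0.
under [X in rintegrable X]funext do rewrite big_cons.
exact: rintegrableD.
Qed.

Lemma Rintegral_sum (I : Type) (s : seq I) (F : I -> R -> R) :
  (forall i, rintegrable (F i)) ->
  \int[leb]_x (\sum_(i <- s) F i x) = \sum_(i <- s) \int[leb]_x F i x.
Proof.
move=> Fi; elim: s => [|i s ih].
  under eq_Rintegral do rewrite big_nil.
  by rewrite big_nil Rintegral_cst// mul0r.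
under eq_Rintegral do rewrite big_cons.
rewrite RintegralD ?big_cons ?ih//; first exact: Fi.
exact: rintegrable_sum.
Qed.

Lemma lebesgue_measure_shift (a : R) (A : set R) : measurable A ->
  pushforward leb (fun x => (a + x : measurableTypeR R)) A = leb A.
Proof.
move=> mA.
have ma : measurable_fun setT (fun x : R => (a + x : measurableTypeR R)).
  have H : measurable_fun setT (fun x : R => a + x) by exact: measurable_funD.
  exact: H.
pose mf := isMeasurableFun.Build _ _ _ _ _ ma.
pose F : {mfun _ >-> _} := HB.pack (fun x : R => (a + x : measurableTypeR R)) mf.
apply/esym; apply: (@lebesgue_measure_unique _ (pushforward leb F)) => //= _ [[c d]] _ <-.
rewrite /pushforward/=.
rewrite (_ : _ @^-1` _ = [set` `]c - a, d - a]]); last first.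
  by apply/seteqP; split => x /=; rewrite !in_itv/= ltrBlDl lerBrDl.
by rewrite !lebesgue_measure_itv/= !lte_fin ltrD2r -!EFinB; case: ifP => // _; congr EFin; ring.
Qed.

Section translation.
Variables (T : R -> R).
Hypothesis mT : measurable_fun setT T.
Hypothesis TE : forall A, measurable A -> pushforward leb (T : _ -> measurableTypeR R) A = leb A.

(** Stated for any measure-preserving map, so that translations and the reflection are both
    instances. *)
Lemma integral_transport (f : R -> \bar R) : measurable_fun setT f ->
  (forall x, 0 <= f x)%E -> (\int[leb]_x f (T x) = \int[leb]_x f x)%E.
Proof.
move=> mf f0.
have := @ge0_integral_pushforward _ _ (measurableTypeR R) (measurableTypeR R) R T mT leb setT f measurableT mf (fun y _ => f0 y).
rewrite preimage_setT => <-.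
by apply: eq_measure_integral => //= A mA AS; exact: TE.
Qed.

Lemma rintegrable_transport f : rintegrable f -> rintegrable (f \o T).
Proof.
move=> /[dup] /rintegrable_measurable mf /integrableP[_ fi].
apply: rintegrable_lty; first exact: measurableT_comp.
rewrite (integral_transport (f := fun x => `|f x|%:E))//.
by apply/measurable_EFinP; exact: measurableT_comp.
Qed.

Lemma Rintegral_transport f : rintegrable f ->
  \int[leb]_x f (T x) = \int[leb]_x f x.
Proof.
move=> fi; congr fine.
have := @integral_pushforward _ _ (measurableTypeR R) (measurableTypeR R) R T mT leb setT (EFin \o f).
rewrite preimage_setT => <- //.
- by apply: eq_measure_integral => //= A mA AS; exact: TE.
- by apply/measurable_EFinP; exact: rintegrable_measurable.
- exact: rintegrable_transport.
Qed.

End translation.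

Lemma rintegrable_shift a f : rintegrable f -> rintegrable (fun x => f (a + x)).
Proof.
apply: (@rintegrable_transport (fun x => a + x)); first exact: measurable_funD.
exact: lebesgue_measure_shift.
Qed.

Lemma Rintegral_shift a f : rintegrable f ->
  \int[leb]_x f (a + x) = \int[leb]_x f x.
Proof.
apply: (@Rintegral_transport (fun x => a + x)); first exact: measurable_funD.
exact: lebesgue_measure_shift.
Qed.

Lemma rintegrable_opp f : rintegrable f -> rintegrable (fun x => f (- x)).
Proof.
apply: (@rintegrable_transport -%R); first exact: oppr_measurable.
exact: lebesgue_measureN.
Qed.

Lemma Rintegral_opp f : rintegrable f ->
  \int[leb]_x f (- x) = \int[leb]_x f x.
Proof.
apply: (@Rintegral_transport -%R); first exact: oppr_measurable.
exact: lebesgue_measureN.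
Qed.

Lemma Rintegral_odd f : rintegrable f -> (forall x, f (- x) = - f x) ->
  \int[leb]_x f x = 0.
Proof.
move=> fi fodd; have := Rintegral_opp fi.
under eq_Rintegral do rewrite fodd -mulN1r.
by rewrite RintegralZl// => h; lra.
Qed.

Lemma Rintegral_dominated (f_ : nat -> R -> R) f g :
  (forall n, measurable_fun setT (f_ n)) ->
  (forall x, f_ n x @[n --> \oo] --> f x) ->
  rintegrable g -> (forall n x, `|f_ n x| <= g x) ->
  (rintegrable f * ((\int[leb]_x f_ n x) @[n --> \oo] --> \int[leb]_x f x))%type.
Proof.
move=> mf_ f_f gi f_g.
have mf : measurable_fun setT f.
  by apply: (@measurable_fun_cvg _ _ _ _ f_ f) => // x _; exact: f_f.
have mEf_ n : measurable_fun setT (fun x => (f_ n x)%:E) by exact/measurable_EFinP.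
have mEf : measurable_fun setT (EFin \o f) by exact/measurable_EFinP.
have cE : {ae leb, forall x, setT x -> (fun n => (f_ n x)%:E) @ \oo --> (EFin \o f) x}.
  by apply: aeW => x _; apply: cvg_EFin; [exact: nearW|exact: f_f].
have dE : {ae leb, forall x n, setT x -> (`|(f_ n x)%:E| <= (EFin \o g) x)%E}.
  by apply: aeW => x n _; rewrite lee_fin.
have [fi _ fc] := @dominated_convergence _ (measurableTypeR R) R leb setT measurableT _ _ _ mEf_ mEf cE gi dE.
split => //.
by apply: fine_cvg; rewrite fineK//; exact: integrable_fin_num.
Qed.

Lemma bounded_rintegrable_itv (f : R -> R) (a b : R) : continuous f ->
  leb.-integrable `[a, b] (EFin \o f).
Proof.
move=> cf; apply: continuous_compact_integrable; first exact: segment_compact.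
exact: continuous_subspaceT.
Qed.

Lemma Rintegral_itv_FTC (F f : R -> R) (a b : R) : a <= b -> continuous f ->
  (forall x : R, is_derive x 1 F (f x)) ->
  \int[leb]_(x in `[a, b]) f x = F b - F a.
Proof.
move=> ab cf dF; move: ab; rewrite le_eqVlt => /predU1P[->|ab].
  by rewrite set_itv1 Rintegral_set1 subrr.
have cF x : {for x, continuous F}.
  by apply: differentiable_continuous; apply/derivable1_diffP; apply: ex_derive.
rewrite /Rintegral (@continuous_FTC2 _ f F)//.
- exact: continuous_subspaceT.
- split; first by move=> x _; apply: ex_derive.
  + exact/cvg_at_right_filter/cF.
  + exact/cvg_at_left_filter/cF.
- by move=> x _; rewrite derive1E derive_val.
Qed.

Lemma Rintegral_setI_cvg f : rintegrable f ->
  (\int[leb]_(x in `[(- n%:R : R), n%:R]) f x) @[n --> \oo] --> \int[leb]_x f x.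
Proof.
move=> fi; under eq_fun do rewrite Rintegral_mkcond.
apply: (Rintegral_dominated (g := fun x => `|f x|) _ _ _ _).2.
- move=> n; apply/(measurable_restrictT _ _).1 => //; apply: measurable_funTS.
exact: rintegrable_measurable fi.
- move=> x; apply: cvg_near_cst; near=> n.
  rewrite /restrict mem_set//= in_itv/= -ler_norml.
  by near: n; exact: nbhs_infty_ger.
- exact: rintegrable_norm.
- by move=> n x; rewrite /restrict; case: ifP => // _; rewrite normr0.
Unshelve. all: end_near. Qed.

End real_integrals.

(** * Gaussians: decay, smoothness and cosine transform *)

Section gaussian.
Context {R : realType}.
Local Notation leb := (@lebesgue_measure R).
Implicit Types (s v a x y c : R) (p q : {poly R}).

Lemma is_derive_Rintegral (f df : R -> R -> R) (G : R -> R) (a : R) :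
  (forall x, rintegrable (f x)) ->
  (forall x y : R, is_derive x 1 (f ^~ y) (df x y)) ->
  rintegrable G -> (forall x y, `|df x y| <= G y) ->
  is_derive a 1 (fun x => \int[leb]_y f x y) (\int[leb]_y df a y).
Proof.
move=> fi fd Gi fG.
have dE x y : partial1of2 f x y = df x y.
  by rewrite partial1of2E derive_val.
have Ia : `](a - 1), (a + 1)[%classic a.
  by rewrite /= in_itv/=; apply/andP; split; lra.
have G0 y : 0 <= G y by apply: le_trans (fG a y).
have d1 x y : `](a - 1), (a + 1)[%classic x -> (@setT R) y -> derivable (f ^~ y) x 1.
  by move=> _ _; apply: ex_derive.
have b1 x y : `](a - 1), (a + 1)[%classic x -> (@setT R) y -> `|partial1of2 f x y| <= G y.
  by move=> _ _; rewrite dE.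
have D := @derivable_under_integral _ _ (measurableTypeR R) leb f setT
  measurableT a _ _ Ia (fun x _ => fi x) d1 G G0 Gi b1.
apply: DeriveDef => //.
rewrite -derive1E (@differentiation_under_integral _ _ (measurableTypeR R) leb f setT
  measurableT a _ _ Ia (fun x _ => fi x) d1 G G0 Gi b1).
by apply: eq_Rintegral => y _; rewrite dE.
Qed.

(** The constant combines [|x|^k <= k! e^|x|] with [|x| - c x^2 <= 1 / (4 c)], obtained by
    completing the square. *)
Lemma Xn_expR_bounded (k : nat) (c : R) : 0 < c ->
  exists M, forall x : R, `|x| ^+ k * expR (- (c * x ^+ 2)) <= M.
Proof.
move=> c0; exists (k`!%:R * expR ((4 * c)^-1)) => x.
have h1 : `|x| ^+ k <= k`!%:R * expR `|x|.
  case: k => [|k].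
    by rewrite expr0 fact0 mul1r -expR0 ler_expR.
  have := @expR_ge1Dxn R `|x| k (normr_ge0 _).
  rewrite -lerBrDl => h; rewrite mulrC -ler_pdivrMr ?ltr0n ?fact_gt0//.
  by apply: le_trans h _; lra.
apply: le_trans (ler_wpM2r (expR_ge0 _) h1) _.
rewrite -mulrA ler_wpM2l// -expRD ler_expR.
rewrite -subr_ge0 -(real_normK (num_real x)).
rewrite (_ : _ - _ = c * (`|x| - (2 * c)^-1) ^+ 2); last by field; lra.
by rewrite mulr_ge0 ?sqr_ge0// ltW.
Qed.

Lemma poly_expR_bounded (p : {poly R}) (c : R) : 0 < c ->
  exists M, forall x : R, `|p.[x]| * expR (- (c * x ^+ 2)) <= M.
Proof.
move=> c0.
(* The extra factor [|x|^k] makes the induction go through: the ['X] of [p * 'X + a] is handed to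
   the induction hypothesis at [k.+1]. *)
suff H : forall k, exists M, forall x : R, `|x| ^+ k * `|p.[x]| * expR (- (c * x ^+ 2)) <= M.
  by have [M HM] := H 0%N; exists M => x; have := HM x; rewrite expr0 mul1r.
elim/poly_ind: p => [|p a ih] k.
  by exists 0 => x; rewrite horner0 normr0 mulr0 mul0r.
have [M HM] := ih k.+1; have [N HN] := Xn_expR_bounded k c0.
exists (M + `|a| * N) => x; rewrite hornerMXaddC.
apply: (@le_trans _ _ (`|x| ^+ k.+1 * `|p.[x]| * expR (- (c * x ^+ 2)) +
   `|a| * (`|x| ^+ k * expR (- (c * x ^+ 2))))); last first.
  by apply: lerD => //; exact: ler_wpM2l.
rewrite !mulrA -!mulrDl ler_wpM2r ?expR_ge0//.
apply: le_trans (ler_wpM2l (exprn_ge0 _ (normr_ge0 x)) (ler_normD _ _)) _.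
by rewrite normrM exprSr le_eqVlt; apply/orP; left; apply/eqP; ring.
Qed.

(** A polynomial times a Gaussian of variance [v] centred at [a]. The class is closed under
    differentiation, which controls all iterated derivatives at once. *)
Definition hermite_fun (v a : R) (p : {poly R}) (x : R) : R :=
  p.[x - a] * expR (- ((x - a) ^+ 2 / (v *+ 2))).

Lemma is_derive_hermite v a p (x : R) : v != 0 ->
  is_derive x 1 (hermite_fun v a p) (hermite_fun v a (p^`() - v^-1 *: ('X * p)) x).
Proof.
move=> v0; rewrite /hermite_fun.
have dB : is_derive x 1 (fun y : R => y - a) 1.
  by apply: is_derive_eq; rewrite subr0.
have dp : is_derive x 1 (horner p \o (fun y : R => y - a)) (p^`().[x - a] * 1).
  exact: is_derive1_comp.
have dE : is_derive x 1 (expR \o (fun y : R => - ((y - a) ^+ 2 / (v *+ 2))))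
  (expR (- ((x - a) ^+ 2 / (v *+ 2))) * (- ((x - a) / v))).
  apply: is_derive1_comp.
  apply: is_derive_eq.
  rewrite !scaler1 /GRing.scale/= ?mulr1 ?mul1r.
  by field.
have := is_deriveM dp dE; rewrite /GRing.scale/= => D.
apply: is_derive_eq D _.
rewrite !hornerE/=; ring.
Qed.

Lemma derive1n_hermite v a p n : v != 0 ->
  exists q, derive1n n (hermite_fun v a p) = hermite_fun v a q.
Proof.
move=> v0; elim: n => [|n [q ih]]; first by exists p.
exists (q^`() - v^-1 *: ('X * q)); rewrite derive1nS ih; apply/funext => x.
by rewrite derive1E; have D := is_derive_hermite a q x v0; rewrite derive_val.
Qed.

Lemma schwartz_hermite v a p : 0 < v -> schwartz (hermite_fun v a p).
Proof.
move=> v0; have v0' : v != 0 by rewrite gt_eqF.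
split=> [n x|k n]; have [q ->] := derive1n_hermite a p n v0'.
  by have D := is_derive_hermite a q x v0'; exact: ex_derive.
have c0 : 0 < (v *+ 2)^-1 by rewrite invr_gt0 mulrn_wgt0.
have [M HM] := poly_expR_bounded (('X + a%:P) ^+ k * q) c0.
exists M => x; apply: le_trans (HM (x - a)).
rewrite hornerM horner_exp hornerD hornerX hornerC subrK /hermite_fun !normrM normrX.
by rewrite (ger0_norm (expR_ge0 _)) mulrA (mulrC (v *+ 2)^-1).
Qed.

Definition gaussian (s x : R) := normal_peak s * expR (- (x ^+ 2 / (s ^+ 2 *+ 2))).

Lemma gaussianE s : s != 0 -> gaussian s = normal_pdf 0 s.
Proof.
move=> s0; rewrite normal_pdfE//; apply/funext => x.
by rewrite /gaussian /normal_fun subr0 mulNr.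
Qed.

Lemma gaussian_ge0 s x : 0 <= gaussian s x.
Proof. by rewrite mulr_ge0 ?normal_peak_ge0 ?expR_ge0. Qed.

Lemma gaussianN s x : gaussian s (- x) = gaussian s x.
Proof. by rewrite /gaussian sqrrN. Qed.

Lemma gaussian_le s x y : `|x| <= `|y| -> gaussian s y <= gaussian s x.
Proof.
move=> xy; rewrite ler_wpM2l ?normal_peak_ge0// ler_expR lerN2.
rewrite ler_wpM2r ?invr_ge0 ?mulrn_wge0 ?sqr_ge0//.
by rewrite -(real_normK (num_real x)) -(real_normK (num_real y)) ler_sqr ?nnegrE.
Qed.

Lemma rintegrable_gaussian s : s != 0 -> rintegrable (gaussian s).
Proof. by move=> s0; rewrite gaussianE//; exact: integrable_normal_pdf. Qed.

Lemma Rintegral_gaussian s : s != 0 -> \int[leb]_x gaussian s x = 1.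
Proof. by move=> s0; rewrite gaussianE// /Rintegral integral_normal_pdf. Qed.

Lemma is_derive_gaussian s (x : R) : s != 0 ->
  is_derive x 1 (gaussian s) (- (x / s ^+ 2) * gaussian s x).
Proof.
move=> s0; have v0 : s ^+ 2 != 0 by rewrite expf_neq0.
have -> : gaussian s = hermite_fun (s ^+ 2) 0 (normal_peak s)%:P.
  by apply/funext => y; rewrite /hermite_fun hornerC subr0.
apply: is_derive_eq (is_derive_hermite _ _ _ v0) _.
rewrite /hermite_fun derivC !hornerE/=; ring.
Qed.

Lemma continuous_gaussian s : s != 0 -> continuous (gaussian s).
Proof. by move=> s0; rewrite gaussianE//; exact: continuous_normal_pdf. Qed.

(** The factor 1/2 of the exponent is split as 3/8 + 1/8: the first share absorbs the polynomial,
    the second is the exponent of the Gaussian of width [2 * s]. *)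
Lemma rintegrable_poly_gaussian p s : s != 0 ->
  rintegrable (fun x => p.[x] * gaussian s x).
Proof.
move=> s0; have s20 : 0 < s ^+ 2 by rewrite exprn_even_gt0.
have c0 : 0 < 3 / (8 * s ^+ 2) by apply: divr_gt0 => //; exact: mulr_gt0.
have [M HM] := poly_expR_bounded p c0.
have s2 : 2 * s != 0 by rewrite mulf_neq0 ?pnatr_eq0.
apply: (@le_rintegrable _ _ (fun x => (M * (normal_peak s / normal_peak (2 * s))) * gaussian (2 * s) x)).
- apply: measurable_funM; apply: continuous_measurable_fun.
    exact: continuous_horner.
  exact: continuous_gaussian.
- move=> x; rewrite normrM (ger0_norm (gaussian_ge0 _ _)) /gaussian.
  rewrite (_ : - (x ^+ 2 / (s ^+ 2 *+ 2)) =
     - (3 / (8 * s ^+ 2) * x ^+ 2) + - (x ^+ 2 / ((2 * s) ^+ 2 *+ 2))); last first.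
    by field.
  rewrite expRD.
  have np : normal_peak (2 * s) != 0 by rewrite gt_eqF// normal_peak_gt0.
  rewrite [leRHS](_ : _ = M * (normal_peak s * expR (- (x ^+ 2 / ((2 * s) ^+ 2 *+ 2))))); last first.
    by field.
  set E := expR (- (_ / (_ *+ 2))).
  rewrite [leLHS](_ : _ = `|p.[x]| * expR (- (3 / (8 * s ^+ 2) * x ^+ 2)) * (normal_peak s * E)); last by ring.
  rewrite ler_wpM2r//.
  by rewrite mulr_ge0 ?normal_peak_ge0 ?expR_ge0.
- exact/rintegrableZ/rintegrable_gaussian.
Qed.

Lemma gaussian_bounded_cvg0 (f : R -> R) s : s != 0 -> (forall x, `|f x| <= 1) ->
  (gaussian s n%:R * f n%:R @[n --> \oo] --> 0) * (gaussian s (- n%:R) * f (- n%:R) @[n --> \oo] --> 0).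
Proof.
move=> s0 f1.
have G0 : gaussian s (n%:R) @[n --> \oo] --> 0.
  have s20 : 0 < s ^+ 2 by rewrite exprn_even_gt0.
  have [M HM] := Xn_expR_bounded 1 (c := (s ^+ 2 *+ 2)^-1) ltac:(by rewrite invr_gt0 mulrn_wgt0).
  apply: (@squeeze_cvgr _ _ _ _ (cst 0) (fun n => (normal_peak s * M) * n%:R^-1)).
  - near=> n; rewrite gaussian_ge0/= /gaussian -mulrA ler_wpM2l ?normal_peak_ge0//.
    rewrite ler_pdivlMr; last by near: n; exact: nbhs_infty_gtr.
    rewrite mulrC -[X in X * _]ger0_norm// -[X in X * _]expr1 (mulrC (_ ^+ 2)).
    exact: HM.
  - exact: cvg_cst.
  - rewrite -(mulr0 (normal_peak s * M)); apply: cvgMl_tmp.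
    by apply/gtr0_cvgV0; [near=> n; near: n; exact: nbhs_infty_gtr|exact: cvgr_idn].
have H (u : nat -> R) (h : nat -> R) : u n @[n --> \oo] --> 0 -> (forall n, `|h n| <= 1) -> u n * h n @[n --> \oo] --> 0.
  move=> u0 h1; apply: norm_cvg0; apply: (@squeeze_cvgr _ _ _ _ (cst 0) (fun n => `|u n|)).
  - by apply: nearW => n; rewrite normr_ge0/= normrM ler_piMr.
  - exact: cvg_cst.
  - by rewrite -(normr0 R); exact: cvg_norm.
split; apply: H => //.
by under eq_fun do rewrite gaussianN.
Unshelve. all: end_near. Qed.

Lemma Rintegral_derive_eq0 (F f : R -> R) : continuous f ->
  (forall x : R, is_derive x 1 F (f x)) -> rintegrable f ->
  F n%:R @[n --> \oo] --> 0 -> F (- n%:R) @[n --> \oo] --> 0 ->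
  \int[leb]_x f x = 0.
Proof.
move=> cf dF fi F0 FN0.
have := Rintegral_setI_cvg fi.
under eq_fun => n do rewrite (Rintegral_itv_FTC (F := F)) ?ge0_cp//.
move=> H; apply: (cvg_unique _ H) => //.
by rewrite -(subr0 0); exact: cvgB.
Qed.

(** Differentiation under the integral and integration by parts give [J' = - s^2 xi J]; so
    [J xi * e^(s^2 xi^2 / 2)] is constant, and [J 0 = 1]. *)
Lemma gaussian_cos s xi : s != 0 ->
  \int[leb]_x (gaussian s x * cos (x * xi)) = expR (- (s ^+ 2 * xi ^+ 2 / 2)).
Proof.
move=> s0; have v0 : s ^+ 2 != 0 by rewrite expf_neq0.
pose J xi := \int[leb]_x (gaussian s x * cos (x * xi)).
have mM xi0 : continuous (fun x => x * xi0 : R).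
  by move=> x; apply: cvgM; [exact: cvg_id|exact: cvg_cst].
have ccos xi0 : continuous (fun x => cos (x * xi0) : R).
  by move=> x; apply: (continuous_comp (mM xi0 x)); exact: continuous_cos.
have csin xi0 : continuous (fun x => sin (x * xi0) : R).
  by move=> x; apply: (continuous_comp (mM xi0 x)); exact: continuous_sin.
have ig xi0 : rintegrable (fun x => gaussian s x * cos (x * xi0)).
  apply: (@rintegrableM_bounded _ _ _ 1).
  - exact: continuous_measurable_fun.
  - by move=> x; exact: cos_max.
  - exact: rintegrable_gaussian.
have ixg : rintegrable (fun x => x * gaussian s x).
  by have := rintegrable_poly_gaussian 'X s0; under eq_fun do rewrite hornerX.
have ixs xi0 : rintegrable (fun x => x * gaussian s x * sin (x * xi0)).
  apply: (@rintegrableM_bounded _ _ _ 1) => //.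
  - exact: continuous_measurable_fun.
  - by move=> x; exact: sin_max.
have byparts xi0 : \int[leb]_x (x * gaussian s x * sin (x * xi0)) = s ^+ 2 * xi0 * J xi0.
  have E : \int[leb]_x (- (s ^+ 2)^-1 * (x * gaussian s x * sin (x * xi0)) + xi0 * (gaussian s x * cos (x * xi0))) = 0.
    apply: (@Rintegral_derive_eq0 (fun x => gaussian s x * sin (x * xi0))).
    - move=> x; apply: cvgD; apply: cvgM; try exact: cvg_cst.
        apply: cvgM; last exact: csin.
        by apply: cvgM; [exact: cvg_id|exact: continuous_gaussian].
      by apply: cvgM; [exact: continuous_gaussian|exact: ccos].
    - move=> x.
      have D1 := is_derive_gaussian x s0.
      have D2 : is_derive x 1 (fun x : R => x * xi0) xi0.
        by apply: is_derive_eq; rewrite /GRing.scale/= mulr0 add0r mulr1.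
      have D3 : is_derive x 1 (sin \o (fun x : R => x * xi0)) (cos (x * xi0) * xi0).
        exact: is_derive1_comp.
      apply: is_derive_eq (is_deriveM D1 D3) _.
      rewrite /GRing.scale/=; ring.
    - by apply: rintegrableD; exact: rintegrableZ.
    - exact: (gaussian_bounded_cvg0 s0 (fun x => sin_max (x * xi0))).1.
    - exact: (gaussian_bounded_cvg0 s0 (fun x => sin_max (x * xi0))).2.
  move: E; rewrite (rintegralD (rintegrableZ _ (ixs _)) (rintegrableZ _ (ig _))).
  rewrite (rintegralZ _ (ixs _)) (rintegralZ _ (ig _)) => /eqP; rewrite mulNr addrC subr_eq0 => /eqP E.
  by rewrite /J -mulrA E mulrA divff// mul1r.
have dJ (x : R) : is_derive x 1 J (- (s ^+ 2 * x * J x)).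
  rewrite -byparts -mulN1r -(rintegralZ _ (ixs _)).
  apply: (@is_derive_Rintegral (fun xi x => gaussian s x * cos (x * xi))
     (fun xi x => -1 * (x * gaussian s x * sin (x * xi))) (fun x => `|x * gaussian s x|)) => //.
  - move=> y z.
    have D2 : is_derive y 1 (fun y : R => z * y) z.
      by apply: is_derive_eq; rewrite /GRing.scale/= mulr1.
    have D3 : is_derive y 1 (cos \o (fun x : R => z * x)) (- sin (z * y) * z).
      exact: is_derive1_comp.
    have D4 := is_deriveZ (gaussian s z) D3.
    by apply: is_derive_eq D4 _; rewrite /GRing.scale/=; ring.
  - exact: rintegrable_norm.
  - by move=> y z; rewrite mulN1r normrN normrM ler_piMr// sin_max.
have cstH (x : R) : is_derive x 1 (fun y => J y * expR (s ^+ 2 * y ^+ 2 / 2)) 0.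
  have D1 := dJ x.
  have D2 : is_derive x 1 (expR \o (fun y : R => s ^+ 2 * y ^+ 2 / 2)) (expR (s ^+ 2 * x ^+ 2 / 2) * (s ^+ 2 * x)).
    apply: is_derive1_comp.
    by apply: is_derive_eq; rewrite /GRing.scale/= !mulr0 ?add0r ?addr0 ?mulr1; field.
  by apply: is_derive_eq (is_deriveM D1 D2) _; rewrite /GRing.scale/=; ring.
have := @is_derive_0_is_cst _ _ xi 0 cstH.
rewrite expr0n/= mulr0 mul0r expR0 mulr1.
have -> : J 0 = 1.
  rewrite /J -(Rintegral_gaussian s0); apply: eq_Rintegral => x _.
  by rewrite mulr0 cos0 mulr1.
have e0 : expR (s ^+ 2 * xi ^+ 2 / 2) != 0 by rewrite gt_eqF// expR_gt0.
by move=> h; rewrite expRN; apply: (mulIf e0); rewrite mulVf.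
Qed.

End gaussian.

(** * Gaussian pairings and mixtures of exponentials *)

Section exponential_kernel.
Context {R : realType}.
Local Notation leb := (@lebesgue_measure R).
Implicit Types (s t a x y c xi : R).

Lemma continuous_cosM xi : continuous (fun x => cos (x * xi) : R).
Proof.
move=> x; apply: (continuous_comp (f := fun x => x * xi)); last exact: continuous_cos.
by apply: cvgM; [exact: cvg_id|exact: cvg_cst].
Qed.

Lemma continuous_expRN_norm t : continuous (fun x => expR (- (t * `|x|)) : R).
Proof.
move=> x; apply: (continuous_comp (f := fun x => - (t * `|x|))); last exact: continuous_expR.
by apply: cvgN; apply: cvgM; [exact: cvg_cst|exact: norm_continuous].
Qed.

(** Adding 1 to the cosine makes the integrand nonnegative, as the fundamental theorem on a half
    line used here requires. The case [xi = 0] then evaluates the extra term, to be subtracted. *)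
Let integral_exp_1Dcos t xi : 0 < t ->
  (\int[leb]_x (expR (- (t * `|x|)) * (1 + cos (x * xi)))%:E =
   (2 / t + 2 * t / (t ^+ 2 + xi ^+ 2))%:E)%E.
Proof.
move=> t0.
have txi : t ^+ 2 + xi ^+ 2 != 0.
  by rewrite gt_eqF// ltr_wpDr ?sqr_ge0// exprn_gt0.
rewrite ge0_symfun_integralT; last 3 first.
- by move=> x; rewrite mulr_ge0 ?expR_ge0// -lerBlDl sub0r cos_geN1.
- move=> x; apply: cvgM; first exact: continuous_expRN_norm.
  by apply: cvgD; [exact: cvg_cst|exact: continuous_cosM].
- by move=> x; rewrite /= normrN mulNr cosN.
pose F x := - t^-1 * expR (- (t * x)) +
  (t ^+ 2 + xi ^+ 2)^-1 * (expR (- (t * x)) * (xi * sin (x * xi) - t * cos (x * xi))).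
pose f x := expR (- (t * x)) * (1 + cos (x * xi)).
have dF x : is_derive x 1 F (f x).
  have D1 : is_derive x 1 (expR \o (fun x => - (t * x))) (expR (- (t * x)) * - t).
    apply: is_derive1_comp.
    by apply: is_derive_eq; rewrite /GRing.scale/= mulr1.
  have D0 : is_derive x 1 (fun x : R => x * xi) xi.
    by apply: is_derive_eq; rewrite /GRing.scale/= mulr0 add0r mulr1.
  have D2 : is_derive x 1 (sin \o (fun x : R => x * xi)) (cos (x * xi) * xi).
    exact: is_derive1_comp.
  have D3 : is_derive x 1 (cos \o (fun x : R => x * xi)) (- sin (x * xi) * xi).
    exact: is_derive1_comp.
  have D4 : is_derive x 1 (fun x => xi * sin (x * xi) - t * cos (x * xi))
      (xi * (cos (x * xi) * xi) - t * (- sin (x * xi) * xi)).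
    exact: is_deriveB (is_deriveZ xi D2) (is_deriveZ t D3).
  have D5 := is_deriveM D1 D4.
  have D6 : is_derive x 1 F (- t^-1 * (expR (- (t * x)) * - t) +
      (t ^+ 2 + xi ^+ 2)^-1 *
      (expR (- (t * x)) * (xi * (cos (x * xi) * xi) - t * (- sin (x * xi) * xi)) +
       (xi * sin (x * xi) - t * cos (x * xi)) * (expR (- (t * x)) * - t))).
    exact: is_deriveD (is_deriveZ (- t^-1) D1) (is_deriveZ ((t ^+ 2 + xi ^+ 2)^-1) D5).
  apply: is_derive_eq D6 _; rewrite /f; field.
  by rewrite txi/= gt_eqF.
have cF x : {for x, continuous F}.
  by apply: differentiable_continuous; apply/derivable1_diffP; apply: ex_derive.
rewrite -set_itvcy.
under eq_integral => x.
  rewrite inE/= in_itv/= andbT => x0; rewrite ger0_norm//.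
  over.
rewrite -/(f _)/=.
rewrite (@ge0_continuous_FTC2y _ f F 0 0); last 6 first.
- by move=> x x0; rewrite mulr_ge0 ?expR_ge0// -lerBlDl sub0r cos_geN1.
- apply: continuous_subspaceT => x; apply: cvgM.
    apply: (continuous_comp (f := fun x => - (t * x))); last exact: continuous_expR.
    by apply: cvgN; apply: cvgM; [exact: cvg_cst|exact: cvg_id].
  by apply: cvgD; [exact: cvg_cst|exact: continuous_cosM].
- pose C := t^-1 + (`|xi| + t) / (t ^+ 2 + xi ^+ 2).
  have txi0 : 0 < t ^+ 2 + xi ^+ 2 by rewrite lt_def txi addr_ge0 ?sqr_ge0.
  apply: norm_cvg0; apply: (@squeeze_cvgr _ _ _ _ (cst 0) (fun x => C * expR (- (t * x)))).
  + apply: nearW => x; rewrite normr_ge0/= /F /C mulrDl.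
    apply: le_trans (ler_normD _ _) _; apply: lerD.
      by rewrite normrM normrN !ger0_norm ?expR_ge0 ?invr_ge0 ?(ltW t0).
    rewrite !normrM (ger0_norm (expR_ge0 _)) ger0_norm ?invr_ge0 ?(ltW txi0)//.
    rewrite [leRHS](_ : _ = (t ^+ 2 + xi ^+ 2)^-1 * (expR (- (t * x)) * (`|xi| + t))); last by ring.
    apply: ler_wpM2l; first by rewrite invr_ge0 ltW.
    apply: ler_wpM2l; first exact: expR_ge0.
    apply: le_trans (ler_normB _ _) _; apply: lerD.
      by rewrite normrM ler_piMr// sin_max.
    by rewrite normrM (gtr0_norm t0) ler_piMr ?(ltW t0)// cos_max.
  + exact: cvg_cst.
  + rewrite -(mulr0 C); apply: cvgMl_tmp.
    apply: (cvg_comp (fun x => t * x) (fun x => expR (- x))); last exact: cvgr_expR.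
    by apply: gt0_cvgMry => //; exact: cvg_id.
- by move=> x _; apply: ex_derive.
- exact/cvg_at_right_filter/cF.
- by move=> x _; rewrite derive1E derive_val.
rewrite /F !mul0r sin0 cos0 mulr0 oppr0 expR0 -EFinM; congr EFin.
by field; rewrite txi/= gt_eqF.
Qed.

Lemma rintegrable_expRN_norm t : 0 < t -> rintegrable (fun x => expR (- (t * `|x|))).
Proof.
move=> t0; apply: (@le_rintegrable _ _ (fun x => expR (- (t * `|x|)) * (1 + cos (x * 0)))).
- by apply: continuous_measurable_fun; exact: continuous_expRN_norm.
- move=> x; rewrite mulr0 cos0 ger0_norm ?expR_ge0//.
  by rewrite ler_peMr ?expR_ge0// lerDl.
apply: rintegrable_lty.
  apply: continuous_measurable_fun => x; apply: cvgM; first exact: continuous_expRN_norm.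
  by apply: cvgD; [exact: cvg_cst|exact: continuous_cosM].
under eq_integral => x _.
  rewrite ger0_norm; last by rewrite mulr_ge0 ?expR_ge0// -lerBlDl sub0r cos_geN1.
  over.
by rewrite integral_exp_1Dcos// ltry.
Qed.

Lemma rintegrable_expRN_cos t xi : 0 < t ->
  rintegrable (fun x => expR (- (t * `|x|)) * cos (x * xi)).
Proof.
move=> t0; apply: (@rintegrableM_bounded _ _ _ 1).
- by apply: continuous_measurable_fun; exact: continuous_cosM.
- by move=> x; exact: cos_max.
- exact: rintegrable_expRN_norm.
Qed.

Lemma Rintegral_expRN_norm t : 0 < t -> \int[leb]_x expR (- (t * `|x|)) = 2 / t.
Proof.
move=> t0; have := congr1 fine (integral_exp_1Dcos 0 t0).
rewrite -/(Rintegral _ _ _).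
under eq_Rintegral do rewrite mulr0 cos0 mulrC.
rewrite rintegralZ; last exact: rintegrable_expRN_norm.
rewrite /= => h; apply: (@mulfI _ 2); first by rewrite pnatr_eq0.
rewrite -[2 in LHS]/(1 + 1) h; field; rewrite gt_eqF//.
Qed.

Lemma Rintegral_expRN_cos t xi : 0 < t ->
  \int[leb]_x (expR (- (t * `|x|)) * cos (x * xi)) = 2 * t / (t ^+ 2 + xi ^+ 2).
Proof.
move=> t0; have := congr1 fine (integral_exp_1Dcos xi t0).
rewrite -/(Rintegral _ _ _).
under eq_Rintegral do rewrite mulrDr mulr1.
rewrite (rintegralD (rintegrable_expRN_norm t0) (rintegrable_expRN_cos _ t0)).
by rewrite Rintegral_expRN_norm// => /addrI.
Qed.

End exponential_kernel.

(** * Pairing symbols with Gaussian windows *)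

Section pairing.
Context {R : realType}.
Local Notation leb := (@lebesgue_measure R).
Implicit Types (s t a x y c xi d : R) (f g : R -> R).

Lemma measurable_cos : measurable_fun setT (@cos R).
Proof. by apply: continuous_measurable_fun; exact: continuous_cos. Qed.

(** Fubini; this is Parseval's relation, moving the cosine transform from one factor to the
    other. *)
Lemma Rintegral_swap_cos f g : rintegrable f -> rintegrable g ->
  \int[leb]_x (f x * \int[leb]_y (g y * cos (y * x))) =
  \int[leb]_y (g y * \int[leb]_x (f x * cos (x * y))).
Proof.
move=> fi gi.
have mf := rintegrable_measurable fi; have mg := rintegrable_measurable gi.
have icos h z : rintegrable h -> rintegrable (fun y => h y * cos (y * z)).
  apply: (@rintegrableM_bounded _ _ _ 1).
    by apply: continuous_measurable_fun; exact: continuous_cosM.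
  by move=> x; exact: cos_max.
pose h (z : measurableTypeR R * measurableTypeR R) := f z.1 * (g z.2 * cos (z.2 * z.1)).
have mh : measurable_fun setT h.
  apply: measurable_funM; first exact: (measurableT_comp mf measurable_fst).
  apply: measurable_funM; first exact: (measurableT_comp mg measurable_snd).
  apply: (measurableT_comp measurable_cos).
  by apply: measurable_funM; [exact: measurable_snd|exact: measurable_fst].
have mEh : measurable_fun setT (EFin \o h) by exact/measurable_EFinP.
have ih : (leb \x leb)%E.-integrable setT (EFin \o h).
  apply/(@integrable12ltyP _ _ _ _ R leb leb _ mEh).
  pose C := \int[leb]_y `|g y|.
  have iC : (\int[leb]_y `|g y|%:E = C%:E)%E.
    by rewrite /C /Rintegral fineK//; apply: integrable_fin_num => //; exact: rintegrable_norm.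
  have ifC := rintegrable_norm (rintegrableZ C (rintegrable_norm fi)).
  have [_] := integrableP _ _ _ ifC; apply: le_lt_trans.
  apply: ge0_le_integral => //.
  - by move=> x _; exact: integral_ge0.
  - apply: (@measurable_fun_fubini_tonelli_F _ _ _ _ R leb (fun z => `|(EFin \o h) z|%E)) => //.
    by apply/measurable_EFinP; exact: measurableT_comp.
  - by apply: measurableT_comp => //; exact: measurable_int ifC.
  - move=> x _.
    apply: (@le_trans _ _ (\int[leb]_y (`|f x|%:E * `|g y|%:E))%E).
      apply: ge0_le_integral => //.
      + apply: measurableT_comp => //; apply/measurable_EFinP.
        exact: rintegrable_measurable (rintegrableZ (f x) (icos g x gi)).
      + apply: emeasurable_funM => //; apply/measurable_EFinP; exact: measurableT_comp.
      + move=> y _; rewrite /= -EFinM lee_fin /h/= !normrM ler_wpM2l//.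
        by rewrite ler_piMr// cos_max.
    rewrite ge0_integralZl//; last by apply/measurable_EFinP; exact: measurableT_comp.
    by rewrite iC -EFinM /= lee_fin mulrC normr_id ler_norm.
have EF h' : rintegrable h' -> (\int[leb]_x (h' x)%:E = (\int[leb]_x h' x)%:E)%E.
  by move=> ?; rewrite /Rintegral fineK//; exact: integrable_fin_num.
have E1 x : (\int[leb]_y (EFin \o h) (x, y) = (f x * \int[leb]_y (g y * cos (y * x)))%:E)%E.
  by rewrite -(rintegralZ _ (icos _ _ gi)) -EF//; exact: rintegrableZ (icos _ _ gi).
have E2 y : (\int[leb]_x (EFin \o h) (x, y) = (g y * \int[leb]_x (f x * cos (x * y)))%:E)%E.
  rewrite -(rintegralZ _ (icos _ _ fi)) -EF; last exact: rintegrableZ (icos _ _ fi).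
  by apply: eq_integral => x _; rewrite /= /h/= mulrCA (mulrC y).
have := Fubini ih; move=> /(congr1 fine).
under eq_integral do rewrite E1.
by under [in RHS]eq_integral do rewrite E2.
Qed.

(** The inverse Fourier transform of [gaussian s]. Centring the Gaussian at [a] multiplies the real
    part by [cos (xi * a)]. *)
Definition gauss_weight s xi := (2 * pi)^-1 * expR (- (s ^+ 2 * xi ^+ 2 / 2)).

Lemma gauss_weightE s xi : 0 < s -> gauss_weight s xi =
  normal_peak s * gaussian s^-1 xi.
Proof.
move=> s0; rewrite /gauss_weight /gaussian.
have s0' : s != 0 by rewrite gt_eqF.
rewrite mulrA; congr (_ * expR (- _)); last by field.
rewrite /normal_peak -invfM -sqrtrM; last by rewrite mulrn_wge0// mulr_ge0 ?sqr_ge0 ?pi_ge0.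
rewrite (_ : s ^+ 2 * pi *+ 2 * _ = (2 * pi) ^+ 2); last by field.
by rewrite sqrtr_sqr ger0_norm// mulr_ge0 ?pi_ge0.
Qed.

Lemma gauss_weight_ge0 s xi : 0 <= gauss_weight s xi.
Proof. by rewrite mulr_ge0 ?expR_ge0// invr_ge0 mulr_ge0 ?pi_ge0. Qed.

Lemma rintegrable_gauss_weight s : 0 < s -> rintegrable (gauss_weight s).
Proof.
move=> s0; rewrite (_ : gauss_weight s = fun xi => normal_peak s * gaussian s^-1 xi).
  by apply: rintegrableZ; apply: rintegrable_gaussian; rewrite invr_neq0// gt_eqF.
by apply/funext => xi; rewrite gauss_weightE.
Qed.

Lemma rintegrable_gauss_weight_cos s a : 0 < s ->
  rintegrable (fun xi => gauss_weight s xi * cos (xi * a)).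
Proof.
move=> s0; apply: (@rintegrableM_bounded _ _ _ 1).
- by apply: continuous_measurable_fun; exact: continuous_cosM.
- by move=> x; exact: cos_max.
- exact: rintegrable_gauss_weight.
Qed.

Lemma Rintegral_gauss_weight_cos s a : 0 < s ->
  \int[leb]_xi (gauss_weight s xi * cos (xi * a)) = gaussian s a.
Proof.
move=> s0; have s0' : s^-1 != 0 by rewrite invr_neq0// gt_eqF.
under eq_Rintegral do rewrite gauss_weightE// -mulrA.
rewrite rintegralZ; last first.
  apply: (@rintegrableM_bounded _ _ _ 1).
  - by apply: continuous_measurable_fun; exact: continuous_cosM.
  - by move=> x; exact: cos_max.
  - exact: rintegrable_gaussian.
rewrite gaussian_cos//; congr (_ * expR (- _)); field.
by rewrite gt_eqF.
Qed.

(** When [f] is the Fourier transform of a function, this is the average of that function against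
    the Gaussian of width [s] centred at [a]. *)
Definition gauss_pair s f a := \int[leb]_xi (f xi * (gauss_weight s xi * cos (xi * a))).

Lemma gauss_pair_expRN s t a : 0 < s -> 0 < t ->
  gauss_pair s (fun xi => 2 * t / (t ^+ 2 + xi ^+ 2)) a =
  \int[leb]_y (expR (- (t * `|a + y|)) * gaussian s y).
Proof.
move=> s0 t0; rewrite /gauss_pair.
under eq_Rintegral do rewrite -Rintegral_expRN_cos// mulrC.
rewrite Rintegral_swap_cos; [|exact: rintegrable_gauss_weight_cos|exact: rintegrable_expRN_norm].
pose e x := expR (- (t * `|x|)).
have s0' : s != 0 by rewrite gt_eqF.
have H b : rintegrable (fun x => e x * gaussian s (b + x)).
  apply: (@rintegrableM_bounded _ _ _ (normal_peak s)).
  - apply: continuous_measurable_fun => x.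
    apply: (continuous_comp (f := fun x => b + x)); last exact: continuous_gaussian.
    by apply: cvgD; [exact: cvg_cst|exact: cvg_id].
  - move=> x; rewrite ger0_norm ?gaussian_ge0// gaussianE//.
    exact: normal_pdf_ub.
  - exact: rintegrable_expRN_norm.
(* The product of the two cosines is half the sum of those of [x (y - a)] and [x (y + a)]. The two
   resulting integrals agree by reflection, as [e] and the Gaussian are even. *)
have E y : e y * \int[leb]_x (gauss_weight s x * cos (x * a) * cos (x * y)) =
    2^-1 * (e y * gaussian s (- a + y)) + 2^-1 * (e y * gaussian s (a + y)).
  rewrite -(Rintegral_gauss_weight_cos (- a + y) s0) -(Rintegral_gauss_weight_cos (a + y) s0).
  rewrite !(mulrCA 2^-1) -mulrDr -mulrDr; congr (_ * _).
  rewrite -(rintegralD (rintegrable_gauss_weight_cos _ s0) (rintegrable_gauss_weight_cos _ s0)).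
  rewrite -rintegralZ; last by apply: rintegrableD; exact: rintegrable_gauss_weight_cos.
  apply: eq_Rintegral => x _.
  rewrite (_ : x * (- a + y) = x * y - x * a); last by ring.
  by rewrite cosB (mulrDr x) cosD; field.
under eq_Rintegral do rewrite E.
rewrite (rintegralD (rintegrableZ _ (H _)) (rintegrableZ _ (H _))).
rewrite !(rintegralZ _ (H _)).
have <- : \int[leb]_y (e y * gaussian s (- a + y)) = \int[leb]_y (e y * gaussian s (a + y)).
  rewrite -(Rintegral_opp (H a)); apply: eq_Rintegral => y _.
  by rewrite /e normrN -gaussianN opprD opprK.
rewrite -mulrDl (_ : 2^-1 + 2^-1 = 1) ?mul1r; last by field.
rewrite -(Rintegral_shift a (H (- a))).
by apply: eq_Rintegral => y _; rewrite addKr.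
Qed.

End pairing.

(** * Mixture inequalities smoothed by Gaussians *)

Section exponential_mixtures.
Context {R : realType}.
Local Notation leb := (@lebesgue_measure R).
Implicit Types (s t a x y c xi d B : R) (f g : R -> R) (l : seq (R * R)).

Lemma inv_fourier_re_gaussian s a xi : 0 < s ->
  inv_fourier_re (fun x => gaussian s (x - a)) xi = gauss_weight s xi * cos (xi * a).
Proof.
move=> s0; have s0' : s != 0 by rewrite gt_eqF.
have ic : rintegrable (fun x => gaussian s x * cos (x * xi)).
  apply: (@rintegrableM_bounded _ _ _ 1); last exact: rintegrable_gaussian.
    by apply: continuous_measurable_fun; exact: continuous_cosM.
  by move=> x; exact: cos_max.
have isn : rintegrable (fun x => gaussian s x * sin (x * xi)).
  apply: (@rintegrableM_bounded _ _ _ 1); last exact: rintegrable_gaussian.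
    apply: continuous_measurable_fun => x.
    apply: (continuous_comp (f := fun x => x * xi)); last exact: continuous_sin.
    by apply: cvgM; [exact: cvg_id|exact: cvg_cst].
  by move=> x; exact: sin_max.
have E x : gaussian s x * cos ((a + x) * xi) =
   cos (xi * a) * (gaussian s x * cos (x * xi)) - sin (xi * a) * (gaussian s x * sin (x * xi)).
  by rewrite mulrDl cosD (mulrC a); ring.
have iE : rintegrable (fun x => gaussian s x * cos ((a + x) * xi)).
  by under [X in rintegrable X]funext do rewrite E; apply: rintegrableB; exact: rintegrableZ.
rewrite /inv_fourier_re.
have -> : \int[leb]_x (gaussian s (x - a) * cos (x * xi)) =
          \int[leb]_x (gaussian s x * cos ((a + x) * xi)).
  rewrite -(Rintegral_shift (- a) iE); apply: eq_Rintegral => x _.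
  by rewrite addrA subrr add0r addrC.
under eq_Rintegral do rewrite E.
rewrite rintegralB ?rintegralZ//; [|exact: rintegrableZ..].
rewrite gaussian_cos// (Rintegral_odd isn) ?mulr0 ?subr0; last first.
  by move=> x; rewrite gaussianN mulNr sinN mulrN.
by rewrite mulrA mulrAC.
Qed.

(** The distributional identity defining the kernel is tested on translated Gaussians, whose
    transforms are explicit. *)
Lemma whitham_kernel_gaussian K s a : is_whitham_kernel K -> 0 < s ->
  \int[leb]_x (K x * gaussian s (x - a)) = gauss_pair s whitham_symbol a.
Proof.
case=> _ _ hK s0.
have E : (fun x => gaussian s (x - a)) = hermite_fun (s ^+ 2) a (normal_peak s)%:P.
  by apply/funext => x; rewrite /hermite_fun hornerC.
have := (hK (fun x => gaussian s (x - a)) _).1; rewrite E => -> //; last first.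
  by apply: schwartz_hermite; rewrite exprn_gt0.
rewrite /gauss_pair -E; apply: eq_Rintegral => xi _.
by rewrite inv_fourier_re_gaussian.
Qed.

(* Satisfied by c + sum_j c_j / (t_j ^ 2 + xi ^ 2) with c, c_j >= 0 and
   t_j >= 1, and stable under bounded pointwise limits: the error term absorbs
   both the constant c (a multiple of the Dirac mass at 0) and the mass that
   the Gaussians carry across the origin. *)
Definition mixture_bound f := forall s l d, 0 < s -> 0 < d ->
  (forall p, p \in l -> d <= p.2) ->
  (forall t, 1 <= t -> 0 <= \sum_(p <- l) p.1 * expR (- (t * p.2))) ->
  - ((\sum_(p <- l) `|p.1|) * gaussian s d * f 0) <=
    \sum_(p <- l) p.1 * gauss_pair s f p.2.

Lemma rintegrable_gauss_pair s f a B : 0 < s -> measurable_fun setT f ->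
  (forall x, `|f x| <= B) ->
  rintegrable (fun xi => f xi * (gauss_weight s xi * cos (xi * a))).
Proof.
move=> s0 mf fB; under [X in rintegrable X]funext do rewrite mulrC.
by apply: (rintegrableM_bounded mf fB); exact: rintegrable_gauss_weight_cos.
Qed.

Lemma gauss_pairD s f g a B : 0 < s -> measurable_fun setT f -> measurable_fun setT g ->
  (forall x, `|f x| <= B) -> (forall x, `|g x| <= B) ->
  gauss_pair s (fun x => f x + g x) a = gauss_pair s f a + gauss_pair s g a.
Proof.
move=> s0 mf mg fB gB; rewrite /gauss_pair -rintegralD.
- by apply: eq_Rintegral => x _; rewrite mulrDl.
- exact: rintegrable_gauss_pair fB.
- exact: rintegrable_gauss_pair gB.
Qed.

Lemma gauss_pairZ s f a c B : 0 < s -> measurable_fun setT f ->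
  (forall x, `|f x| <= B) ->
  gauss_pair s (fun x => c * f x) a = c * gauss_pair s f a.
Proof.
move=> s0 mf fB; rewrite /gauss_pair -rintegralZ.
- by apply: eq_Rintegral => x _; rewrite mulrA.
- exact: rintegrable_gauss_pair fB.
Qed.

Lemma mixture_boundD f g B : measurable_fun setT f -> measurable_fun setT g ->
  (forall x, `|f x| <= B) -> (forall x, `|g x| <= B) ->
  mixture_bound f -> mixture_bound g -> mixture_bound (fun x => f x + g x).
Proof.
move=> mf mg fB gB hf hg s l d s0 d0 ld lt.
rewrite [leRHS](eq_bigr (fun p => p.1 * gauss_pair s f p.2 + p.1 * gauss_pair s g p.2)); last first.
  by move=> p _; rewrite -mulrDr; congr (_ * _); exact: gauss_pairD fB gB.
rewrite big_split/= mulrDr opprD; apply: lerD; [exact: hf|exact: hg].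
Qed.

Lemma mixture_boundZ f c B : 0 <= c -> measurable_fun setT f ->
  (forall x, `|f x| <= B) -> mixture_bound f -> mixture_bound (fun x => c * f x).
Proof.
move=> c0 mf fB hf s l d s0 d0 ld lt.
rewrite [leRHS](eq_bigr (fun p => c * (p.1 * gauss_pair s f p.2))); last first.
  by move=> p _; rewrite mulrCA; congr (_ * _); exact: gauss_pairZ fB.
by rewrite -mulr_sumr mulrCA -mulrN; apply: ler_wpM2l => //; exact: hf.
Qed.

(** The constant 1 is the transform of the Dirac mass at 0, whose Gaussian average at distance at
    least [d] is at most [gaussian s d]. The coefficients have arbitrary signs, so the error term
    has to pay for all of them. *)
Lemma mixture_bound1 : mixture_bound (fun=> 1).
Proof.
move=> s l d s0 d0 ld _; rewrite mulr1 mulr_suml -sumrN.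
rewrite big_seq [leRHS]big_seq; apply: ler_sum => p pl.
rewrite /gauss_pair; under eq_Rintegral do rewrite mul1r.
rewrite Rintegral_gauss_weight_cos//.
apply: (@le_trans _ _ (- (`|p.1| * gaussian s p.2))).
  rewrite lerN2 ler_wpM2l// gaussian_le// gtr0_norm//.
  by rewrite ger0_norm ?ld// (le_trans (ltW d0))// ld.
rewrite -mulNr ler_wpM2r ?gaussian_ge0// lerNl.
by rewrite -normrN ler_norm.
Qed.

(** The pairings are averages of [e^(-t |x|)] around the points of [l]. A displacement [|y| <= d]
    keeps every point on the positive side, where [e^(-t y)] factors out and leaves a nonnegative
    sum. Beyond [d] the Gaussian is at most [gaussian s d], and the integral of [e^(-t |x|)] is
    [2 / t], the value of the symbol at 0. *)
Lemma mixture_bound_lorentz t : 1 <= t ->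
  mixture_bound (fun xi => 2 * t / (t ^+ 2 + xi ^+ 2)).
Proof.
move=> t1 s l d s0 d0 ld lt.
have t0 : 0 < t by apply: lt_le_trans t1.
have s0' : s != 0 by rewrite gt_eqF.
have ie b : rintegrable (fun y => expR (- (t * `|b + y|))).
  exact: (rintegrable_shift b (rintegrable_expRN_norm t0)).
have ieg b : rintegrable (fun y => expR (- (t * `|b + y|)) * gaussian s y).
  apply: (@rintegrableM_bounded _ _ _ (normal_peak s)) => //.
  - by apply: continuous_measurable_fun; exact: continuous_gaussian.
  - move=> x; rewrite ger0_norm ?gaussian_ge0// gaussianE//.
    exact: normal_pdf_ub.
rewrite [leRHS](eq_bigr (fun p => \int[leb]_y (p.1 * (expR (- (t * `|p.2 + y|)) * gaussian s y)))); last first.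
  by move=> p _; rewrite rintegralZ//; congr (_ * _); exact: gauss_pair_expRN.
rewrite -Rintegral_sum => [|p]; last exact: rintegrableZ.
rewrite expr0n/= addr0.
have -> : - ((\sum_(p <- l) `|p.1|) * gaussian s d * (2 * t / t ^+ 2)) =
    \int[leb]_y (\sum_(p <- l) (- (`|p.1| * gaussian s d)) * expR (- (t * `|p.2 + y|))).
  rewrite Rintegral_sum => [|p]; last exact: rintegrableZ.
  rewrite !mulr_suml -sumrN; apply: eq_bigr => p _.
  rewrite rintegralZ// (Rintegral_shift p.2 (rintegrable_expRN_norm t0)).
  by rewrite Rintegral_expRN_norm// mulNr; congr (- (_ * _)); field; rewrite gt_eqF.
apply: le_rintegral; [by apply: rintegrable_sum => p; exact: rintegrableZ..|].
move=> y; have [yd|yd] := leP `|y| d.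
  apply: (@le_trans _ _ 0).
    apply: sumr_le0 => p _; rewrite mulr_le0_ge0 ?expR_ge0// oppr_le0.
    by rewrite mulr_ge0 ?gaussian_ge0.
  rewrite [leRHS](_ : _ = expR (- (t * y)) * gaussian s y * \sum_(p <- l) p.1 * expR (- (t * p.2))).
    by rewrite mulr_ge0 ?lt// mulr_ge0 ?expR_ge0 ?gaussian_ge0.
  rewrite mulr_sumr big_seq [RHS]big_seq; apply: eq_bigr => p pl.
  have h : 0 <= p.2 + y.
    by move: yd; rewrite ler_norml => /andP[? _]; have := ld _ pl; lra.
  rewrite (ger0_norm h) (_ : - (t * (p.2 + y)) = - (t * p.2) + - (t * y)) ?expRD; ring.
apply: ler_sum => p _.
rewrite [leRHS](_ : _ = p.1 * gaussian s y * expR (- (t * `|p.2 + y|))); last by ring.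
apply: ler_wpM2r; first exact: expR_ge0.
rewrite lerNl -mulNr; apply: (@le_trans _ _ (`|p.1| * gaussian s y)).
  by apply: ler_wpM2r; [exact: gaussian_ge0|rewrite -normrN ler_norm].
by apply: ler_wpM2l => //; apply: gaussian_le; rewrite (gtr0_norm d0) ltW.
Qed.

Lemma mixture_bound_cvg (f_ : nat -> R -> R) f B :
  (forall n, measurable_fun setT (f_ n)) -> (forall n x, `|f_ n x| <= B) ->
  (forall x, f_ n x @[n --> \oo] --> f x) ->
  (forall n, mixture_bound (f_ n)) -> mixture_bound f.
Proof.
move=> mf_ f_B f_f hf s l d s0 d0 ld lt.
have cp a : gauss_pair s (f_ n) a @[n --> \oo] --> gauss_pair s f a.
  apply: (Rintegral_dominated (g := fun xi => B * gauss_weight s xi) _ _ _ _).2.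
  - by move=> n; exact: rintegrable_measurable (rintegrable_gauss_pair _ s0 (mf_ n) (f_B n)).
  - by move=> x; apply: cvgMr_tmp; exact: f_f.
  - exact/rintegrableZ/rintegrable_gauss_weight.
  - move=> n x; rewrite normrM; apply: ler_pM => //.
    rewrite normrM (ger0_norm (gauss_weight_ge0 _ _)) ler_piMr ?gauss_weight_ge0//.
    exact: cos_max.
have H1 : - ((\sum_(p <- l) `|p.1|) * gaussian s d * f_ n 0) @[n --> \oo] -->
   - ((\sum_(p <- l) `|p.1|) * gaussian s d * f 0).
  by apply: cvgN; apply: cvgMl_tmp; exact: f_f.
have H2 : \sum_(p <- l) p.1 * gauss_pair s (f_ n) p.2 @[n --> \oo] -->
   \sum_(p <- l) p.1 * gauss_pair s f p.2.
  apply: cvg_big => //; first by move=> x y; exact: add_continuous.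
  by move=> p _; apply: cvgMl_tmp; exact: cp.
rewrite -(cvg_lim _ H1)// -(cvg_lim _ H2)//.
apply: ler_lim; [by apply/cvg_ex; eexists; exact: H1|by apply/cvg_ex; eexists; exact: H2|].
by apply: nearW => n; exact: hf.
Qed.

End exponential_mixtures.

(** * Mixtures and rational functions with interlaced zeros and poles *)

Section mixtures.
Context {R : realType}.
Implicit Types (s t a b x y c xi d B u v lam : R) (f g : R -> R) (l : seq (R * R)).

Definition mixture f := [/\ measurable_fun setT f,
  exists B, forall x, `|f x| <= B & mixture_bound f].

Lemma mixture1 : mixture (fun=> 1).
Proof. by split=> //; [exists 1 => x; rewrite normr1|exact: mixture_bound1]. Qed.

Lemma mixtureD f g : mixture f -> mixture g -> mixture (fun x => f x + g x).
Proof.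
move=> [mf [B fB] hf] [mg [C gC] hg]; split.
- exact: measurable_funD.
- by exists (B + C) => x; apply: le_trans (ler_normD _ _) _; exact: lerD.
- apply: (@mixture_boundD _ f g (Num.max B C)) => //.
    by move=> x; rewrite le_max fB.
  by move=> x; rewrite le_max gC orbT.
Qed.

Lemma mixtureZ f c : 0 <= c -> mixture f -> mixture (fun x => c * f x).
Proof.
move=> c0 [mf [B fB] hf]; split.
- exact: measurable_funM.
- by exists (c * B) => x; rewrite normrM (ger0_norm c0) ler_wpM2l.
- exact: (@mixture_boundZ _ _ _ B).
Qed.

Lemma mixture_lorentz c u : 0 <= c -> 1 <= u -> mixture (fun xi => c / (xi ^+ 2 + u)).
Proof.
move=> c0 u1; have u0 : 0 < u by apply: lt_le_trans u1.
pose t : R := Num.sqrt u.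
have t2 : t ^+ 2 = u by rewrite sqr_sqrtr// ltW.
have t1 : 1 <= t by rewrite -[leLHS]sqrtr1; exact: ler_wsqrtr.
have t0 : 0 < t by apply: lt_le_trans t1.
have -> : (fun xi => c / (xi ^+ 2 + u)) =
  (fun xi => c / (2 * t) * (2 * t / (t ^+ 2 + xi ^+ 2))).
  apply/funext => xi; rewrite -t2; field.
  by rewrite !gt_eqF// ltr_wpDr ?sqr_ge0// exprn_gt0.
apply: mixtureZ; first by rewrite divr_ge0// mulr_ge0// ltW.
have tx x : 0 < t ^+ 2 + x ^+ 2 by rewrite ltr_wpDr ?sqr_ge0// exprn_gt0.
split.
- apply: continuous_measurable_fun => x; apply: cvgM; first exact: cvg_cst.
  apply: cvgV; first by rewrite gt_eqF.
  by apply: cvgD; [exact: cvg_cst|exact: sqr_continuous].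
- exists (2 * t / t ^+ 2) => x; rewrite ger0_norm; last first.
    by rewrite divr_ge0 ?mulr_ge0// ltW.
  rewrite ler_wpM2l ?mulr_ge0 ?(ltW t0)// lef_pV2 ?posrE//.
    by rewrite lerDl sqr_ge0.
  by rewrite exprn_gt0.
- exact: mixture_bound_lorentz.
Qed.

Lemma mixture_ext f g : f =1 g -> mixture f -> mixture g.
Proof. by move=> /funext ->. Qed.

Lemma mixture_cvg (f_ : nat -> R -> R) f B :
  (forall n, mixture (f_ n)) -> (forall n x, `|f_ n x| <= B) ->
  (forall x, f_ n x @[n --> \oo] --> f x) -> mixture f.
Proof.
move=> hf fB f_f.
have mf_ n : measurable_fun setT (f_ n) by case: (hf n).
split.
- by apply: (@measurable_fun_cvg _ _ _ _ f_ f) => // x _; exact: f_f.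
- exists B => x; have cn : `|f_ n x| @[n --> \oo] --> `|f x| by apply: cvg_norm; exact: f_f.
  rewrite -(cvg_lim _ cn)//; apply: limr_le; first by apply/cvg_ex; eexists; exact: cn.
  exact: nearW.
- by apply: (@mixture_bound_cvg _ f_ f B) => // n; case: (hf n).
Qed.

(* F is a rational function 1 + sum_i c_i / (lam + u_i) with c_i >= 0 and poles
   - u_i in ]- b, - 1], nonnegative on ]-oo, - b]. *)
Definition stieltjes_rat b (F : R -> R) :=
  (exists2 l : seq (R * R), (forall p, p \in l -> [/\ 0 <= p.1, 1 <= p.2 & p.2 < b])
     & forall lam, (forall p, p \in l -> lam + p.2 != 0) ->
         F lam = 1 + \sum_(p <- l) p.1 / (lam + p.2)) /\
  (forall u, b <= u -> 0 <= F (- u)).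

Lemma stieltjes_rat1 b : stieltjes_rat b (fun=> 1).
Proof.
split; last by move=> ? _; exact: ler01.
by exists [::] => // lam _; rewrite big_nil addr0.
Qed.

Lemma stieltjes_rat_le b b' F : b <= b' -> stieltjes_rat b F -> stieltjes_rat b' F.
Proof.
move=> bb' [[l hl lE] hF]; split; last by move=> u ub; apply: hF; exact: le_trans ub.
by exists l => // p /hl[? ? pb]; split => //; exact: lt_le_trans bb'.
Qed.

Lemma stieltjes_rat_ext b F G : F =1 G -> stieltjes_rat b F -> stieltjes_rat b G.
Proof. by move=> /funext ->. Qed.

(** The new pole [- u] and zero [- v] lie to the left of all earlier poles. The residue at [- u] is
    [(v - u) F(- u)], nonnegative by the sign condition on [F]; an old residue is multiplied by
    [(v - p.2) / (u - p.2)], written [1 + (v - u) / (u - p.2)]. *)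
Lemma stieltjes_rat_mul b F u v : stieltjes_rat b F -> b <= u -> 1 <= u -> u < v ->
  stieltjes_rat v (fun lam => F lam * ((lam + v) / (lam + u))).
Proof.
move=> [[l hl lE] hF] bu u1 uv; split; last first.
  move=> w vw; rewrite mulr_ge0 ?hF//; first by lra.
  rewrite -mulrNN -invrN mulr_ge0//; first by lra.
  by rewrite invr_ge0; lra.
have ul p : p \in l -> 0 < u - p.2 by move=> /hl[_ _ ?]; lra.
exists (rcons [seq (p.1 * (1 + (v - u) / (u - p.2)), p.2) | p <- l] ((v - u) * F (- u), u)).
  move=> p; rewrite mem_rcons inE => /orP[/eqP ->/=|/mapP[q ql ->]/=].
    by split => //; rewrite mulr_ge0 ?hF//; lra.
  have [q0 q1 q2] := hl _ ql; split => //; last by lra.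
  rewrite mulr_ge0// addr_ge0// divr_ge0//; first by lra.
  by rewrite ltW// ul.
move=> lam hlam.
have lu : lam + u != 0 by apply: (hlam ((v - u) * F (- u), u)); rewrite mem_rcons inE eqxx.
have ll p : p \in l -> lam + p.2 != 0.
  move=> pl; apply: (hlam (p.1 * (1 + (v - u) / (u - p.2)), p.2)).
  by rewrite mem_rcons inE; apply/orP; right; apply/mapP; exists p.
rewrite lE// big_rcons/= big_map/= lE; last first.
  by move=> p pl; rewrite addrC subr_eq0 lt_eqF// -subr_gt0 ul.
set S1 := \sum_(p <- l) p.1 / (lam + p.2); set S2 := \sum_(p <- l) p.1 / (- u + p.2).
have -> : \sum_(j <- l) j.1 * (1 + (v - u) / (u - j.2)) / (lam + j.2) =
    S1 * ((lam + v) / (lam + u)) - (v - u) / (lam + u) * S2.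
  rewrite /S1 /S2 mulr_suml mulr_sumr -sumrB; apply: eq_big_seq => p pl.
  have h1 := ll _ pl; have h2 := lt0r_neq0 (ul _ pl).
  have h3 : - u + p.2 != 0 by rewrite -oppr_eq0 opprD opprK.
  by field; rewrite lu h1 h2 h3.
by field.
Qed.

End mixtures.

(** * Square roots of interlaced products and the symbol *)

Section square_root_of_products.
Context {R : realType}.
Implicit Types (s t a b c x y xi h u v lam : R) (f g F : R -> R).

Lemma mixture_stieltjes b F : stieltjes_rat b F -> mixture (fun xi => F (xi ^+ 2)).
Proof.
move=> [[l hl lE] _].
apply: (@mixture_ext _ (fun xi => 1 + \sum_(p <- l) p.1 / (xi ^+ 2 + p.2))).
  move=> xi; rewrite lE// => p /hl[_ p1 _].
  by rewrite gt_eqF// ltr_wpDl ?sqr_ge0// (lt_le_trans _ p1).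
apply: mixtureD; first exact: mixture1.
elim: l hl {lE} => [|p l ih] hl.
  apply: (@mixture_ext _ (fun=> 0 * 1)); first by move=> xi; rewrite big_nil mul0r.
  by apply: mixtureZ => //; exact: mixture1.
apply: (@mixture_ext _ (fun xi => p.1 / (xi ^+ 2 + p.2) + \sum_(q <- l) q.1 / (xi ^+ 2 + q.2))).
  by move=> xi; rewrite big_cons.
have [p0 p1 _] := hl _ (mem_head _ _).
apply: mixtureD; first exact: mixture_lorentz.
by apply: ih => q ql; apply: hl; rewrite inE ql orbT.
Qed.

(* Half of the factors of the telescoping product for (lam + a + 2 M h) / (lam + a). *)
Definition half_block a h (M : nat) lam :=
  \prod_(k < M) ((lam + (a + (k.*2.+1)%:R * h)) / (lam + (a + (k.*2)%:R * h))).

Lemma stieltjes_half_block c F a h M : stieltjes_rat c F -> c <= a -> 1 <= a -> 0 < h ->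
  stieltjes_rat (a + (M.*2)%:R * h) (fun lam => F lam * half_block a h M lam).
Proof.
move=> hF ca a1 h0; elim: M => [|M ih].
  apply: (@stieltjes_rat_ext _ _ F).
    by move=> lam; rewrite /half_block big_ord0 mulr1.
  by rewrite mul0r addr0; exact: stieltjes_rat_le hF.
have uv : a + (M.*2)%:R * h < a + (M.*2.+1)%:R * h.
  by rewrite ltrD2l ltr_pM2r// ltr_nat.
have := stieltjes_rat_mul ih (lexx _) _ uv => /(_ _)/stieltjes_rat_le H.
apply: stieltjes_rat_ext; last first.
  apply: H.
    by rewrite lerD2l ler_pM2r// ler_nat.
  by rewrite (le_trans a1)// lerDl mulr_ge0// ltW.
by move=> lam; rewrite -mulrA; congr (_ * _); rewrite /half_block big_ord_recr.
Qed.

Lemma half_block_gt0 a h M lam : 0 < lam + a -> 0 < h -> 0 < half_block a h M lam.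
Proof.
move=> la h0; apply: prodr_gt0 => k _.
by rewrite divr_gt0// addrA ltr_wpDr// mulr_ge0// ltW.
Qed.

(** In an arithmetic progression [t_k^2 >= t_(k-1) t_(k+1)]. Applied to the numerators of the
    squared factors this gives the lower bound, applied to the denominators the upper one; both
    products telescope. In the second the initial factor stays outside the telescoping and leaves
    [t_1 / t_0^2]. *)
Lemma half_block_sqr a h M lam : 0 < lam + a -> 0 < h ->
  (lam + (a + (M.*2)%:R * h)) / (lam + a) <= half_block a h M lam ^+ 2 <=
  (lam + (a + (M.*2)%:R * h)) / (lam + a) * (1 + h / (lam + a)).
Proof.
set t0 := lam + a => t00 h0.
pose t (k : nat) : R := lam + (a + k%:R * h).
have tp k : 0 < t k by rewrite /t addrA ltr_wpDr// mulr_ge0// ltW.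
have tS k : t k.+1 = t k + h by rewrite /t -natr1; ring.
have tE : t 0%N = t0 by rewrite /t mul0r addr0.
have HB : half_block a h M lam = \prod_(k < M) (t k.*2.+1 / t k.*2) by [].
rewrite HB -/(t M.*2) -tE {HB}; apply/andP; split.
  elim: M => [|M ih]; first by rewrite big_ord0 divff ?expr1n// gt_eqF.
  rewrite big_ord_recr/= exprMn.
  apply: le_trans (ler_wpM2r (sqr_ge0 _) ih).
  rewrite doubleS !tS mulrAC ler_wpM2r ?invr_ge0 ?(ltW (tp _))//.
  rewrite exprMn exprVn mulrA ler_pdivlMr ?exprn_gt0//.
  rewrite -subr_ge0 (_ : _ - _ = t M.*2 * h ^+ 2); last by ring.
  by rewrite mulr_ge0 ?sqr_ge0// ltW.
case: M => [|M].
  by rewrite big_ord0 expr1n divff ?gt_eqF// mul1r lerDl divr_ge0// ltW.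
suff H : (\prod_(k < M.+1) (t k.*2.+1 / t k.*2)) ^+ 2 <= t M.*2.+1 * (t 1%N / t 0%N ^+ 2).
  apply: le_trans H _; rewrite doubleS !tS.
  rewrite [leRHS](_ : _ = (t M.*2 + h + h) * ((t 0%N + h) / t 0%N ^+ 2)); last first.
    by field; rewrite gt_eqF.
  apply: ler_wpM2r; last by rewrite lerDl ltW.
  by rewrite divr_ge0 ?sqr_ge0// addr_ge0// ltW.
elim: M => [|M ih].
  by rewrite big_ord_recr big_ord0/= mul1r exprMn exprVn expr2 mulrA.
rewrite big_ord_recr exprMn.
apply: le_trans (ler_wpM2r (sqr_ge0 _) ih) _.
rewrite /= mulrAC ler_wpM2r ?divr_ge0 ?sqr_ge0 ?(ltW (tp _))//.
rewrite doubleS exprMn exprVn mulrA ler_pdivrMr ?exprn_gt0// !tS.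
rewrite -subr_ge0 (_ : _ - _ = (t M.*2 + h + h + h) * h ^+ 2); last by ring.
by rewrite mulr_ge0 ?sqr_ge0//; have := tp M.*2; lra.
Qed.

Lemma half_block_cvg a b lam : 0 < lam + a -> a < b ->
  half_block a ((b - a) / (M.+1.*2)%:R) M.+1 lam @[M --> \oo] -->
  Num.sqrt ((lam + b) / (lam + a)).
Proof.
move=> la ab.
pose h (M : nat) : R := (b - a) / (M.+1.*2)%:R.
have h0 M : 0 < h M by rewrite divr_gt0 ?ltr0n ?double_gt0// subr_gt0.
have Mh M : a + (M.+1.*2)%:R * h M = b.
  by rewrite /h mulrCA divff ?mulr1 ?pnatr_eq0 ?double_eq0//; ring.
have hc : h M @[M --> \oo] --> 0.
  rewrite -(mulr0 (b - a)); apply: cvgMl_tmp.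
  apply: (@squeeze_cvgr _ _ _ _ (cst 0) (fun M => M.+1%:R^-1)).
  - apply: nearW => M; rewrite invr_ge0 ler0n/= lef_pV2 ?posrE ?ltr0n ?double_gt0//.
    by rewrite ler_nat -addnn leq_addr.
  - exact: cvg_cst.
  - exact: cvg_harmonic.
have sq : half_block a (h M) M.+1 lam ^+ 2 @[M --> \oo] --> (lam + b) / (lam + a).
  apply: (@squeeze_cvgr _ _ _ _ (cst ((lam + b) / (lam + a)))
      (fun M => (lam + b) / (lam + a) * (1 + h M / (lam + a)))).
  - apply: nearW => M; have := half_block_sqr M.+1 la (h0 M).
    by rewrite Mh.
  - exact: cvg_cst.
  - rewrite -[X in _ --> X]mulr1; apply: cvgMl_tmp.
    rewrite -[X in _ --> X]addr0; apply: cvgD; first exact: cvg_cst.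
    by rewrite -(mul0r (lam + a)^-1); exact: cvgMr_tmp.
have : Num.sqrt (half_block a (h M) M.+1 lam ^+ 2) @[M --> \oo] -->
    Num.sqrt ((lam + b) / (lam + a)).
  by apply: (cvg_comp _ _ sq); exact: sqrt_continuous.
apply: cvg_trans; apply: near_eq_cvg; apply: nearW => M /=.
by rewrite sqrtr_sqr ger0_norm// ltW// half_block_gt0.
Qed.

Lemma half_block_le a b M lam : 0 <= lam -> 1 <= a -> a < b ->
  half_block a ((b - a) / (M.+1.*2)%:R) M.+1 lam <= 1 + b.
Proof.
move=> l0 a1 ab; have la : 0 < lam + a by lra.
set h := (b - a) / _.
have h0 : 0 < h by rewrite divr_gt0 ?ltr0n ?double_gt0// subr_gt0.
have hb : h <= b.
  rewrite ler_pdivrMr ?ltr0n ?double_gt0//.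
  apply: (@le_trans _ _ (b * 1)); first by lra.
  by rewrite ler_wpM2l ?ler1n ?double_gt0//; lra.
have [_] := andP (half_block_sqr M.+1 la h0).
have -> : a + (M.+1.*2)%:R * h = b.
  by rewrite /h mulrCA divff ?mulr1 ?pnatr_eq0 ?double_eq0//; ring.
move=> H; rewrite -ler_sqr ?nnegrE ?(ltW (half_block_gt0 _ la h0))//; last by lra.
apply: le_trans H _; rewrite expr2.
apply: ler_pM; rewrite ?divr_ge0 ?addr_ge0 ?divr_ge0//; try lra.
  rewrite ler_pdivrMr//; apply: (@le_trans _ _ ((1 + b) * (lam + 1))).
    rewrite -subr_ge0 (_ : _ - _ = 1 + lam * b); last by ring.
    by rewrite addr_ge0// mulr_ge0//; lra.
  by rewrite ler_wpM2l//; lra.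
rewrite lerD2l ler_pdivrMr//; apply: le_trans hb _.
by rewrite ler_peMr//; lra.
Qed.

(** Each factor's square root is a limit of half blocks, whose zeros and poles interlace inside
    [[a n, b n]] up to sign. These intervals follow one another, so the product of the blocks is
    again interlaced. *)
Lemma mixture_sqrt_prod (N : nat) (a b : nat -> R) :
  (forall n, (n < N)%N -> 1 <= a n /\ a n < b n) ->
  (forall m n, (m < n < N)%N -> b m <= a n) ->
  mixture (fun xi => Num.sqrt (\prod_(n < N) ((xi ^+ 2 + b n) / (xi ^+ 2 + a n)))).
Proof.
move=> ab ba.
pose h n (M : nat) : R := (b n - a n) / (M.+1.*2)%:R.
have hn n M : (n < N)%N -> 0 < h n M.
  by move=> /ab[_ ?]; rewrite divr_gt0 ?ltr0n ?double_gt0// subr_gt0.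
have hM n M : a n + (M.+1.*2)%:R * h n M = b n.
  by rewrite /h mulrCA divff ?mulr1 ?pnatr_eq0 ?double_eq0//; ring.
have st M x : (forall n, (n < N)%N -> b n <= x) ->
    stieltjes_rat x (fun lam => \prod_(n < N) half_block (a n) (h n M) M.+1 lam).
  elim: N x ab ba hn => [|N ih] x ab ba hn bx.
    apply: stieltjes_rat_ext (stieltjes_rat1 _) => lam.
    by rewrite big_ord0.
  have := @stieltjes_half_block (a N) _ (a N) (h N M) M.+1 (ih (a N) _ _ _ _) (lexx _) (ab _ _).1 (hn _ _ _).
  move=> H; apply: stieltjes_rat_le (bx N _) _ => //.
  rewrite -(hM N M); apply: stieltjes_rat_ext; last first.
    apply: H => //.
    - by move=> n nN; apply: ab; exact: ltnW.
    - by move=> m n /andP[mn nN]; apply: ba; rewrite mn ltnW.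
    - by move=> n M' nN; apply: hn; exact: ltnW.
    - by move=> n nN; apply: ba; rewrite nN/=.
  by move=> lam; rewrite big_ord_recr.
have xi0 xi n : (n < N)%N -> 0 < xi ^+ 2 + a n.
  by move=> /ab[a1 _]; rewrite ltr_wpDl ?sqr_ge0//; lra.
apply: (@mixture_cvg _ (fun M xi => \prod_(n < N) half_block (a n) (h n M) M.+1 (xi ^+ 2))
   _ (\prod_(n < N) (1 + b n))).
(* The sum of the [|b n|] serves only as a common upper bound of the [b n]. *)
- move=> M; apply: (@mixture_stieltjes (\sum_(n < N) `|b n|)
    (fun lam => \prod_(n < N) half_block (a n) (h n M) M.+1 lam)).
  apply: st => n nN.
  rewrite (bigD1 (Ordinal nN))//=; apply: le_trans (ler_norm _) _.
  by rewrite lerDl sumr_ge0.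
- move=> M x; rewrite normr_prod; apply: ler_prod => n _; rewrite normr_ge0/=.
  have [a1 a2] := ab n (ltn_ord n).
  rewrite gtr0_norm; first by apply: half_block_le => //; exact: sqr_ge0.
  by apply: half_block_gt0; [exact: xi0|exact: hn].
- move=> x.
  have -> : Num.sqrt (\prod_(n < N) ((x ^+ 2 + b n) / (x ^+ 2 + a n))) =
     \prod_(n < N) Num.sqrt ((x ^+ 2 + b n) / (x ^+ 2 + a n)).
    have P n : (n < N)%N -> 0 <= (x ^+ 2 + b n) / (x ^+ 2 + a n).
      move=> nN; have := xi0 x n nN; have [a1 a2] := ab n nN => H.
      by rewrite divr_ge0//; lra.
    elim: N P {ab ba hn st xi0} => [|N ih] P; first by rewrite !big_ord0 sqrtr1.
    rewrite !big_ord_recr/= sqrtrM ?ih// => [n nN|]; first by apply: P; exact: ltnW.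
    by apply: prodr_ge0 => n _; apply: P; rewrite ltnS ltnW.
  apply: cvg_big => //; first by move=> u v; exact: mul_continuous.
  move=> n _; apply: half_block_cvg; first exact: xi0.
  by have [] := ab n (ltn_ord n).
Qed.

End square_root_of_products.

(** * Rational approximation of tanh(xi)/xi *)

Section tanh_approximation.
Context {R : realType}.
Implicit Types (x y z t xi : R) (n k : nat).

(* With P, Q the two components, (1 + z) ^ n = P(z ^ 2) + z Q(z ^ 2). *)
Fixpoint tanh_polys n : {poly R} * {poly R} :=
  if n is n'.+1 then
    let: (P, Q) := tanh_polys n' in (P + 'X * Q, P + Q)
  else (1, 0).

Local Notation tP n := (tanh_polys n).1.
Local Notation tQ n := (tanh_polys n).2.

Lemma tanh_polysS n : tanh_polys n.+1 = (tP n + 'X * tQ n, tP n + tQ n).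
Proof. by rewrite /=; case: (tanh_polys n). Qed.

Lemma tanh_polys_expr n z :
  (tP n).[z ^+ 2] + z * (tQ n).[z ^+ 2] = (1 + z) ^+ n.
Proof.
elim: n => [|n ih]; first by rewrite /= hornerC horner0 mulr0 addr0.
by rewrite tanh_polysS /= !hornerE (exprS _ n) -ih; ring.
Qed.

(** De Moivre's formula for [(1 + i tan t)^n], split into real and imaginary parts; it exhibits the
    roots of both components. *)
Lemma tanh_polys_trig n t : cos t != 0 ->
  (tP n).[- tan t ^+ 2] * cos t ^+ n = cos (n%:R * t) /\
  tan t * (tQ n).[- tan t ^+ 2] * cos t ^+ n = sin (n%:R * t).
Proof.
move=> ct; have st : tan t * cos t = sin t by rewrite /tan divfK.
elim: n => [|n [ihP ihQ]].
  by rewrite /= hornerC horner0 mulr0 !mul0r mul1r expr0 cos0 sin0.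
rewrite (_ : n.+1%:R * t = n%:R * t + t); last by rewrite -natr1 mulrDl mul1r.
rewrite tanh_polysS /= !hornerE cosD sinD -ihP -ihQ -st (exprS (cos t)).
by split; ring.
Qed.

Lemma size_tanh_polys n : (size (tP n) <= n./2.+1)%N /\ (size (tQ n) <= n.+1./2)%N.
Proof.
elim: n => [|n [ihP ihQ]]; first by rewrite /= size_poly1 size_poly0.
have h : (n./2 <= n.+1./2)%N by exact/half_leq.
rewrite tanh_polysS /=; split; apply: leq_trans (size_polyD _ _) _; rewrite geq_max.
  rewrite (leq_trans ihP)//=; apply: leq_trans (size_polyMleq _ _) _.
  by rewrite size_polyX /= ltnS.
by rewrite ihP/= (leq_trans ihQ)//= uphalf_half -add1n leq_add2r leq_b1.
Qed.

Lemma tanh_polys0 n : (tP n).[0] = 1 /\ (tQ n).[0] = n%:R.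
Proof.
elim: n => [|n [ihP ihQ]]; first by rewrite /= hornerC horner0.
by rewrite tanh_polysS /= !hornerE ihP ihQ addrC natr1.
Qed.

(** The bound [Q <= n P] is what keeps [tanh_ratio] at most 1. *)
Lemma tanh_polys_gt0 n x : 0 <= x -> 0 < (tP n).[x] /\ 0 <= (tQ n).[x] <= n%:R * (tP n).[x].
Proof.
move=> x0; elim: n => [|n [ihP /andP[ihQ ih]]].
  by rewrite /= hornerC horner0 mul0r lexx ltr01.
rewrite tanh_polysS /= !hornerE; split; first by rewrite ltr_wpDr// mulr_ge0.
have xQ : 0 <= x * (tQ n).[x] by exact: mulr_ge0.
apply/andP; split; first by rewrite addr_ge0// ltW.
rewrite -natr1 mulrDl mul1r mulrDr.
have : 0 <= n%:R * (x * (tQ n).[x]) by rewrite mulr_ge0.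
lra.
Qed.

Lemma poly_all_roots (p : {poly R}) (k : nat) (r : nat -> R) : p != 0 ->
  (size p <= k.+1)%N -> (forall i, (i < k)%N -> root p (r i)) ->
  (forall i j, (i < j < k)%N -> r i != r j) ->
  exists c, forall x, p.[x] = c * \prod_(i < k) (x - r i).
Proof.
move=> p0 sp hr rne.
pose rs := [seq r i | i <- iota 0 k].
have srs : size rs = k by rewrite size_map size_iota.
have urs : uniq rs.
  rewrite map_inj_in_uniq ?iota_uniq// => i j; rewrite !mem_iota !add0n /= => ik jk rij.
  have [ij|ij|//] := ltngtP i j.
    by have := rne i j; rewrite ij jk rij eqxx => /(_ isT).
  by have := rne j i; rewrite ij ik rij eqxx => /(_ isT).
have ars : all (root p) rs.
  by apply/allP => _ /mapP[i + ->]; rewrite mem_iota => ik; apply: hr.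
have sp' : size p = (size rs).+1.
  by apply/eqP; rewrite eqn_leq srs sp/= -srs max_poly_roots.
exists (lead_coef p) => x.
rewrite [in LHS](all_roots_prod_XsubC sp' ars) ?uniq_rootsE//.
rewrite hornerZ horner_prod big_map -{1}(subn0 k) -/(index_iota 0 k) big_mkord.
by congr (_ * _); apply: eq_bigr => i _; rewrite hornerXsubC.
Qed.

Lemma sin_natMpi n : sin (n%:R * pi) = 0 :> R.
Proof.
elim: n => [|n ih]; first by rewrite mul0r sin0.
by rewrite -natr1 mulrDl mul1r sinDpi ih oppr0.
Qed.

Lemma norm_sin_natM n x : `|sin (n%:R * x)| <= n%:R * `|sin x|.
Proof.
elim: n => [|n ih]; first by rewrite !mul0r sin0 normr0.
rewrite -natr1 !mulrDl !mul1r sinD.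
apply: le_trans (ler_normD _ _) _; rewrite !normrM; apply: lerD.
  by apply: le_trans ih; rewrite ler_piMr// cos_max.
by rewrite ler_piMl// cos_max.
Qed.

Section nodes.
Variable k : nat.
(** With an odd exponent both components have exactly [k] roots, so that zeros and poles pair up. *)
Let n := k.*2.+1.
Let N : R := n%:R.
Let N0 : 0 < N. Proof. by rewrite ltr0n. Qed.

(** At odd indices [cos (n * t)] vanishes and at even ones [sin (n * t)]. So in the variable
    [xi ^+ 2] the opposites of the odd nodes are the poles of [tanh_ratio], and those of the even
    nodes from 2 on are its zeros. *)
Definition tanh_angle (i : nat) : R := i%:R * (pi / (2 * N)).
Definition tanh_node (i : nat) : R := N ^+ 2 * tan (tanh_angle i) ^+ 2.

Lemma tanh_angle_itv i : (i <= k.*2)%N -> 0 <= tanh_angle i < pi / 2.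
Proof.
move=> ik; have p0 := pi_gt0 R; rewrite /tanh_angle; apply/andP; split.
  by rewrite mulr_ge0// divr_ge0// ?mulr_ge0// ltW.
rewrite mulrCA ltr_pM2l// ltr_pdivrMr ?mulr_gt0// mulrA mulVf ?pnatr_eq0// mul1r.
by rewrite ltr_nat ltnS.
Qed.

Lemma tanh_angle_cos i : (i <= k.*2)%N -> 0 < cos (tanh_angle i).
Proof.
move=> /tanh_angle_itv /andP[h1 h2]; apply: cos_gt0_pihalf; rewrite h2 andbT.
by have := pi_gt0 R; lra.
Qed.

Lemma tan_angle_lt i j : (i < j <= k.*2)%N -> 0 <= tan (tanh_angle i) < tan (tanh_angle j).
Proof.
move=> /andP[ij jk].
have /andP[i0 ip] := tanh_angle_itv (ltnW (leq_trans ij jk)).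
have /andP[j0 jp] := tanh_angle_itv jk.
have p0 := pi_gt0 R.
have h x : 0 <= x -> x < pi / 2 -> x \in `](- (pi / 2)), (pi / 2)[.
  by move=> ? ?; rewrite in_itv/=; apply/andP; split => //; lra.
apply/andP; split.
  rewrite divr_ge0//; last by rewrite ltW// tanh_angle_cos// ltnW// (leq_trans ij).
  by apply: sin_ge0_pi; rewrite i0/=; lra.
by rewrite ltr_tan ?h// /tanh_angle ltr_pM2r ?ltr_nat ?divr_gt0 ?mulr_gt0.
Qed.

Lemma tanh_node_lt i j : (i < j <= k.*2)%N -> tanh_node i < tanh_node j.
Proof.
move=> /tan_angle_lt /andP[h1 h2]; rewrite ltr_pM2l ?exprn_gt0//.
by rewrite ltr_sqr ?nnegrE// ltW// (le_lt_trans h1).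
Qed.

(** At the first angle [t = pi / (2 N)] one has [1 = sin (N t) <= N sin t <= N tan t]. As [N] grows
    this node tends to [(pi / 2)^2], the first pole of [tanh]; the cruder bound 1 is the origin of
    the restriction [t >= 1] on the rates. *)
Lemma tanh_node_ge1 i : (1 <= i <= k.*2)%N -> 1 <= tanh_node i.
Proof.
case: i => // i /= ik.
suff H : 1 <= tanh_node 1.
  case: i ik => // i ik; apply: le_trans H _; apply: ltW; apply: tanh_node_lt.
  by rewrite ltnS/= ik.
have k2 : (1 <= k.*2)%N by exact: leq_ltn_trans ik.
have p0 := pi_gt0 R.
have c0 := tanh_angle_cos k2.
have s1 : 1 <= N * `|sin (tanh_angle 1)|.
  apply: le_trans (norm_sin_natM n _).
  rewrite /tanh_angle mul1r (_ : _ * _ = pi / 2); last by field; rewrite gt_eqF.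
  by rewrite sin_pihalf normr1.
rewrite /tanh_node -exprMn -(real_normK (num_real (_ * _))) -[leLHS](expr1n _ 2).
rewrite ler_sqr ?nnegrE// normrM (gtr0_norm N0) /tan normf_div (gtr0_norm c0).
apply: le_trans s1 _; rewrite ler_pM2l// ler_pdivlMr//.
by rewrite ler_piMr// cos_le1.
Qed.

Lemma root_tanh_polysP j : (j < k)%N -> root (tP n) (- tan (tanh_angle j.*2.+1) ^+ 2).
Proof.
move=> jk; have jk' : (j.*2.+1 <= k.*2)%N by rewrite ltn_double.
have c0 := lt0r_neq0 (tanh_angle_cos jk').
have [h _] := tanh_polys_trig n c0.
apply/rootP/(mulIf (expf_neq0 n c0)); rewrite mul0r h.
rewrite /tanh_angle -/N (_ : N * _ = j%:R * pi + pi / 2).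
  by rewrite cosDpihalf sin_natMpi oppr0.
by rewrite -natr1 -muln2 natrM; field; rewrite gt_eqF.
Qed.

Lemma root_tanh_polysQ j : (j < k)%N -> root (tQ n) (- tan (tanh_angle j.*2.+2) ^+ 2).
Proof.
move=> jk; have jk' : (j.*2.+2 <= k.*2)%N by rewrite -doubleS leq_double.
have c0 := lt0r_neq0 (tanh_angle_cos jk').
have [_ h] := tanh_polys_trig n c0.
have t0 : tan (tanh_angle j.*2.+2) != 0.
  have /andP[t0 t1] := @tan_angle_lt 0 j.*2.+2 jk'.
  by rewrite gt_eqF// (le_lt_trans t0).
apply/rootP/(mulfI t0)/(mulIf (expf_neq0 n c0)); rewrite mulr0 mul0r h.
rewrite /tanh_angle -/N (_ : N * _ = j.+1%:R * pi) ?sin_natMpi//.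
by rewrite -doubleS -muln2 natrM; field; rewrite gt_eqF.
Qed.

(** With [z = xi / N] and [xi != 0] this is [((1 + z)^n - (1 - z)^n) / ((1 + z)^n + (1 - z)^n) /
    xi]. Written with the components it also has the right value 1 at [xi = 0]. *)
Definition tanh_ratio xi := (tQ n).[(xi / N) ^+ 2] / (N * (tP n).[(xi / N) ^+ 2]).

Lemma tanh_ratio_factor : exists2 C, 0 <= C & forall xi, tanh_ratio xi =
  C * \prod_(j < k) ((xi ^+ 2 + tanh_node j.*2.+2) / (xi ^+ 2 + tanh_node j.*2.+1)).
Proof.
have [p0 q0] := tanh_polys0 n.
have [sp sq] := size_tanh_polys n.
have nk : n./2 = k by rewrite /n /= uphalf_double.
have nk' : n.+1./2 = k.+1 by rewrite /n /= doubleK.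
have nodes_ne (s : nat -> nat) : (forall i j, (i < j < k)%N -> (s i < s j <= k.*2)%N) ->
   forall i j, (i < j < k)%N ->
   - tan (tanh_angle (s i)) ^+ 2 != - tan (tanh_angle (s j)) ^+ 2.
  move=> hs i j /hs /tan_angle_lt /andP[h1 h2].
  by rewrite eqr_opp lt_eqF// ltr_sqr ?nnegrE// ltW// (le_lt_trans h1).
have [cP hP] : exists c, forall x, (tP n).[x] = c * \prod_(j < k) (x - - tan (tanh_angle j.*2.+1) ^+ 2).
  apply: (@poly_all_roots _ k (fun j => - tan (tanh_angle j.*2.+1) ^+ 2)).
  - by apply/eqP => h; move: p0; rewrite h horner0 => /eqP; rewrite eq_sym oner_eq0.
  - by rewrite -[k in X in (_ <= X)%N]nk.
  - exact: root_tanh_polysP.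
  - apply: (nodes_ne (fun j => j.*2.+1)) => i j /andP[ij jk].
    by rewrite ltnS ltn_double ij ltn_double.
have [cQ hQ] : exists c, forall x, (tQ n).[x] = c * \prod_(j < k) (x - - tan (tanh_angle j.*2.+2) ^+ 2).
  apply: (@poly_all_roots _ k (fun j => - tan (tanh_angle j.*2.+2) ^+ 2)).
  - apply/eqP => h; move: q0; rewrite h horner0 => /eqP.
    by rewrite eq_sym pnatr_eq0.
  - by rewrite -nk'.
  - exact: root_tanh_polysQ.
  - apply: (nodes_ne (fun j => j.*2.+2)) => i j /andP[ij jk].
    by rewrite !ltnS ltn_double ij -doubleS leq_double.
(* The constants of the two factorizations are positive because the values at 0, which are 1 and
   [n], are. *)
have pos (s : nat -> nat) : (forall j, (j < k)%N -> (1 <= s j <= k.*2)%N) ->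
   forall c x, 0 < c * \prod_(j < k) (0 - - tan (tanh_angle (s j)) ^+ 2) -> 0 < c.
  move=> hs c x; rewrite pmulr_lgt0//; apply: prodr_gt0 => j _.
  rewrite sub0r opprK.
  have /tanh_node_ge1 h := hs j (ltn_ord j).
  by have := lt_le_trans ltr01 h; rewrite /tanh_node pmulr_rgt0// exprn_gt0.
have cP0 : 0 < cP.
  apply: (pos (fun j => j.*2.+1) _ _ 0); last by rewrite -hP p0.
  by move=> j jk; rewrite /= ltn_double.
have cQ0 : 0 < cQ.
  apply: (pos (fun j => j.*2.+2) _ _ 0); last by rewrite -hQ q0.
  by move=> j jk; rewrite /= -doubleS leq_double.
exists (cQ / (N * cP)); first by rewrite divr_ge0 ?mulr_ge0// ltW.
move=> xi; rewrite /tanh_ratio hP hQ mulrA invfM mulrACA -prodf_div.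
congr (_ * _); apply: eq_bigr => j _.
have j1 : 0 < tanh_node j.*2.+1.
  apply: lt_le_trans ltr01 _; apply: tanh_node_ge1.
  by rewrite /= ltn_double.
have xi2 := sqr_ge0 xi.
rewrite /tanh_node in j1 *; rewrite !opprK; field.
rewrite (gt_eqF N0)/= !gt_eqF//.
by rewrite exprMn ltr_wpDl.
Qed.

Lemma tanh_ratio_itv xi : 0 <= tanh_ratio xi <= 1.
Proof.
have [h1 /andP[h2 h3]] := tanh_polys_gt0 n (sqr_ge0 (xi / N)).
have NP : 0 < N * (tP n).[(xi / N) ^+ 2] by exact: mulr_gt0.
by rewrite /tanh_ratio divr_ge0 ?ler_pdivrMr ?mul1r ?(ltW NP).
Qed.

Lemma mixture_sqrt_tanh_ratio : mixture (fun xi => Num.sqrt (tanh_ratio xi)).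
Proof.
have [C C0 CE] := tanh_ratio_factor.
apply: (@mixture_ext _ (fun xi => Num.sqrt C * Num.sqrt
  (\prod_(j < k) ((xi ^+ 2 + tanh_node j.*2.+2) / (xi ^+ 2 + tanh_node j.*2.+1))))).
  by move=> xi; rewrite CE sqrtrM.
apply: mixtureZ; first exact: sqrtr_ge0.
apply: (mixture_sqrt_prod (a := fun j => tanh_node j.*2.+1) (b := fun j => tanh_node j.*2.+2)).
  move=> j jk; split; first by apply: tanh_node_ge1; rewrite /= ltn_double.
  by apply: tanh_node_lt; rewrite ltnSn -doubleS leq_double.
move=> i j /andP[ij jk]; apply: ltW; apply: tanh_node_lt.
by rewrite ltnS -doubleS leq_double ij ltn_double.
Qed.

End nodes.

(** With [z = x / n], the lower bound comes from [(1 - z) e^z <= 1], which gives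
    [e^x (1 - z^2)^n <= (1 + z)^n], followed by Bernoulli's inequality for [(1 - z^2)^n]. *)
Lemma cvg_expR_expn x : (1 + x / n%:R) ^+ n @[n --> \oo] --> expR x.
Proof.
apply: (@squeeze_cvgr _ _ _ _ (fun n => expR x * (1 - x ^+ 2 / n%:R)) (cst (expR x))).
- near=> n.
  have n0 : 0 < n%:R :> R by near: n; exact: nbhs_infty_gtr.
  have xn : `|x| < n%:R by near: n; exact: nbhs_infty_gtr.
  have /andP[z1 z2] : -1 < x / n%:R < 1.
    by rewrite -ltr_norml normrM normfV (gtr0_norm n0) ltr_pdivrMr// mul1r.
  set z := x / n%:R in z1 z2 *.
  have ex : expR x = expR z ^+ n by rewrite -expRM_natl /z mulrCA divff ?mulr1// gt_eqF.
  apply/andP; split; last first.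
    by rewrite ex lerXn2r ?nnegrE ?expR_ge0 ?expR_ge1Dx//; lra.
  have z21 : z ^+ 2 <= 1 by nra.
  apply: (@le_trans _ _ (expR x * (1 - z ^+ 2) ^+ n)).
    rewrite ler_wpM2l ?expR_ge0//.
    have B : forall m : nat, 1 - m%:R * z ^+ 2 <= (1 - z ^+ 2) ^+ m.
      elim=> [|m ih]; first by rewrite mul0r subr0 expr0.
      rewrite (exprS _ m); apply: le_trans (ler_wpM2l _ ih); last by lra.
      rewrite -natr1 -subr_ge0 (_ : _ - _ = m%:R * (z ^+ 2) ^+ 2); last by ring.
      by rewrite mulr_ge0// sqr_ge0.
    have := B n; rewrite (_ : n%:R * z ^+ 2 = x ^+ 2 / n%:R)// /z.
    by field; rewrite gt_eqF.
  rewrite ex -exprMn lerXn2r ?nnegrE ?mulr_ge0 ?expR_ge0//; try lra.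
  rewrite (_ : 1 - z ^+ 2 = (1 - z) * (1 + z)); last by ring.
  rewrite mulrA ler_piMl//; first by lra.
  rewrite -[leRHS](expRxMexpNx_1 z) ler_wpM2l ?expR_ge0//.
  exact: expR_ge1Dx.
- rewrite -[X in _ --> X]mulr1; apply: cvgMl_tmp.
  rewrite -[X in _ --> X]subr0; apply: cvgB; first exact: cvg_cst.
  rewrite -(mulr0 (x ^+ 2)); apply: cvgMl_tmp.
  apply/gtr0_cvgV0; last exact: cvgr_idn.
  by near=> n; near: n; exact: nbhs_infty_gtr.
- exact: cvg_cst.
Unshelve. all: end_near. Qed.

Lemma tanh_ratio_cvg xi : xi != 0 -> tanh_ratio k xi @[k --> \oo] --> tanh xi / xi.
Proof.
move=> xi0.
pose u x (k : nat) : R := (1 + x / (k.*2.+1)%:R) ^+ k.*2.+1.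
have hu x : u x k @[k --> \oo] --> expR x.
  have h : (fun k => k.*2.+1) @ \oo --> \oo.
    apply/cvgnyPge => A; near=> k; rewrite ltnW// ltnS -addnn.
    by rewrite (leq_trans _ (leq_addr _ _))//; near: k; exact: nbhs_infty_ge.
  exact: (cvg_comp (fun k => k.*2.+1) (fun n => (1 + x / n%:R) ^+ n) h (@cvg_expR_expn x)).
have E k : tanh_ratio k xi = (u xi k - u (- xi) k) / (u xi k + u (- xi) k) / xi.
  set N : R := (k.*2.+1)%:R; have N0 : 0 < N by rewrite ltr0n.
  rewrite /tanh_ratio /u mulNr -(tanh_polys_expr _ (xi / N)).
  rewrite -[1 - _]/(1 + - (xi / N)) -(tanh_polys_expr _ (- (xi / N))) sqrrN.
  have [h _] := tanh_polys_gt0 k.*2.+1 (sqr_ge0 (xi / N)).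
  rewrite -/N; set p := (tP _).[_] in h *; set q := (tQ _).[_].
  rewrite (_ : p + xi / N * q + (p + - (xi / N) * q) = 2 * p); last by ring.
  by field; rewrite xi0 !gt_eqF.
under eq_fun do rewrite E.
apply: cvgMr_tmp; rewrite /tanh; apply: cvgM; first by apply: cvgB; exact: hu.
apply: cvgV; last by apply: cvgD; exact: hu.
by rewrite gt_eqF// addr_gt0// expR_gt0.
Unshelve. all: end_near. Qed.

Lemma mixture_whitham_symbol : mixture (@whitham_symbol R).
Proof.
apply: (@mixture_cvg _ (fun k xi => Num.sqrt (tanh_ratio k xi)) _ 1).
- exact: mixture_sqrt_tanh_ratio.
- move=> k xi; have /andP[h0 h1] := tanh_ratio_itv k xi.
  by rewrite ger0_norm ?sqrtr_ge0// -[leRHS]sqrtr1; exact: ler_wsqrtr.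
- move=> xi; rewrite /whitham_symbol; case: ifPn => [/eqP ->|xi0].
    under eq_fun => k.
      rewrite /tanh_ratio mul0r expr0n/=.
      have [-> ->] := tanh_polys0 k.*2.+1.
      rewrite mulr1 divff ?pnatr_eq0// sqrtr1.
      over.
    exact: cvg_cst.
  apply: (cvg_comp (tanh_ratio ^~ xi) Num.sqrt (tanh_ratio_cvg xi0)).
  exact: sqrt_continuous.
Qed.

End tanh_approximation.

(** * The kernel and its periodization *)

Section kernel_properties.
Context {R : realType}.
Local Notation leb := (@lebesgue_measure R).
Implicit Types (s t a x y c xi d e B : R) (f g h H K : R -> R) (l : seq (R * R)).

(** The split 3/8 + 1/8 of the exponent again: beyond [d] the Gaussian is below one of twice the
    width, still of mass 1, with a coefficient that vanishes as [s] tends to 0. *)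
Lemma gaussian_tail s y d : 0 < s -> 0 < d -> d <= `|y| ->
  gaussian s y <= 2 * expR (- (3 / 8 * d ^+ 2 / s ^+ 2)) * gaussian (2 * s) y.
Proof.
move=> s0 d0 dy.
have s2 : s != 0 by rewrite gt_eqF.
have -> : gaussian s y = 2 * expR (- (3 / 8 * y ^+ 2 / s ^+ 2)) * gaussian (2 * s) y.
  rewrite /gaussian.
  have -> : normal_peak s = 2 * normal_peak (2 * s).
    rewrite /normal_peak (_ : (2 * s) ^+ 2 * pi *+ 2 = 2 ^+ 2 * (s ^+ 2 * pi *+ 2)); last by ring.
    rewrite sqrtrM ?sqr_ge0//.
    by rewrite sqrtr_sqr ger0_norm// invfM mulrA divff ?mul1r.
  rewrite (_ : - (y ^+ 2 / (s ^+ 2 *+ 2)) =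
    - (3 / 8 * y ^+ 2 / s ^+ 2) + - (y ^+ 2 / ((2 * s) ^+ 2 *+ 2))); last by field.
  by rewrite expRD; ring.
apply: ler_wpM2r; first exact: gaussian_ge0.
rewrite ler_wpM2l// ler_expR lerN2 ler_wpM2r ?invr_ge0 ?sqr_ge0//.
rewrite ler_wpM2l// -(real_normK (num_real y)) ler_sqr ?nnegrE//.
exact: ltW.
Qed.

Lemma expRN_sqr_cvg0 c : 0 < c ->
  (n.+1%:R * expR (- (c * n.+1%:R ^+ 2)) @[n --> \oo] --> 0) *
  (expR (- (c * n.+1%:R ^+ 2)) @[n --> \oo] --> 0).
Proof.
move=> c0.
have [M HM] := Xn_expR_bounded 2 c0.
have A : n.+1%:R * expR (- (c * n.+1%:R ^+ 2)) @[n --> \oo] --> 0.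
  apply: (@squeeze_cvgr _ _ _ _ (cst 0) (fun n => M * n.+1%:R^-1)).
  - apply: nearW => n; rewrite mulr_ge0 ?expR_ge0//=.
    rewrite ler_pdivlMr ?ltr0n//; have := HM n.+1%:R.
    by rewrite ger0_norm// expr2 mulrAC.
  - exact: cvg_cst.
  - by rewrite -(mulr0 M); apply: cvgMl_tmp; exact: cvg_harmonic.
split=> //.
apply: (@squeeze_cvgr _ _ _ _ (cst 0) _ _ _ _ _ A).
- by apply: nearW => n; rewrite expR_ge0/= ler_peMl ?expR_ge0// ler1n.
- exact: cvg_cst.
Qed.

Let sq (n : nat) : R := n.+1%:R^-1.
Let sq0 n : 0 < sq n. Proof. by rewrite invr_gt0 ltr0n. Qed.

Lemma gaussian_cvg0 d : 0 < d -> gaussian (n.+1%:R^-1) d @[n --> \oo] --> 0.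
Proof.
move=> d0.
have c0 : 0 < d ^+ 2 / 2 by rewrite divr_gt0 ?exprn_gt0.
have := (expRN_sqr_cvg0 c0).1 => /(@cvgMl_tmp _ _ _ _ _ (Num.sqrt (pi *+ 2))^-1).
rewrite mulr0; apply: cvg_trans; apply: near_eq_cvg; apply: nearW => n.
rewrite /gaussian /normal_peak mulrA; congr (_ * expR (- _)); last first.
  by have : n.+1%:R != 0 :> R by []; move: (n.+1%:R : R) => m m0; field.
rewrite (_ : n.+1%:R^-1 ^+ 2 * pi *+ 2 = n.+1%:R^-1 ^+ 2 * (pi *+ 2)); last by ring.
rewrite sqrtrM ?sqr_ge0// sqrtr_sqr ger0_norm ?invr_ge0//.
by rewrite invfM invrK mulrC.
Qed.

(** Away from 0 the function [h] need not be bounded, since translates of [K] are singular. Its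
    integrable part [H] is met by the bound [gaussian s d] on the Gaussian, its bounded part [B] by
    [gaussian_tail]. *)
Lemma gaussian_approximate_identity h H B : measurable_fun setT h -> rintegrable H ->
  (forall y, `|h y| <= H y + B) -> h 0 = 0 -> {for 0, continuous h} ->
  \int[leb]_y (h y * gaussian (n.+1%:R^-1) y) @[n --> \oo] --> 0.
Proof.
move=> mh iH hHB h00 ch.
apply/cvgr0Pnorm_le => e e0.
have e2 : 0 < e / 2 by rewrite divr_gt0.
have [d /= d0 hd] : exists2 d, 0 < d & forall y, `|y| < d -> `|h y| <= e / 2.
  move/cvgrPdist_le : ch => /(_ _ e2); rewrite h00 => -[d /= d0 hd].
  exists d => // y yd; have := hd y; rewrite /= !sub0r !normrN; exact.
pose E n := 2 * expR (- (3 / 8 * d ^+ 2 / sq n ^+ 2)).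
have B0 : 0 <= `|B| by [].
have s_neq0 n : sq n != 0 by rewrite gt_eqF.
have s2_neq0 n : 2 * sq n != 0 by rewrite mulf_neq0.
pose C := \int[leb]_y `|H y|.
have ig n : rintegrable (fun y => e / 2 * gaussian (sq n) y + gaussian (sq n) d * `|H y| + `|B| * E n * gaussian (2 * sq n) y).
  apply: rintegrableD; first apply: rintegrableD.
  - exact/rintegrableZ/rintegrable_gaussian.
  - exact/rintegrableZ/rintegrable_norm.
  - exact/rintegrableZ/rintegrable_gaussian.
have bd n y : `|h y * gaussian (sq n) y| <= e / 2 * gaussian (sq n) y + gaussian (sq n) d * `|H y| + `|B| * E n * gaussian (2 * sq n) y.
  rewrite normrM (ger0_norm (gaussian_ge0 _ _)).
  have g0 := gaussian_ge0 (sq n) y; have gd := gaussian_ge0 (sq n) d.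
  have g2 : 0 <= `|B| * E n * gaussian (2 * sq n) y.
    by rewrite mulr_ge0 ?gaussian_ge0// mulr_ge0// mulr_ge0// expR_ge0.
  have [yd|dy] := ltP `|y| d.
    apply: (@le_trans _ _ (e / 2 * gaussian (sq n) y)).
      by apply: ler_wpM2r => //; exact: hd.
    by rewrite -addrA lerDl addr_ge0// mulr_ge0.
  apply: (@le_trans _ _ ((`|H y| + `|B|) * gaussian (sq n) y)).
    apply: ler_wpM2r => //; apply: le_trans (hHB y) _.
    by apply: lerD; exact: ler_norm.
  rewrite mulrDl -addrA; apply: ler_wpDl; first by rewrite mulr_ge0// ltW.
  apply: lerD.
    by rewrite mulrC ler_wpM2r// gaussian_le// (gtr0_norm d0).
  by rewrite -mulrA; apply: ler_wpM2l => //; exact: gaussian_tail.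
have ih n : rintegrable (fun y => h y * gaussian (sq n) y).
  apply: (le_rintegrable _ (bd n) (ig n)); apply: measurable_funM => //.
  by apply: continuous_measurable_fun; exact: continuous_gaussian.
have key n : `|\int[leb]_y (h y * gaussian (sq n) y)| <= e / 2 + (gaussian (sq n) d * C + `|B| * E n).
  apply: le_trans (le_norm_rintegral (ih n)) _.
  apply: le_trans (le_rintegral (rintegrable_norm (ih n)) (ig n) (bd n)) _.
  rewrite rintegralD; last 2 first.
  - apply: rintegrableD; last exact/rintegrableZ/rintegrable_norm.
    exact/rintegrableZ/rintegrable_gaussian.
  - exact/rintegrableZ/rintegrable_gaussian.
  rewrite rintegralD; last 2 first.
  - exact/rintegrableZ/rintegrable_gaussian.
  - exact/rintegrableZ/rintegrable_norm.
  rewrite (rintegralZ _ (rintegrable_gaussian (s_neq0 n))) (rintegralZ _ (rintegrable_norm iH)).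
  rewrite (rintegralZ _ (rintegrable_gaussian (s2_neq0 n))).
  by rewrite !Rintegral_gaussian// !mulr1 addrA.
have lim0 : gaussian (sq n) d * C + `|B| * E n @[n --> \oo] --> 0.
  rewrite -[X in _ --> X]addr0; apply: cvgD.
    by rewrite -(mul0r C); apply: cvgMr_tmp; exact: gaussian_cvg0.
  rewrite -(mulr0 `|B|); apply: cvgMl_tmp.
  rewrite -(mulr0 2); apply: cvgMl_tmp.
  have c0 : 0 < 3 / 8 * d ^+ 2 by rewrite mulr_gt0 ?exprn_gt0.
  have := (expRN_sqr_cvg0 c0).2; apply: cvg_trans; apply: near_eq_cvg.
  by apply: nearW => n; rewrite /sq exprVn invrK.
have /cvgr0Pnorm_le/(_ _ e2) := lim0.
apply: filterS => n hn; apply: le_trans (key n) _.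
by have := le_trans (ler_norm _) hn; lra.
Qed.

Lemma continuous_whitham_symbol0 : {for 0, continuous (@whitham_symbol R)}.
Proof.
have D1 : is_derive (0 : R) 1 (@tanh R) 1.
  have De : is_derive (0 : R) 1 (@expR R) 1 by apply: is_derive_eq; rewrite expR0.
  have DN : is_derive (0 : R) 1 (expR \o (fun x : R => - x)) (- 1).
    have -> : (-1 : R) = expR (- 0) * - 1 by rewrite oppr0 expR0 mul1r.
    by apply: is_derive1_comp.
  have Ds := is_deriveB De DN; have Da := is_deriveD De DN.
  have nz : (expR + (expR \o -%R)) (0 : R) != 0.
    by rewrite !fctE/= gt_eqF// addr_gt0// expR_gt0.
  have := is_deriveM Ds (is_deriveV nz Da).
  move=> D; apply: is_derive_eq D _.
  rewrite !fctE/= oppr0 expR0 /GRing.scale/=.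
  by field.
have c : tanh x / x @[x --> (0:R)^'] --> (1 : R).
  have [D2 D3] := D1.
  rewrite -[X in _ --> X]D3; move/cvg_ex : D2 => [L DL].
  move: (DL) => /cvg_lim -/(_ (@norm_hausdorff _ _)) DE.
  rewrite /derive DE; move: DL; apply: cvg_trans; apply: near_eq_cvg.
  apply: nearW => x /=.
  by rewrite addr0 scaler1 /GRing.scale/= {2}/tanh oppr0 subrr mul0r subr0 mulrC.
have c' : Num.sqrt (tanh x / x) @[x --> (0:R)^'] --> (1 : R).
  rewrite -(@sqrtr1 R); apply: (cvg_comp _ _ c); exact: sqrt_continuous.
have w0 : @whitham_symbol R 0 = 1 by rewrite /whitham_symbol eqxx.
apply/continuous_withinNx; rewrite w0; move: c'; apply: cvg_trans.
apply: near_eq_cvg; near=> x; rewrite /whitham_symbol.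
have -> // : (x == 0) = false.
by apply/negbTE; near: x; exact: nbhs_dnbhs_neq.
Unshelve. all: end_near. Qed.

Lemma whitham_kernel_integrable K : is_whitham_kernel K -> rintegrable K.
Proof. by case. Qed.

(** Continuity off the origin recovers [K a] from its averages against ever narrower Gaussians, and
    the symbol determines these averages. *)
Lemma whitham_kernel_cvg K a : is_whitham_kernel K -> a != 0 ->
  gauss_pair (n.+1%:R^-1) whitham_symbol a @[n --> \oo] --> K a.
Proof.
move=> hK a0; have iK := whitham_kernel_integrable hK.
have [_ cK _] := hK.
have iKa : rintegrable (fun y => K (a + y)) by exact: rintegrable_shift.
have s_neq0 n : sq n != 0 by rewrite gt_eqF.
have mg n : measurable_fun setT (gaussian (sq n)).
  by apply: continuous_measurable_fun; exact: continuous_gaussian.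
have iKg n : rintegrable (fun y => K (a + y) * gaussian (sq n) y).
  apply: (@rintegrableM_bounded _ _ _ (normal_peak (sq n))) => // x.
  by rewrite ger0_norm ?gaussian_ge0// gaussianE//; exact: normal_pdf_ub.
have iag n : rintegrable (fun y => K a * gaussian (sq n) y).
  exact/rintegrableZ/rintegrable_gaussian.
have E n : gauss_pair (sq n) whitham_symbol a =
    \int[leb]_y ((K (a + y) - K a) * gaussian (sq n) y) + K a.
  rewrite -(whitham_kernel_gaussian _ hK)//.
  have -> : \int[leb]_x (K x * gaussian (sq n) (x - a)) = \int[leb]_y (K (a + y) * gaussian (sq n) y).
    rewrite -(Rintegral_shift (- a) (iKg n)); apply: eq_Rintegral => x _.
    by rewrite addrA subrr add0r addrC.
  have -> : \int[leb]_y ((K (a + y) - K a) * gaussian (sq n) y) =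
      \int[leb]_y (K (a + y) * gaussian (sq n) y - K a * gaussian (sq n) y).
    by apply: eq_Rintegral => y _; rewrite mulrBl.
  rewrite rintegralB// (rintegralZ _ (rintegrable_gaussian (s_neq0 n))).
  by rewrite Rintegral_gaussian// mulr1 subrK.
suff H : \int[leb]_y ((K (a + y) - K a) * gaussian (n.+1%:R^-1) y) + K a @[n --> \oo] --> 0 + K a.
  move: H; rewrite add0r; apply: cvg_trans; apply: near_eq_cvg.
  by apply: nearW => n; rewrite E.
apply: cvgD; last exact: cvg_cst.
apply: (@gaussian_approximate_identity (fun y => K (a + y) - K a) (fun y => `|K (a + y)|) `|K a|).
- by apply: measurable_funB => //; exact: rintegrable_measurable iKa.
- exact: rintegrable_norm.
- by move=> y; exact: ler_normB.
- by rewrite addr0 subrr.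
- apply: cvgB; last exact: cvg_cst.
  apply: (continuous_comp (f := fun y => a + y)); last by rewrite addr0; exact: cK.
  by apply: cvgD; [exact: cvg_cst|exact: cvg_id].
Qed.

Lemma whitham_kernel_even K x : is_whitham_kernel K -> K (- x) = K x.
Proof.
move=> hK; have [->|x0] := eqVneq x 0; first by rewrite oppr0.
have h1 := whitham_kernel_cvg hK x0.
have x0' : - x != 0 by rewrite oppr_eq0.
have h2 := whitham_kernel_cvg hK x0'.
apply: (cvg_unique _ h2) => //; move: h1; apply: cvg_trans; apply: near_eq_cvg.
apply: nearW => n; apply: eq_Rintegral => xi _.
by rewrite mulrN cosN.
Qed.

(* Stands for "f is a mixture of the e^{-t x}, t >= 1": stated by duality, against
   the exponential sums that are nonnegative for all these t. *)
Definition exp_monotone f := forall l, (forall p, p \in l -> 0 < p.2) ->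
  (forall t, 1 <= t -> 0 <= \sum_(p <- l) p.1 * expR (- (t * p.2))) ->
  0 <= \sum_(p <- l) p.1 * f p.2.

(** The points of [l] keep a distance [d > 0] from the origin, so the error term of [mixture_bound]
    vanishes with the width of the Gaussian. *)
Lemma whitham_kernel_exp_monotone K : is_whitham_kernel K -> exp_monotone K.
Proof.
move=> hK l l0 lt.
have [d d0 dl] : exists2 d, 0 < d & forall p, p \in l -> d <= p.2.
  elim: l l0 {lt} => [|p l ih] l0; first by exists 1.
  have [d d0 dl] := ih (fun q ql => l0 q (mem_behead (s := p :: l) ql)).
  have p0 := l0 p (mem_head _ _).
  exists (Num.min d p.2); first by rewrite lt_min d0.
  by move=> q; rewrite inE => /predU1P[->|/dl dq]; rewrite ge_min ?lexx ?orbT ?dq.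
have [_ _ mb] := @mixture_whitham_symbol R.
have H1 : - ((\sum_(p <- l) `|p.1|) * gaussian (sq n) d * whitham_symbol 0) @[n --> \oo] --> (0 : R).
  rewrite -[X in _ --> X]oppr0; apply: cvgN.
  rewrite -[X in _ --> X](mul0r (whitham_symbol 0)); apply: cvgMr_tmp.
  by rewrite -[X in _ --> X](mulr0 (\sum_(p <- l) `|p.1|)); apply: cvgMl_tmp; exact: gaussian_cvg0.
have H2 : \sum_(p <- l) p.1 * gauss_pair (sq n) whitham_symbol p.2 @[n --> \oo] -->
   \sum_(p <- l) p.1 * K p.2.
  rewrite big_seq; under eq_fun do rewrite big_seq.
  apply: cvg_big => //; first by move=> x y; exact: add_continuous.
  move=> p /l0 p0; apply: cvgMl_tmp; apply: whitham_kernel_cvg => //.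
  by rewrite gt_eqF.
rewrite -[leLHS](cvg_lim _ H1)// -[leRHS](cvg_lim _ H2)//.
apply: ler_lim; [by apply/cvg_ex; eexists; exact: H1|by apply/cvg_ex; eexists; exact: H2|].
by apply: nearW => n; exact: mb.
Qed.

(** Gaussians of growing width, scaled to the value 1 at 0, turn the left pairing into the integral
    of [K]; on the frequency side they concentrate at 0, where the symbol is 1. *)
Lemma Rintegral_whitham_kernel K : is_whitham_kernel K -> \int[leb]_x K x = 1.
Proof.
move=> hK; have iK := whitham_kernel_integrable hK.
have [mm [B mB] _] := @mixture_whitham_symbol R.
pose s (n : nat) : R := n.+1%:R.
have s0 n : 0 < s n by rewrite ltr0n.
have s_neq0 n : s n != 0 by rewrite gt_eqF.
have p0 n : normal_peak (s n) != 0 by rewrite gt_eqF// normal_peak_gt0.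
have E n : \int[leb]_x (K x * (gaussian (s n) x / normal_peak (s n))) =
    \int[leb]_xi ((whitham_symbol xi - 1) * gaussian (n.+1%:R^-1) xi) + 1.
  have iKg : rintegrable (fun x => K x * gaussian (s n) x).
    apply: (@rintegrableM_bounded _ _ _ (normal_peak (s n))) => //.
      by apply: continuous_measurable_fun; exact: continuous_gaussian.
    move=> x; rewrite ger0_norm ?gaussian_ge0// gaussianE//.
    exact: normal_pdf_ub.
  have -> : \int[leb]_x (K x * (gaussian (s n) x / normal_peak (s n))) =
     (normal_peak (s n))^-1 * \int[leb]_x (K x * gaussian (s n) (x - 0)).
    rewrite -rintegralZ; last by under [X in rintegrable X]funext do rewrite subr0.
    by apply: eq_Rintegral => x _; rewrite subr0; ring.
  have ig : rintegrable (gaussian (sq n)) by apply: rintegrable_gaussian; rewrite gt_eqF.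
  have imig : rintegrable (fun xi => whitham_symbol xi * gaussian (sq n) xi).
    by under [X in rintegrable X]funext do rewrite mulrC; exact: (rintegrableM_bounded mm mB).
  rewrite (whitham_kernel_gaussian _ hK)// /gauss_pair.
  have -> : \int[leb]_xi (whitham_symbol xi * (gauss_weight (s n) xi * cos (xi * 0))) =
     \int[leb]_xi (normal_peak (s n) * (whitham_symbol xi * gaussian (sq n) xi)).
    by apply: eq_Rintegral => xi _; rewrite mulr0 cos0 mulr1 gauss_weightE// mulrCA.
  rewrite rintegralZ// mulrA mulVf// mul1r.
  have -> : \int[leb]_xi ((whitham_symbol xi - 1) * gaussian n.+1%:R^-1 xi) =
     \int[leb]_xi (whitham_symbol xi * gaussian (sq n) xi - gaussian (sq n) xi).
    by apply: eq_Rintegral => xi _; rewrite mulrBl mul1r.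
  by rewrite rintegralB// Rintegral_gaussian ?subrK// gt_eqF.
have R1 : \int[leb]_x (K x * (gaussian (s n) x / normal_peak (s n))) @[n --> \oo] --> (1 : R).
  suff H : \int[leb]_xi ((whitham_symbol xi - 1) * gaussian (n.+1%:R^-1) xi) + 1 @[n --> \oo] --> (0 + 1 : R).
    move: H; rewrite add0r; apply: cvg_trans; apply: near_eq_cvg.
    by apply: nearW => n; rewrite E.
  apply: cvgD; last exact: cvg_cst.
  apply: (@gaussian_approximate_identity (fun xi => whitham_symbol xi - 1) (fun=> 0) (B + 1)).
  - exact: measurable_funB.
  - exact: integrable0.
  - move=> y; rewrite add0r; apply: le_trans (ler_normB _ _) _.
    by rewrite normr1 lerD2r.
  - by rewrite /whitham_symbol eqxx subrr.
  - by apply: cvgB; [exact: continuous_whitham_symbol0|exact: cvg_cst].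
have gE n x : gaussian (s n) x / normal_peak (s n) = expR (- (x ^+ 2 / (s n ^+ 2 *+ 2))).
  by rewrite /gaussian mulrC mulrA mulVf// mul1r.
have R2 : \int[leb]_x (K x * (gaussian (s n) x / normal_peak (s n))) @[n --> \oo] --> \int[leb]_x K x.
  apply: (Rintegral_dominated (g := fun x => `|K x|) _ _ _ _).2.
  - move=> n; apply: measurable_funM; first exact: rintegrable_measurable.
    apply: measurable_funM => //.
    by apply: continuous_measurable_fun; exact: continuous_gaussian.
  - move=> x; rewrite -[X in _ --> X]mulr1; apply: cvgMl_tmp.
    under eq_fun do rewrite gE.
    rewrite -(@expR0 R); apply: (cvg_comp _ expR); last exact: continuous_expR.
    rewrite -oppr0; apply: cvgN.
    apply: (@squeeze_cvgr _ _ _ _ (cst 0) (fun n => x ^+ 2 * n.+1%:R^-1)).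
    + apply: nearW => n; rewrite divr_ge0 ?sqr_ge0 ?mulrn_wge0 ?sqr_ge0//=.
      rewrite ler_wpM2l ?sqr_ge0// lef_pV2 ?posrE ?ltr0n// ?mulrn_wgt0 ?exprn_gt0//.
      apply: (@le_trans _ _ (s n ^+ 2)); last by rewrite mulr2n lerDl sqr_ge0.
      by rewrite expr2 ler_peMl// ler1n.
    + exact: cvg_cst.
    + by rewrite -(mulr0 (x ^+ 2)); apply: cvgMl_tmp; exact: cvg_harmonic.
  - exact: rintegrable_norm.
  - move=> n x; rewrite normrM ler_piMr// gE ger0_norm ?expR_ge0//.
    by rewrite expR_le1 oppr_le0 divr_ge0 ?sqr_ge0// mulrn_wge0// sqr_ge0.
exact: (cvg_unique _ R2 R1).
Qed.

End kernel_properties.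

(** * Consequences of exponential monotonicity, each from one finite sum of exponentials *)

Section exp_monotone_functions.
Context {R : realType}.
Implicit Types (s t a b c d x y h w p : R) (f : R -> R).

Lemma exp_monotone_ge0 f x : exp_monotone f -> 0 < x -> 0 <= f x.
Proof.
move=> hf x0; have := hf [:: (1, x)]; rewrite !big_seq1 mul1r; apply.
  by move=> q; rewrite inE => /eqP ->.
by move=> t _; rewrite big_seq1 mul1r expR_ge0.
Qed.

Lemma exp_monotone_decay f x h : exp_monotone f -> 0 < x -> 0 <= h ->
  f (x + h) <= expR (- h) * f x.
Proof.
move=> hf x0 h0; have := hf [:: (expR (- h), x); (-1, x + h)].
rewrite !big_cons !big_nil /= addr0 mulN1r subr_ge0; apply.
  by move=> q; rewrite !inE => /orP[|] /eqP -> //=; lra.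
move=> t t1; rewrite !big_cons !big_nil /= addr0 mulN1r subr_ge0 -expRD ler_expR.
have : h <= t * h by rewrite ler_peMl.
lra.
Qed.

Lemma exp_monotone_nincr f x y : exp_monotone f -> 0 < x -> x <= y -> f y <= f x.
Proof.
move=> hf x0 xy; rewrite -(subrK x y) addrC.
apply: le_trans (exp_monotone_decay hf x0 _) _; first by rewrite subr_ge0.
by rewrite ler_piMl ?exp_monotone_ge0// expR_le1; lra.
Qed.

(** Convexity as monotonicity of chord slopes; with denominators cleared, degenerate chords are
    allowed. *)
Definition nincr_slopes f a b c d := (f c - f d) * (b - a) <= (f a - f b) * (d - c).

Lemma exp_monotone_slopes f a b c d : exp_monotone f ->
  0 < a -> a <= b -> b <= c -> c <= d -> nincr_slopes f a b c d.
Proof.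
move=> hf a0 ab bc cd.
have := hf [:: (d - c, a); (- (d - c), b); (- (b - a), c); (b - a, d)].
rewrite /nincr_slopes !big_cons !big_nil /= => H.
rewrite -subr_ge0 (_ : _ - _ = (d - c) * f a + (- (d - c) * f b + (- (b - a) * f c + ((b - a) * f d + 0)))); last by ring.
apply: H.
  by move=> q; rewrite !inE => /or4P[] /eqP -> //=; lra.
move=> t t1; rewrite !big_cons !big_nil /=.
(* Both chords of [e^(-t x)] are compared with its tangent slope at [c]. *)
have E1 : (b - a) * t * expR (- (t * c)) <= expR (- (t * a)) - expR (- (t * b)).
  have -> : expR (- (t * a)) = expR (- (t * b)) * expR (t * (b - a)).
    by rewrite -expRD; congr expR; ring.
  apply: (@le_trans _ _ ((b - a) * t * expR (- (t * b)))).
    apply: ler_wpM2l; first by rewrite mulr_ge0; lra.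
    by rewrite ler_expR lerN2 ler_wpM2l//; lra.
  have := expR_ge1Dx (t * (b - a)) => h.
  have := ler_wpM2l (expR_ge0 (- (t * b))) h; lra.
have E2 : expR (- (t * c)) - expR (- (t * d)) <= (d - c) * t * expR (- (t * c)).
  have -> : expR (- (t * d)) = expR (- (t * c)) * expR (- (t * (d - c))).
    by rewrite -expRD; congr expR; ring.
  have := expR_ge1Dx (- (t * (d - c))) => h.
  have := ler_wpM2l (expR_ge0 (- (t * c))) h; lra.
have h1 : 0 <= b - a by lra.
have h2 : 0 <= d - c by lra.
have := ler_wpM2l h2 E1; have := ler_wpM2l h1 E2; lra.
Qed.

(** The second difference of [e^(-t x)] is [2 cosh (t h) - 2] times its value, and [t >= 1]. This
    quantifies strict convexity, from which the strict decrease of the periodized kernel up to the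
    midpoint is drawn. *)
Lemma exp_monotone_diff2_ge f x h : exp_monotone f -> 0 < h -> h < x ->
  (expR h + expR (- h) - 2) * f x <= f (x - h) + f (x + h) - 2 * f x.
Proof.
move=> hf h0 hx.
have := hf [:: (1, x - h); (1, x + h); (- (expR h + expR (- h)), x)].
rewrite !big_cons !big_nil /= => H.
rewrite -subr_ge0 (_ : _ - _ = 1 * f (x - h) + (1 * f (x + h) + (- (expR h + expR (- h)) * f x + 0))); last by ring.
apply: H; first by move=> q; rewrite !inE => /or3P[] /eqP -> //=; lra.
move=> t t1; rewrite !big_cons !big_nil /=.
have -> : expR (- (t * (x - h))) = expR (- (t * x)) * expR (t * h).
  by rewrite -expRD; congr expR; ring.
have -> : expR (- (t * (x + h))) = expR (- (t * x)) * expR (- (t * h)).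
  by rewrite -expRD; congr expR; ring.
rewrite [leRHS](_ : _ = expR (- (t * x)) * (expR (t * h) + expR (- (t * h)) - (expR h + expR (- h)))); last by ring.
apply: mulr_ge0; first exact: expR_ge0.
(* cosh is increasing: (u - v)(1 - 1/(uv)) >= 0 for u >= v >= 1 *)
rewrite !expRN; set u := expR (t * h); set v := expR h.
have v0 : 0 < v by exact: expR_gt0.
have u0 : 0 < u by exact: expR_gt0.
have v1 : 1 <= v by rewrite -[leLHS]expR0 ler_expR ltW.
have uv : v <= u by rewrite ler_expR ler_peMl// ltW.
rewrite (_ : _ - _ = (u - v) * (u * v - 1) / (u * v)); last first.
  by field; rewrite !gt_eqF.
rewrite divr_ge0 ?mulr_ge0 ?(ltW u0) ?(ltW v0)//; first by lra.
have : 1 * 1 <= u * v by apply: ler_pM => //; lra.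
lra.
Qed.

(** A zero spreads to the right by monotonicity, and to the left by repeated steps of ratio 2/3; so
    it would reach [y]. *)
Lemma exp_monotone_gt0 f x : exp_monotone f -> (exists2 y, 0 < y & f y != 0) ->
  0 < x -> 0 < f x.
Proof.
move=> hf [y y0 fy] x0; rewrite lt_def exp_monotone_ge0// andbT.
apply/negP => /eqP fx0.
(* AM-GM: f vanishes at w as soon as it vanishes at 3 w / 2. *)
have step w : 0 < w -> f (3 * w) = 0 -> f (2 * w) = 0.
  move=> w0 f3; apply/eqP; rewrite eq_le exp_monotone_ge0 ?mulr_gt0// andbT.
  apply/ler_addgt0Pl => e e0; rewrite addr0.
  have fw0 := exp_monotone_ge0 hf w0.
  (* The sum tested below says [2 q^2 <= A q^3 + q / A] for [q = e^(-t w)]. As [f] vanishes at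
     [3 w], a large [A] makes [f (2 w)] arbitrarily small. *)
  pose A := f w / e + 1.
  have A0 : 0 < A by rewrite ltr_wpDl// divr_ge0// ltW.
  have : 2 * f (2 * w) <= A * f (3 * w) + A^-1 * f w.
    have := hf [:: (A, 3 * w); (A^-1, w); (- 2, 2 * w)].
    rewrite !big_cons !big_nil /= => H.
    rewrite -subr_ge0 (_ : _ - _ = A * f (3 * w) + (A^-1 * f w + (- 2 * f (2 * w) + 0))); last by ring.
    apply: H; first by move=> q; rewrite !inE => /or3P[] /eqP -> //=; lra.
    move=> t t1; rewrite !big_cons !big_nil /=.
    have -> : expR (- (t * (3 * w))) = expR (- (t * w)) ^+ 3.
      by rewrite -expRM_natl; congr expR; ring.
    have -> : expR (- (t * (2 * w))) = expR (- (t * w)) ^+ 2.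
      by rewrite -expRM_natl; congr expR; ring.
    set q := expR _; have q0 : 0 < q by exact: expR_gt0.
    rewrite [leRHS](_ : _ = q * A^-1 * (A * q - 1) ^+ 2); last by field; rewrite gt_eqF.
    by rewrite mulr_ge0 ?sqr_ge0// mulr_ge0 ?invr_ge0// ltW.
  rewrite f3 mulr0 add0r.
  have : A^-1 * f w <= e.
    rewrite mulrC ler_pdivrMr// /A mulrDr mulrCA divff ?gt_eqF// mulr1 mulr1.
    by rewrite lerDl ltW.
  by have := exp_monotone_ge0 hf (mulr_gt0 (ltr0n _ 2) w0); lra.
have down n : f ((2 / 3) ^+ n * x) = 0.
  elim: n => [|n ih]; first by rewrite expr0 mul1r.
  have := step ((2 / 3) ^+ n * x / 3) _ _.
  rewrite exprS (_ : 2 * ((2 / 3) ^+ n * x / 3) = 2 / 3 * (2 / 3) ^+ n * x); last by field.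
  apply; first by rewrite divr_gt0// mulr_gt0// exprn_gt0// divr_gt0.
  by rewrite mulrCA divff ?mulr1// ih.
have [n hn] : exists n, (2 / 3) ^+ n * x <= y.
  have : (2 / 3) ^+ n * x @[n --> \oo] --> 0.
    rewrite -[X in _ --> X](mul0r x); apply: cvgMr_tmp; apply: cvg_expr.
    by rewrite ger0_norm; lra.
  move/cvgr0Pnorm_lt/(_ _ y0) => [n _ /(_ n (leqnn n)) h].
  by exists n; apply: le_trans (ler_norm _) _; exact: ltW.
have xn0 : 0 < (2 / 3) ^+ n * x by rewrite mulr_gt0// exprn_gt0// divr_gt0.
have := exp_monotone_nincr hf xn0 hn; rewrite down => fy0.
by move/eqP: fy; apply; apply/eqP; rewrite eq_le fy0 exp_monotone_ge0.
Qed.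

(** For one exponential the second difference is at most [(t h)^2 e^(t h)] times its value at [x];
    passing from [x] to [x / 2] gains a factor [e^(t x / 2)] that absorbs the growth in [t]. The
    constant 64 comes from squaring [t x / 8 <= e^(t x / 8)], and [h <= x / 4] takes care of
    [e^(t h)]. *)
Lemma exp_monotone_diff2_le f x h : exp_monotone f -> 0 < h -> h <= x / 4 ->
  f (x - h) + f (x + h) - 2 * f x <= (64 / x ^+ 2) * h ^+ 2 * f (x / 2).
Proof.
move=> hf h0 hx; have x0 : 0 < x by lra.
have := hf [:: ((64 / x ^+ 2) * h ^+ 2, x / 2); (-1, x - h); (-1, x + h); (2, x)].
rewrite !big_cons !big_nil /= => H.
rewrite -subr_ge0 (_ : _ - _ = 64 / x ^+ 2 * h ^+ 2 * f (x / 2) +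
     (-1 * f (x - h) + (-1 * f (x + h) + (2 * f x + 0)))); last by ring.
apply: H; first by move=> q; rewrite !inE => /or4P[] /eqP -> //=; lra.
move=> t t1; rewrite !big_cons !big_nil /=.
have -> : expR (- (t * (x - h))) = expR (- (t * x)) * expR (t * h).
  by rewrite -expRD; congr expR; ring.
have -> : expR (- (t * (x + h))) = expR (- (t * x)) * (expR (t * h))^-1.
  by rewrite -expRN -expRD; congr expR; ring.
have -> : expR (- (t * (x / 2))) = expR (- (t * x)) * expR (t * x / 2).
  by rewrite -expRD; congr expR; field.
set E := expR (- (t * x)); set u := expR (t * h).
have E0 : 0 < E by exact: expR_gt0.
have u0 : 0 < u by exact: expR_gt0.
have th0 : 0 < t * h by rewrite mulr_gt0//; lra.
have B1 : u + u^-1 - 2 <= (t * h) ^+ 2 * u.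
  rewrite (_ : _ - 2 = (1 - u^-1) ^+ 2 * u); last by field; rewrite gt_eqF.
  rewrite ler_wpM2r ?(ltW u0)//.
  have h1 : 0 <= 1 - u^-1.
    by rewrite subr_ge0 invf_le1// -[leLHS]expR0 ler_expR ltW.
  have h2 : 1 - u^-1 <= t * h.
    by rewrite -expRN; have := expR_ge1Dx (- (t * h)); lra.
  by rewrite ler_sqr ?nnegrE// ltW.
have B2 : t ^+ 2 * u <= 64 / x ^+ 2 * expR (t * x / 2).
  have tx0 : 0 < t * x by rewrite mulr_gt0//; lra.
  have e8 : t * x / 8 <= expR (t * x / 8) by have := expR_ge1Dx (t * x / 8); lra.
  have e4 : t ^+ 2 <= 64 / x ^+ 2 * expR (t * x / 4).
    rewrite (_ : t * x / 4 = 2%:R * (t * x / 8)); last by field.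
    rewrite expRM_natl (_ : t ^+ 2 = 64 / x ^+ 2 * (t * x / 8) ^+ 2); last by field; rewrite gt_eqF.
    apply: ler_wpM2l; first by rewrite divr_ge0// sqr_ge0.
    by rewrite ler_sqr ?nnegrE ?expR_ge0// divr_ge0// ltW.
  have u4 : u <= expR (t * x / 4) by rewrite ler_expR -mulrA ler_wpM2l//; lra.
  apply: le_trans (ler_pM (sqr_ge0 _) (ltW u0) e4 u4) _.
  rewrite [leLHS](_ : _ = 64 / x ^+ 2 * (expR (t * x / 4) * expR (t * x / 4))); last by ring.
  by rewrite -expRD (_ : t * x / 4 + _ = t * x / 2)//; field.
have := ler_wpM2l (sqr_ge0 h) B2 => B3.
have B4 : 0 <= 64 / x ^+ 2 * h ^+ 2 * expR (t * x / 2) - (u + u^-1 - 2).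
  have -> : 64 / x ^+ 2 * h ^+ 2 * expR (t * x / 2) = h ^+ 2 * (64 / x ^+ 2 * expR (t * x / 2)) by ring.
  have E1 : (t * h) ^+ 2 * u = h ^+ 2 * (t ^+ 2 * u) by ring.
  by rewrite E1 in B1; lra.
have := mulr_ge0 (ltW E0) B4; congr (_ <= _); ring.
Qed.

(** Convexity puts every left difference quotient below every right one, and the bound on second
    differences makes them differ by at most [C * h]; both sides therefore converge to the infimum
    of the right quotients. *)
Lemma exp_monotone_derivable f x : exp_monotone f -> 0 < x -> derivable f x 1.
Proof.
move=> hf x0.
pose D h := (f (x + h) - f x) / h.
pose C := 64 / x ^+ 2 * f (x / 2).
have DN h k : 0 < h -> h <= x / 4 -> 0 < k -> D (- h) <= D k.
  move=> h0 hx k0; have x1 : 0 < x - h by lra.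
  have h1 : x - h <= x by lra.
  have k1 : x <= x + k by lra.
  have := exp_monotone_slopes hf x1 h1 (lexx _) k1.
  rewrite /nincr_slopes /D invrN mulrN -mulNr ler_pdivrMr// mulrAC ler_pdivlMr//.
  lra.
have DC h : 0 < h -> h <= x / 4 -> D h - D (- h) <= C * h.
  move=> h0 hx; have := exp_monotone_diff2_le hf h0 hx.
  rewrite /D /C => H; have -> : (f (x + h) - f x) / h - (f (x - h) - f x) / - h =
    (f (x - h) + f (x + h) - 2 * f x) / h by field; rewrite gt_eqF.
  rewrite ler_pdivrMr//; lra.
pose S := [set D h | h in [set h | 0 < h <= x / 4]].
have x4 : 0 < x / 4 by rewrite divr_gt0.
have S0 : S !=set0 by exists (D (x / 4)); exists (x / 4) => //=; rewrite x4 lexx.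
have lbS h : 0 < h -> h <= x / 4 -> lbound S (D (- h)).
  by move=> h0 hx _ [k /= /andP[k0 kx] <-]; exact: DN.
pose L := inf S.
have LD h : 0 < h -> h <= x / 4 -> D (- h) <= L <= D h.
  move=> h0 hx; apply/andP; split; first by apply: lb_le_inf => //; exact: lbS.
  apply: ge_inf; first by exists (D (- (x / 4))); exact: lbS.
  by exists h => //=; rewrite h0.
have C0 : 0 <= C by rewrite mulr_ge0 ?divr_ge0 ?sqr_ge0// exp_monotone_ge0// divr_gt0.
have DL h : h != 0 -> `|h| <= x / 4 -> `|D h - L| <= C * `|h|.
  move=> h0 hx; have [hp|hn] := ltP 0 h.
    rewrite gtr0_norm// in hx *; have := LD h hp hx; have := DC h hp hx => dc /andP[l1 l2].
    by rewrite ger0_norm; lra.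
  have hn' : 0 < - h by rewrite oppr_gt0 lt_neqAle h0.
  rewrite ltr0_norm -?oppr_gt0// in hx *.
  have := LD _ hn' hx; have := DC _ hn' hx; rewrite opprK => dc /andP[l1 l2].
  by rewrite ler0_norm; lra.
apply/cvg_ex; exists L => /=.
apply/cvgrPdist_le => e e0; near=> h.
have h0 : h != 0 by near: h; exact: nbhs_dnbhs_neq.
have hx : `|h| <= x / 4 by near: h; apply: dnbhs0_le.
have -> : h^-1 *: (f (h *: (1 : R) + x) - f x) = D h.
  by rewrite /D scaler1 (addrC h) mulrC.
rewrite distrC; apply: le_trans (DL h h0 hx) _.
have : `|h| <= e / (C + 1) by near: h; apply: dnbhs0_le; rewrite divr_gt0// ltr_wpDl.
rewrite ler_pdivlMr ?ltr_wpDl// => H; have := normr_ge0 h; nra.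
Unshelve. all: end_near. Qed.

Definition half_sum f p x := limn (series (fun n : nat => f (x + n%:R * p))).

Lemma half_sum_cvg f p x : exp_monotone f -> 0 < p -> 0 < x ->
  cvgn (series (fun n : nat => f (x + n%:R * p))).
Proof.
move=> hf p0 x0.
have np n : 0 <= n%:R * p by rewrite mulr_ge0// ltW.
apply: (@series_le_cvg _ _ (geometric (f x) (expR (- p)))).
- by move=> n; apply: exp_monotone_ge0 => //; rewrite ltr_wpDr.
- by move=> n; rewrite /geometric/= mulr_ge0 ?exprn_ge0 ?expR_ge0 ?exp_monotone_ge0.
- move=> n; apply: le_trans (exp_monotone_decay hf x0 (np n)) _.
  by rewrite /geometric/= mulrC -mulrN expRM_natl.
- by apply: is_cvg_geometric_series; rewrite ger0_norm ?expR_ge0// expR_lt1 oppr_lt0.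
Qed.

(** A translation by [n p] multiplies [e^(-t x)] by a positive factor, so the sign condition on the
    test sums is preserved term by term. *)
Lemma half_sum_exp_monotone f p : exp_monotone f -> 0 < p -> exp_monotone (half_sum f p).
Proof.
move=> hf p0 l l0 lt.
have np n : 0 <= n%:R * p by rewrite mulr_ge0// ltW.
have term n : 0 <= \sum_(q <- l) q.1 * f (q.2 + n%:R * p).
  have := hf [seq (q.1, q.2 + n%:R * p) | q <- l]; rewrite big_map; apply.
    by move=> _ /mapP[q /l0 q0 ->] /=; rewrite ltr_wpDr.
  move=> t t1; rewrite big_map /=.
  rewrite (eq_bigr (fun q => expR (- (t * (n%:R * p))) * (q.1 * expR (- (t * q.2))))).
    by rewrite -mulr_sumr mulr_ge0 ?expR_ge0 ?lt.
  by move=> q _; rewrite mulrCA -expRD; congr (_ * expR _); ring.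
have H : \sum_(q <- l) q.1 * series (fun n : nat => f (q.2 + n%:R * p)) N @[N --> \oo] -->
   \sum_(q <- l) q.1 * half_sum f p q.2.
  rewrite big_seq; under eq_fun do rewrite big_seq.
  apply: cvg_big => //; first by move=> x y; exact: add_continuous.
  by move=> q /l0 q0; apply: cvgMl_tmp; exact: half_sum_cvg.
rewrite -[leRHS](cvg_lim _ H)//; apply: limr_ge; first by apply/cvg_ex; eexists; exact: H.
apply: nearW => N; rewrite /series/=.
under eq_bigr do rewrite mulr_sumr.
by rewrite exchange_big/= sumr_ge0.
Qed.

Lemma half_sum_split f p x (N : nat) : exp_monotone f -> 0 < p -> 0 < x ->
  half_sum f p x = \sum_(0 <= n < N) f (x + n%:R * p) + half_sum f p (x + N%:R * p).
Proof.
move=> hf p0 x0; have x1 : 0 < x + N%:R * p by rewrite ltr_wpDr// mulr_ge0// ltW.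
have H := half_sum_cvg hf p0 x1; have H0 := half_sum_cvg hf p0 x0.
apply: (@cvg_lim _ _ _ _ _ _ _ _) => //.
rewrite -(cvg_shiftn N).
apply: (@cvg_trans _ ((fun m => \sum_(0 <= n < N) f (x + n%:R * p) +
   series (fun n : nat => f (x + N%:R * p + n%:R * p)) m) @ \oo)).
  apply: near_eq_cvg; apply: nearW => m.
  rewrite /series/= (@big_cat_nat _ _ _ N 0 (m + N)) ?leq_addl//=; congr (_ + _).
  rewrite -[X in _ = \sum_(X <= _ < _) _](add0n N) big_addn addnK; apply: eq_bigr => i _.
  by rewrite natrD mulrDl addrAC addrA.
by apply: cvgD; [exact: cvg_cst|exact: H].
Qed.

End exp_monotone_functions.

(** * The kernel on half a period, for finite and infinite period alike *)

Section kernel_profile.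
Context {R : realType}.
Implicit Types (a b c d x y e h p eta kappa : R) (k K f : R -> R) (P : \bar R).

(* The features of the kernel on half a period (K itself when P = +oo, its
   periodization otherwise) on which the argument relies. *)
Definition kernel_profile P k :=
  [/\ forall a b c d, 0 < a -> a <= b -> b <= c -> c <= d -> (d%:E < P)%E ->
        nincr_slopes k a b c d,
      forall c d, 0 < c -> c < d -> ((2 * d)%:E <= P)%E -> k d < k c
    & forall p x, P = p%:E -> 0 < x -> x < p -> k (p - x) = k x].

Lemma kernel_profile_pinfty K : exp_monotone K ->
  (forall x, 0 < x -> 0 < K x) -> kernel_profile +oo K.
Proof.
move=> hK K0; split=> // [a b c d a0 ab bc cd _|c d c0 cd _].
  exact: exp_monotone_slopes.
have cd' : 0 <= d - c by lra.
have := exp_monotone_decay hK c0 cd'; rewrite (addrC c) subrK => h.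
apply: le_lt_trans h _; rewrite gtr_pMl ?K0// expR_lt1; lra.
Qed.

Lemma kernel_profile_fin f p : exp_monotone f -> (forall x, 0 < x -> 0 < f x) -> 0 < p ->
  kernel_profile p%:E (fun x => f x + f (p - x)).
Proof.
move=> hf f0 p0.
have slopes a b c d : 0 < a -> a <= b -> b <= c -> c <= d -> d < p ->
    nincr_slopes (fun x => f x + f (p - x)) a b c d.
  move=> a0 ab bc cd dp.
  have h1 := exp_monotone_slopes hf a0 ab bc cd.
  have d0' : 0 < p - d by lra.
  have dc' : p - d <= p - c by lra.
  have cb' : p - c <= p - b by lra.
  have ba' : p - b <= p - a by lra.
  have h2 := exp_monotone_slopes hf d0' dc' cb' ba'.
  rewrite /nincr_slopes in h1 h2 *; lra.
split.
- by move=> a b c d a0 ab bc cd; rewrite lte_fin => dp; exact: slopes.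
- move=> c d c0 cd; rewrite lee_fin => dp.
  (* Strict decrease towards the midpoint comes from strict convexity and the symmetry; monotone
     chord slopes then carry it to [c < d < p / 2]. *)
  have half e : 0 < e -> e < p / 2 -> f (p / 2) + f (p - p / 2) < f e + f (p - e).
    move=> e0 ep; have h0 : 0 < p / 2 - e by lra.
    have h1 : p / 2 - e < p / 2 by lra.
    have := exp_monotone_diff2_ge hf h0 h1.
    rewrite (_ : p / 2 - (p / 2 - e) = e); last by ring.
    rewrite (_ : p / 2 + (p / 2 - e) = p - e); last by field.
    rewrite (_ : p - p / 2 = p / 2); last by field.
    set h := p / 2 - e in h0 *.
    have fp : 0 < f (p / 2) by rewrite f0// divr_gt0.
    have ch : 0 < expR h + expR (- h) - 2.
      have h01 : h != 0 by rewrite gt_eqF.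
      have h02 : - h != 0 by rewrite oppr_eq0.
      by have := expR_gt1Dx h01; have := expR_gt1Dx h02; lra.
    by have := mulr_gt0 ch fp; lra.
  have [dp2|dp2] := ltP d (p / 2); last first.
    have -> : d = p / 2 by lra.
    by apply: half => //; lra.
  have d0 : 0 < d by lra.
  have hd := half d d0 dp2.
  have := slopes c d d (p / 2) c0 (ltW cd) (lexx _) (ltW dp2).
  rewrite /nincr_slopes => /(_ _) H.
  have p2 : p / 2 < p by lra.
  have {}H := H p2.
  have l0 : 0 < d - c by lra.
  have := mulr_gt0 _ l0 => /(_ (f d + f (p - d) - (f (p / 2) + f (p - p / 2)))) H2.
  have {}H2 := H2 _; rewrite subr_gt0 in H2; have {}H2 := H2 hd.
  have := lt_le_trans H2 H.
  rewrite pmulr_lgt0; last by lra.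
  by rewrite subr_gt0.
- move=> _ x [<-] x0 xp; have -> : p - (p - x) = x by lra.
  exact: addrC.
Qed.

Section profile_theory.
Variables (P : \bar R) (k : R -> R).
Hypothesis hk : kernel_profile P k.

Lemma profile_lt c d : 0 < c -> c < d -> ((2 * d)%:E <= P)%E -> k d < k c.
Proof. by case: hk => _ + _; exact. Qed.

Lemma profile_le c d : 0 < c -> c <= d -> ((2 * d)%:E <= P)%E -> k d <= k c.
Proof.
move=> c0; rewrite le_eqVlt => /predU1P[-> //|cd dP].
by rewrite ltW// profile_lt.
Qed.

Lemma profile_incr u v eta : 0 < u -> u <= v -> 0 < eta -> ((v + eta)%:E < P)%E ->
  k v - k (v + eta) <= k u - k (u + eta).
Proof.
case: hk => hs _ _ u0 uv eta0 vP.
have [h|h] := leP (u + eta) v.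
  have ue : u <= u + eta by lra.
  have ve : v <= v + eta by lra.
  have := hs u (u + eta) v (v + eta) u0 ue h ve vP.
  by rewrite /nincr_slopes !(addrAC _ eta) !subrr !add0r ler_pM2r.
(* The intervals overlap: the chords over [[u, v]] and [[u + eta, v + eta]], also of equal length,
   are compared instead. *)
move: uv; rewrite le_eqVlt => /predU1P[->//|uv].
have ue : u + eta <= v + eta by lra.
have := hs u v (u + eta) (v + eta) u0 (ltW uv) (ltW h) ue vP.
rewrite /nincr_slopes (_ : v + eta - (u + eta) = v - u); last by ring.
by rewrite ler_pM2r ?subr_gt0//; lra.
Qed.

(** A chord lying to the left of the fixed chord over [[c, d]] is at least as steep. The bound is
    linear in [h], ready for division by [h]. *)
Lemma profile_slope c d y h : 0 < h -> h < y -> y + h <= c -> c < d -> (d%:E < P)%E ->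
  2 * h * ((k c - k d) / (d - c)) <= k (y - h) - k (y + h).
Proof.
case: hk => hs _ _ h0 hy yc cd dP.
have y0 : 0 < y - h by lra.
have yh : y - h <= y + h by lra.
have := hs _ _ _ _ y0 yh yc (ltW cd) dP; rewrite /nincr_slopes.
rewrite (_ : y + h - (y - h) = 2 * h); last by ring.
rewrite [in X in _ -> X](_ : 2 * h * _ = (k c - k d) * (2 * h) / (d - c)); last by ring.
by rewrite ler_pdivrMr ?subr_gt0.
Qed.

(* Folding x + y across P / 2 (when P is finite), both |x - y| and x + y lie in
   ]0, P / 2], at distance at least eta. *)
Lemma profile_gap x a b : 0 < x -> ((2 * x)%:E < P)%E -> 0 < a -> a <= b ->
  ((2 * b)%:E < P)%E ->
  exists2 kappa, 0 < kappa &
    forall y, a <= y -> y <= b -> y != x -> kappa <= k `|x - y| - k (x + y).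
Proof.
move=> x0 xP a0 ab bP.
have gap E eta : 0 < eta -> eta < E -> ((2 * E)%:E <= P)%E -> (E%:E < P)%E ->
   forall d e, 0 < d -> d + eta <= e -> e <= E -> k (E - eta) - k E <= k d - k e.
  move=> eta0 etaE E2 EP d e d0 de eE.
  have h1 : d <= E - eta by lra.
  have := profile_incr d0 h1 eta0; rewrite subrK => /(_ EP) h2.
  have dp : 0 < d + eta by lra.
  have e2P : ((2 * e)%:E <= P)%E.
    by apply: le_trans E2; rewrite lee_fin; lra.
  have := profile_le dp de e2P; lra.
case: P hk xP bP gap => [p| |] hk' xP bP gap.
- rewrite !lte_fin in xP bP.
  (* The two arguments differ by [2 * min x y], or by [p - 2 * max x y] once [x + y] is folded
     across the midpoint. *)
  pose eta := Num.min (Num.min (2 * x) (2 * a)) (Num.min (p - 2 * x) (p - 2 * b)) / 2.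
  have eta0 : 0 < eta by rewrite divr_gt0// !lt_min; apply/andP; split; apply/andP; split; lra.
  have [[e1 e2] [e3 e4]] : (2 * eta <= 2 * x /\ 2 * eta <= 2 * a) /\
      (2 * eta <= p - 2 * x /\ 2 * eta <= p - 2 * b).
    rewrite /eta (mulrC 2) divfK//; split; split.
    + by rewrite !ge_min lexx.
    + by rewrite !ge_min lexx !orbT.
    + by rewrite !ge_min lexx !orbT.
    + by rewrite !ge_min lexx !orbT.
  have etaE : eta < p / 2 by lra.
  have E2 : ((2 * (p / 2))%:E <= p%:E)%E by rewrite lee_fin; lra.
  have EP : ((p / 2)%:E < p%:E)%E by rewrite lte_fin; lra.
  exists (k (p / 2 - eta) - k (p / 2)).
    rewrite subr_gt0; case: hk' => _ + _; apply => //; lra.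
  move=> y ay yb yx.
  have d0 : 0 < `|x - y| by rewrite normr_gt0 subr_eq0 eq_sym.
  have [xy|xy] := leP (x + y) (p / 2).
    by apply: (gap (p / 2) eta) => //; have [|] := ger0P (x - y); lra.
  have -> : k (x + y) = k (p - (x + y)).
    by case: hk' => _ _ ->//; lra.
  by apply: (gap (p / 2) eta) => //; have [|] := ger0P (x - y); lra.
- pose eta := Num.min x a.
  have eta0 : 0 < eta by rewrite lt_min x0.
  have e1 : eta <= x by rewrite ge_min lexx.
  have e2 : eta <= a by rewrite ge_min lexx orbT.
  exists (k (x + b - eta) - k (x + b)).
    rewrite subr_gt0; case: hk' => _ + _; apply; rewrite ?leey//; lra.
  move=> y ay yb yx.
  have d0 : 0 < `|x - y| by rewrite normr_gt0 subr_eq0 eq_sym.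
  apply: (gap (x + b) eta) => //; rewrite ?leey ?ltry//; try lra.
  by have [|] := ger0P (x - y); lra.
- by move: bP; rewrite ltNge leNye.
Qed.

End profile_theory.

End kernel_profile.

(** * The folded convolution *)

Section folded_convolution.
Context {R : realType}.
Local Notation leb := (@lebesgue_measure R).
Implicit Types (a b x y p kappa : R) (f g K : R -> R).

(** One point is exempted because [K (x - y)] takes the unspecified value [K 0] at [y = x]. *)
Lemma le_rintegral_off1 f g x : rintegrable f -> rintegrable g ->
  (forall y, y != x -> f y <= g y) -> \int[leb]_y f y <= \int[leb]_y g y.
Proof.
move=> fi gi fg.
have E h : rintegrable h -> \int[leb]_y h y = \int[leb]_(y in setT `\ x) h y.
  move=> hi; rewrite /Rintegral integral_setD1//.
    exact: measurableD.
  by apply/measurable_EFinP/measurable_funTS; exact: rintegrable_measurable.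
have mD : measurable (setT `\ x : set (measurableTypeR R)) by exact: measurableD.
rewrite (E f fi) (E g gi); apply: le_Rintegral => //.
- exact: integrableS fi.
- exact: integrableS gi.
- by move=> y [_ /eqP yx]; exact: fg.
Qed.

(** Writes restriction to an interval as a factor, so that integrals over different intervals
    combine as integrals over the whole line. *)
Definition bool_ind (b : bool) : R := b%:R.

Lemma measurable_bool_ind_itv (i : interval R) :
  measurable_fun setT (fun y => bool_ind (y \in i)).
Proof.
rewrite (_ : (fun y => bool_ind (y \in i)) = \1_[set` i]); first exact: measurable_indic.
by apply/funext => y; rewrite indicE /bool_ind; congr (_%:R); rewrite mem_setE.
Qed.

Lemma rintegrable_ind f (i : interval R) : rintegrable f ->
  rintegrable (fun y => bool_ind (y \in i) * f y).
Proof.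
move=> fi; under [X in rintegrable X]funext do rewrite mulrC.
apply: (@rintegrableM_bounded _ _ _ 1) => //; first exact: measurable_bool_ind_itv.
by move=> y; rewrite /bool_ind; case: (_ \in _); rewrite ?normr1 ?normr0.
Qed.

Lemma Rintegral_ind f (i : interval R) :
  \int[leb]_y (bool_ind (y \in i) * f y) = \int[leb]_(y in [set` i]) f y.
Proof.
rewrite [RHS]Rintegral_mkcond; apply: eq_Rintegral => y _.
rewrite /restrict /bool_ind mem_setE; case: (_ \in _); first by rewrite mul1r.
by rewrite mul0r.
Qed.

Lemma rintegrable_continuous_ind g a b : continuous g ->
  rintegrable (fun y => bool_ind (y \in `[a, b]) * g y).
Proof.
move=> cg; have := bounded_rintegrable_itv a b cg.
rewrite integrable_mkcond//; congr (integrable _ _ _); apply/funext => y /=.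
rewrite /restrict /bool_ind mem_setE.
by case: (_ \in _); rewrite ?mul1r ?mul0r.
Qed.

Section fold.
Variables (K g : R -> R) (G : R).
Hypothesis iK : rintegrable K.
Hypothesis Keven : forall x, K (- x) = K x.
Hypothesis cg : continuous g.
Hypothesis gG : forall y, `|g y| <= G.
Hypothesis godd : forall y, g (- y) = - g y.

Let g0 : g 0 = 0.
Proof. by have := godd 0; rewrite oppr0; lra. Qed.

Let mg : measurable_fun setT g. Proof. exact: continuous_measurable_fun. Qed.

Let iKM x : rintegrable (fun y => K (x - y) * g y).
Proof.
apply: (rintegrableM_bounded mg gG).
exact: (rintegrable_opp (rintegrable_shift x iK)).
Qed.

Let iKP x : rintegrable (fun y => K (x + y) * g y).
Proof. by apply: (rintegrableM_bounded mg gG); exact: rintegrable_shift. Qed.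

Definition folded x y := (K (x - y) - K (x + y)) * g y.

Lemma rintegrable_folded x : rintegrable (folded x).
Proof.
rewrite /folded; under [X in rintegrable X]funext do rewrite mulrBl.
exact: rintegrableB.
Qed.

(** Averaging the integral with its reflection gives, [g] being odd, half the integral of the even
    function [folded x]. *)
Lemma Rintegral_folded x : \int[leb]_y (K (x - y) * g y) =
  \int[leb]_y (bool_ind (y \in `]0, +oo[) * folded x y).
Proof.
have ih := rintegrable_ind `]0, +oo[ (rintegrable_folded x).
have E : \int[leb]_y (K (x - y) * g y) = 2^-1 * \int[leb]_y folded x y.
  rewrite /folded; under [in RHS]eq_Rintegral do rewrite mulrBl.
  rewrite rintegralB// -[X in _ - X](Rintegral_opp (iKP x)).
  under [X in _ - X]eq_Rintegral do rewrite godd mulrN -mulN1r.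
  by rewrite rintegralZ//; lra.
rewrite E.
have -> : \int[leb]_y folded x y = \int[leb]_y (bool_ind (y \in `]0, +oo[) * folded x y +
   bool_ind (- y \in `]0, +oo[) * folded x (- y)).
  apply: eq_Rintegral => y _.
  have -> : folded x (- y) = folded x y by rewrite /folded godd opprK; ring.
  rewrite -mulrDl /bool_ind !in_itv/= !andbT oppr_gt0.
  have [y0|y0|<-] := ltgtP 0 y.
  - by rewrite addr0 mul1r.
  - by rewrite add0r mul1r.
  - by rewrite /folded g0 !mulr0.
rewrite rintegralD ?(Rintegral_opp ih)//; first by lra.
exact: (rintegrable_opp ih).
Qed.

Lemma convolution_lower_pinfty x a b kappa : 0 < x -> 0 < a -> a <= b ->
  (forall y, 0 < y -> 0 <= g y) -> 
  (forall y, 0 < y -> y != x -> 0 <= K `|x - y| - K (x + y)) ->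
  (forall y, a <= y -> y <= b -> y != x -> kappa <= K `|x - y| - K (x + y)) ->
  kappa * \int[leb]_(y in `[a, b]) g y <= \int[leb]_y (K (x - y) * g y).
Proof.
move=> x0 a0 ab gp Kp hk.
have Kn z : K `|z| = K z by have [] := ger0P z; rewrite ?Keven.
have ig : rintegrable (fun y => bool_ind (y \in `[a, b]) * g y).
  exact: rintegrable_continuous_ind.
rewrite Rintegral_folded -Rintegral_ind -(rintegralZ _ ig).
apply: (@le_rintegral_off1 _ _ x).
- exact: rintegrableZ.
- exact/rintegrable_ind/rintegrable_folded.
move=> y yx; rewrite /folded /bool_ind !in_itv/= andbT.
have [y0|y0] := ltP 0 y; last first.
  rewrite mul0r (_ : a <= y <= b = false) ?mul0r ?mulr0//.
  by apply/negbTE; rewrite negb_and -ltNge (le_lt_trans y0).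
have gy := gp y y0; rewrite mul1r -(Kn (x - y)).
have [/andP[ay yb]|_] := boolP (a <= y <= b).
  by rewrite mul1r ler_wpM2r//; exact: hk.
by rewrite mul0r mulr0 mulr_ge0//; exact: Kp.
Qed.

Section periodic.
Variable p : R.
Hypothesis p0 : 0 < p.
Hypothesis gper : forall y, g (y + p) = g y.

Let gpern (n : nat) y : g (n%:R * p + y) = g y.
Proof.
elim: n => [|n ih]; first by rewrite mul0r add0r.
by rewrite -natr1 mulrDl mul1r addrAC gper.
Qed.

Let gp2 : g (p / 2) = 0.
Proof.
have := godd (p / 2); rewrite -gper.
by rewrite (_ : - (p / 2) + p = p / 2); [lra|field].
Qed.

(** Collects the points [n p + y] and [(n + 1) p - y] of one period, where [g] takes the values
    [g y] and [- g y]. *)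
Definition tile_kernel x (n : nat) y :=
  K (x - (n%:R * p + y)) - K (x + (n%:R * p + y)) -
  (K (x - (n.+1%:R * p - y)) - K (x + (n.+1%:R * p - y))).

Let itile x n : rintegrable (fun y => bool_ind (y \in `]0, (p / 2)[) * (tile_kernel x n y * g y)).
Proof.
apply: rintegrable_ind.
have h a : rintegrable (fun y => K (a + y) * g y).
  by apply: (rintegrableM_bounded mg gG); exact: rintegrable_shift.
have hN a : rintegrable (fun y => K (a - y) * g y).
  apply: (rintegrableM_bounded mg gG).
  exact: (rintegrable_opp (rintegrable_shift a iK)).
have E y : tile_kernel x n y * g y =
    (K (x - n%:R * p - y) * g y - K (x + n%:R * p + y) * g y) -
    (K (x - n.+1%:R * p + y) * g y - K (x + n.+1%:R * p - y) * g y).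
  rewrite /tile_kernel (_ : x - (n%:R * p + y) = x - n%:R * p - y); last by ring.
  rewrite (_ : x - (n.+1%:R * p - y) = x - n.+1%:R * p + y); last by ring.
  rewrite (_ : x + (n.+1%:R * p - y) = x + n.+1%:R * p - y); last by ring.
  by rewrite addrA; ring.
under [X in rintegrable X]funext do rewrite E.
by apply: rintegrableB; apply: rintegrableB.
Qed.

Lemma Rintegral_folded_tile x (n : nat) :
  \int[leb]_y (bool_ind (y \in `](n%:R * p), (n.+1%:R * p)]) * folded x y) =
  \int[leb]_y (bool_ind (y \in `]0, (p / 2)[) * (tile_kernel x n y * g y)).
Proof.
have if_ := rintegrable_folded x.
have nS : n.+1%:R * p = n%:R * p + p by rewrite -natr1 mulrDl mul1r.
have i1 := rintegrable_ind `](n%:R * p), (n%:R * p + p / 2)] if_.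
have i2 := rintegrable_ind `](n%:R * p + p / 2), (n.+1%:R * p)] if_.
have E1 y : bool_ind (y \in `](n%:R * p), (n.+1%:R * p)]) * folded x y =
  bool_ind (y \in `](n%:R * p), (n%:R * p + p / 2)]) * folded x y +
  bool_ind (y \in `](n%:R * p + p / 2), (n.+1%:R * p)]) * folded x y.
  rewrite -mulrDl nS /bool_ind !in_itv/=; congr (_ * _).
  have [h1|h1] := ltP (n%:R * p) y; have [h2|h2] := leP y (n%:R * p + p / 2);
  have [h3|h3] := leP y (n%:R * p + p); rewrite /= ?addr0 ?add0r//; lra.
under eq_Rintegral do rewrite E1.
rewrite rintegralD// -(Rintegral_shift (n%:R * p) i1).
rewrite -[X in _ + X](Rintegral_opp i2) -[X in _ + X](Rintegral_shift (- (n.+1%:R * p)) (rintegrable_opp i2)).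
rewrite -rintegralD; last 2 first.
- exact: rintegrable_shift i1.
- exact: rintegrable_shift (rintegrable_opp i2).
apply: eq_Rintegral => y _.
rewrite opprD opprK /folded gpern.
have -> : g (n.+1%:R * p - y) = - g y by rewrite gpern godd.
rewrite /bool_ind !in_itv/= nS ltrDl lerD2l.
have -> : (n%:R * p + p / 2 < n%:R * p + p - y) = (y < p / 2) by apply/idP/idP; lra.
have -> : (n%:R * p + p - y <= n%:R * p + p) = (0 <= y) by apply/idP/idP; lra.
(* The intervals disagree at end points only, and [g] vanishes at 0 and at [p / 2]. *)
have [h1|h1|<-] := ltgtP 0 y; last by rewrite g0; ring.
- have [h2|h2|->] := ltgtP y (p / 2); last by rewrite gp2; ring.
    by rewrite /= /tile_kernel nS !mul1r -!addrA; ring.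
  by rewrite /= !mul0r addr0.
- by rewrite /= andbF !mul0r addr0.
Qed.

Lemma Rintegral_folded_partial x (N : nat) :
  \int[leb]_y (bool_ind (y \in `]0, (N%:R * p)]) * folded x y) =
  \int[leb]_y (bool_ind (y \in `]0, (p / 2)[) * ((\sum_(n < N) tile_kernel x n y) * g y)).
Proof.
elim: N => [|N ih].
  rewrite mul0r; apply: eq_Rintegral => y _.
  by rewrite big_ord0 mul0r mulr0 /bool_ind in_itv/= lt_le_asym mul0r.
have if_ := rintegrable_folded x.
have Np : 0 <= N%:R * p by rewrite mulr_ge0// ltW.
have NS : N%:R * p <= N.+1%:R * p by rewrite ler_pM2r// ler_nat.
have E y : bool_ind (y \in `]0, (N.+1%:R * p)]) * folded x y =
    bool_ind (y \in `]0, (N%:R * p)]) * folded x y +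
    bool_ind (y \in `](N%:R * p), (N.+1%:R * p)]) * folded x y.
  rewrite -mulrDl /bool_ind !in_itv/=; congr (_ * _).
  have [h1|h1] := ltP 0 y; have [h2|h2] := leP y (N%:R * p);
  have [h3|h3] := leP y (N.+1%:R * p); rewrite /= ?addr0 ?add0r//; lra.
under eq_Rintegral do rewrite E.
rewrite rintegralD; [|exact: rintegrable_ind|exact: rintegrable_ind].
rewrite ih Rintegral_folded_tile -rintegralD//.
  by apply: eq_Rintegral => y _; rewrite big_ord_recr/=; ring.
have := rintegrable_sum (index_enum 'I_N) (fun n : 'I_N => itile x n).
congr rintegrable; apply/funext => y.
by rewrite mulr_suml mulr_sumr.
Qed.

Lemma Rintegral_folded_cvg x :
  \int[leb]_y (bool_ind (y \in `]0, (p / 2)[) * ((\sum_(n < N) tile_kernel x n y) * g y))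
    @[N --> \oo] --> \int[leb]_y (K (x - y) * g y).
Proof.
under eq_fun do rewrite -Rintegral_folded_partial.
rewrite Rintegral_folded.
have if_ := rintegrable_folded x.
apply: (Rintegral_dominated (g := fun y => `|folded x y|) _ _ _ _).2.
- by move=> N; exact: rintegrable_measurable (rintegrable_ind _ if_).
- move=> y; apply: cvg_near_cst; near=> N.
  congr (bool_ind _ * _); rewrite !in_itv/= andbT andb_idr// => y0.
  rewrite -ler_pdivrMr//; near: N; exact: nbhs_infty_ger.
- exact: rintegrable_norm.
- move=> N y; rewrite normrM /bool_ind; case: (_ \in _).
    by rewrite normr1 mul1r.
  by rewrite normr0 mul0r.
Unshelve. all: end_near. Qed.

Hypothesis hK : exp_monotone K.
Let A := half_sum K p.

(** A bound on finite sums with an explicit error uniform in [y], so that series and integral need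
    not be exchanged. The two additional tiles place every omitted tail beyond [N p + p]. *)
Lemma sum_tile_kernel_ge x y (N : nat) : 0 < x -> x < p / 2 -> 0 < y -> y < p / 2 ->
  y != x ->
  A `|x - y| + A (p - `|x - y|) - (A (x + y) + A (p - (x + y))) -
    2 * (expR (- (N%:R * p)) * A p) <= \sum_(n < N.+2) tile_kernel x n y.
Proof.
move=> x0 xp y0 yp yx.
have hA : exp_monotone A by exact: half_sum_exp_monotone.
have Np n : 0 <= n%:R * p by rewrite mulr_ge0// ltW.
have tail z : N%:R * p + p <= z -> A z <= expR (- (N%:R * p)) * A p.
  move=> hz; apply: le_trans (exp_monotone_nincr hA _ hz) _.
    by rewrite ltr_wpDl.
  by rewrite addrC; exact: exp_monotone_decay.
have natS n : n.+1%:R * p = n%:R * p + p :> R by rewrite -natr1 mulrDl mul1r.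
have sum_le z (M : nat) : 0 < z -> \sum_(0 <= n < M) K (z + n%:R * p) <= A z.
  move=> z0; rewrite /A (half_sum_split M hK p0 z0) lerDl.
  by apply: exp_monotone_ge0 => //; rewrite ltr_wpDr.
have TE n : tile_kernel x n y = K (y - x + n%:R * p) + K (x - y + p + n%:R * p) -
    (K (x + y + n%:R * p) + K (p - (x + y) + n%:R * p)).
  rewrite /tile_kernel natS.
  rewrite -(Keven (x - (n%:R * p + y))) -(Keven (x - (n%:R * p + p - y))).
  rewrite (_ : - (x - (n%:R * p + y)) = y - x + n%:R * p); last by ring.
  rewrite (_ : - (x - (n%:R * p + p - y)) = p - (x + y) + n%:R * p); last by ring.
  rewrite (_ : x + (n%:R * p + y) = x + y + n%:R * p); last by ring.
  rewrite (_ : x + (n%:R * p + p - y) = x - y + p + n%:R * p); last by ring.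
  by ring.
rewrite -(big_mkord xpredT (fun n => tile_kernel x n y)).
under eq_bigr do rewrite TE.
rewrite sumrB !big_split/=.
have s2 := sum_le (x + y) N.+2 (addr_gt0 x0 y0).
have pxy : 0 < p - (x + y) by lra.
have s3 := sum_le _ N.+2 pxy.
have N2 : N.+2%:R * p = N%:R * p + p + p by rewrite !natS.
have N1 : N.+1%:R * p = N%:R * p + p by rewrite natS.
have NN := Np N.
have [xy|xy|xy] := ltgtP x y; last by rewrite xy eqxx in yx.
- have -> : `|x - y| = y - x by rewrite ltr0_norm; lra.
  have ep : p - (y - x) = x - y + p by ring.
  have d0 : 0 < y - x by lra.
  have pd0 : 0 < p - (y - x) by lra.
  have := half_sum_split N.+2 hK p0 d0; rewrite -/A N2 => e1.
  have := half_sum_split N.+2 hK p0 pd0; rewrite -/A N2 ep => e4.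
  have t1 := tail (y - x + (N%:R * p + p + p)).
  have t2 := tail (x - y + p + (N%:R * p + p + p)).
  have {}t1 : A (y - x + (N%:R * p + p + p)) <= expR (- (N%:R * p)) * A p by apply: t1; lra.
  have {}t2 : A (x - y + p + (N%:R * p + p + p)) <= expR (- (N%:R * p)) * A p by apply: t2; lra.
  rewrite e1 e4; lra.
(* Here the term [n = 0] of the first sum has a negative argument: by evenness it is the leading
   term of [A (x - y)], and the remaining terms are shifted by one period. *)
- rewrite gtr0_norm; last by lra.
  have d0 : 0 < x - y by lra.
  have pd0 : 0 < p - (x - y) by lra.
  have dp0 : 0 < x - y + p by lra.
  have := half_sum_split 1 hK p0 d0; rewrite -/A big_nat1 mul0r addr0 mul1r => e0.
  have := half_sum_split N.+2 hK p0 dp0; rewrite -/A N2 => e4.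
  have := half_sum_split N.+1 hK p0 pd0; rewrite -/A N1 => e1.
  rewrite big_nat_recl//= mul0r addr0 -(Keven (y - x)) (_ : - (y - x) = x - y); last by ring.
  have -> : \sum_(0 <= i < N.+1) K (y - x + i.+1%:R * p) =
            \sum_(0 <= n < N.+1) K (p - (x - y) + n%:R * p).
    by apply: eq_bigr => i _; rewrite natS; congr K; ring.
  have t1 : A (x - y + p + (N%:R * p + p + p)) <= expR (- (N%:R * p)) * A p by apply: tail; lra.
  have t2 : A (p - (x - y) + (N%:R * p + p)) <= expR (- (N%:R * p)) * A p by apply: tail; lra.
  rewrite e0 e4 e1; lra.
Qed.

Lemma convolution_lower_periodic x a b kappa : 0 < x -> x < p / 2 -> 0 < a -> a <= b -> b < p / 2 ->
  (forall y, 0 < y -> y < p / 2 -> 0 <= g y) ->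
  (forall y, 0 < y -> y < p / 2 -> y != x ->
     0 <= A `|x - y| + A (p - `|x - y|) - (A (x + y) + A (p - (x + y)))) ->
  (forall y, a <= y -> y <= b -> y != x ->
     kappa <= A `|x - y| + A (p - `|x - y|) - (A (x + y) + A (p - (x + y)))) ->
  kappa * \int[leb]_(y in `[a, b]) g y <= \int[leb]_y (K (x - y) * g y).
Proof.
move=> x0 xp a0 ab bp gp Kp hk.
have i1 := rintegrable_continuous_ind a b cg.
have i2 := rintegrable_continuous_ind 0 (p / 2) cg.
pose e (N : nat) := 2 * (expR (- (N%:R * p)) * A p).
pose I1 := \int[leb]_(y in `[a, b]) g y.
pose I2 := \int[leb]_(y in `[0, (p / 2)]) g y.
have c1 : kappa * I1 - e N * I2 @[N --> \oo] --> kappa * I1.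
  rewrite -[X in _ --> X]subr0; apply: cvgB; first exact: cvg_cst.
  rewrite -[X in _ --> X](mul0r I2); apply: cvgMr_tmp.
  rewrite -[X in _ --> X](mulr0 2); apply: cvgMl_tmp.
  rewrite -[X in _ --> X](mul0r (A p)); apply: cvgMr_tmp.
  under eq_fun do rewrite -mulrN expRM_natl.
  apply: cvg_expr; rewrite ger0_norm ?expR_ge0// expR_lt1 oppr_lt0//.
have c2 : \int[leb]_y (bool_ind (y \in `]0, (p / 2)[) * ((\sum_(n < N.+2) tile_kernel x n y) * g y))
    @[N --> \oo] --> \int[leb]_y (K (x - y) * g y).
  have := @Rintegral_folded_cvg x; rewrite -(cvg_shiftn 2).
  by apply: cvg_trans; apply: near_eq_cvg; apply: nearW => N; rewrite -(addn2 N).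
rewrite -[leLHS](cvg_lim _ c1)// -[leRHS](cvg_lim _ c2)//.
apply: ler_lim; [by apply/cvg_ex; eexists; exact: c1|by apply/cvg_ex; eexists; exact: c2|].
apply: nearW => N; rewrite /I1 /I2 -!Rintegral_ind.
rewrite -(rintegralZ _ i1) -(rintegralZ _ i2).
rewrite -(rintegralB (rintegrableZ _ i1) (rintegrableZ _ i2)).
apply: (@le_rintegral_off1 _ _ x).
- by apply: rintegrableB; exact: rintegrableZ.
- have := rintegrable_sum (index_enum 'I_N.+2) (fun n : 'I_N.+2 => itile x n).
  congr rintegrable; apply/funext => y.
  by rewrite mulr_suml mulr_sumr.
move=> y yx; rewrite /bool_ind !in_itv/=.
have [y0|y0|<-] := ltgtP 0 y; last first.
- by rewrite g0 !mulr0 subr0.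
- by rewrite /= (_ : a <= y = false) ?mul0r ?mulr0 ?subr0//; apply/negbTE; rewrite -ltNge; lra.
have [yp|yp|->] := ltgtP y (p / 2); last first.
- by rewrite gp2 !mulr0 subr0.
- by rewrite /= (_ : y <= b = false) ?andbF ?mul0r ?mulr0 ?subr0//; apply/negbTE; rewrite -ltNge; lra.
have gy := gp y y0 yp.
have T := sum_tile_kernel_ge N x0 xp y0 yp yx.
rewrite !mul1r /=.
have H : kappa * (a <= y <= b)%R%:R - e N <= \sum_(n < N.+2) tile_kernel x n y.
  apply: le_trans T; rewrite lerD2r.
  have [/andP[ay yb]|_] := boolP (a <= y <= b); first by rewrite mulr1; exact: hk.
  by rewrite mulr0; exact: Kp.
by have := ler_wpM2r gy H; rewrite mulrBl mulrA.
Qed.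

End periodic.

End fold.
End folded_convolution.

(** * Even periodic solutions *)

Section regularity.
Context {R : realType}.
Implicit Types (K f df g : R -> R) (x y : R).

Lemma unif_continuous_continuous f : unif_continuous f -> continuous f.
Proof.
move=> uf x; apply/cvgrPdist_lt => e e0.
have : entourage [set xy : R * R | `|xy.1 - xy.2| < e].
  by rewrite -entourage_ballE; exists e.
move=> /uf; rewrite -entourage_ballE => -[d /= d0 dP].
by exists d => // t /(dP (x, t)).
Qed.

Lemma bounded_fun_bound f :
  bounded_fun f -> exists G : R, forall x, `|f x| <= G.
Proof.
case=> M [Mreal HM]; exists (M + 1) => x.
by apply: HM => //; rewrite ltrDl.
Qed.

Lemma rintegrable_reflect f x :
  rintegrable f -> rintegrable (fun y => f (x - y)).
Proof. by move=> fi; exact: (rintegrable_opp (rintegrable_shift x fi)). Qed.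

Lemma Rintegral_reflect f x : rintegrable f ->
  \int[lebesgue_measure]_y f (x - y) = \int[lebesgue_measure]_y f y.
Proof.
by move=> fi; rewrite (Rintegral_opp (rintegrable_shift x fi)) Rintegral_shift.
Qed.

Lemma rintegrable_conv K f (B : R) x : rintegrable K -> continuous f ->
  (forall y, `|f y| <= B) -> rintegrable (fun y => K (x - y) * f y).
Proof.
move=> iK cf fB.
have := rintegrableM_bounded (continuous_measurable_fun cf) fB
  (rintegrable_reflect x iK).
by apply.
Qed.

Lemma conv_opE K f (B : R) x : rintegrable K -> continuous f ->
  (forall y, `|f y| <= B) ->
  conv_op K f x = \int[lebesgue_measure]_y (K y * f (x - y)).
Proof.
move=> iK cf fB; rewrite /conv_op -(Rintegral_reflect x); last first.
  exact: rintegrable_conv iK cf fB.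
by apply: eq_Rintegral => y _; rewrite opprB addrC subrK.
Qed.

(** With the convolution written as the integral of [K y * f (x - y)], the derivative falls on [f]
    and integrability of [K] suffices. *)
Lemma is_derive_conv_op K f df (B B' : R) x : rintegrable K ->
  (forall y, is_derive y 1 f (df y)) -> continuous df ->
  (forall y, `|f y| <= B) -> (forall y, `|df y| <= B') ->
  is_derive x 1 (conv_op K f) (conv_op K df x).
Proof.
move=> iK dfE cdf fB dfB.
have cf : continuous f.
  by move=> y; apply/differentiable_continuous/derivable1_diffP; have [] := dfE y.
rewrite (conv_opE x iK cdf dfB).
have -> : conv_op K f = fun x => \int[lebesgue_measure]_y (K y * f (x - y)).
  by apply/funext => z; rewrite (conv_opE z iK cf fB).
have cfr h z : continuous h -> continuous (fun y => h (z - y) : R).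
  move=> ch y; apply: (@continuous_comp _ _ _ (fun y : R => z - y) h); last exact: ch.
  by apply: cvgB; [exact: cvg_cst|exact: cvg_id].
apply: (is_derive_Rintegral (f := fun x y => K y * f (x - y))
  (df := fun x y => K y * df (x - y)) (G := fun y => `|K y| * B')).
- move=> z; have cfz := cfr _ z cf.
  by apply: (rintegrableM_bounded (continuous_measurable_fun cfz) _ iK) => y; exact: fB.
- move=> z y.
  have H := dfE (z - y).
  have D : is_derive z 1 (fun z => z - y) 1 by apply: is_derive_eq; rewrite subr0.
  have := is_deriveZ (K y) (is_derive1_comp (g := fun z => z - y) H D).
  by rewrite mulr1.
- have := rintegrableZ B' (rintegrable_norm iK).
  by congr rintegrable; apply/funext => y; rewrite mulrC.
- by move=> z y; rewrite normrM ler_wpM2l.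
Qed.

End regularity.

(** * Half periods and even periodic functions *)

Section half_period.
Context {R : realType}.
Implicit Types (P : \bar R) (f df : R -> R) (x y p : R).

(** The mirror image of [left_half_period]; the form [2 * x < P] avoids halving an extended real. *)
Definition half_period P : set R := [set x | 0 < x /\ ((2 * x)%:E < P)%E].

Lemma left_half_periodE P x : (0 < P)%E ->
  left_half_period P x <-> half_period P (- x).
Proof.
rewrite /left_half_period /half_period /=; case: P => [p||] //= p0.
  by rewrite !lte_fin; split => -[] ? ?; split; lra.
by rewrite gt0_mulye ?lte_fin ?invr_gt0 // ltNyr ltry; split => -[] ? ?; split => //; lra.
Qed.

Lemma half_periodS P x y : half_period P y -> 0 < x -> x <= y ->
  half_period P x.
Proof.
move=> [y0 yP] x0 xy; split=> //; apply: le_lt_trans yP.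
by rewrite lee_fin; lra.
Qed.

Lemma half_period_small P : (0 < P)%E -> exists x, half_period P x.
Proof.
case: P => [p||] //= p0; last by exists 1; split=> //; rewrite ltry.
by move: p0; rewrite lte_fin => p0; exists (p / 4); split; rewrite ?lte_fin; lra.
Qed.

Lemma half_period_larger P x : half_period P x ->
  exists2 y, x < y & half_period P y.
Proof.
case: P => [p||] [x0 xp]; last by move: xp; rewrite ltNge leNye.
  move: xp; rewrite lte_fin => xp; exists ((x + p / 2) / 2); first lra.
  by split; rewrite ?lte_fin; lra.
by exists (x + 1); [lra|split; rewrite ?ltry //; lra].
Qed.

Lemma half_period_near P x : half_period P x -> \forall y \near x, half_period P y.
Proof.
move=> hx; have [z xz hz] := half_period_larger hx; have [x0 _] := hx.
near=> y; apply: (half_periodS hz); first by near: y; exact: lt_nbhsr.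
by apply: ltW; near: y; exact: lt_nbhsl.
Unshelve. all: by end_near. Qed.

Lemma is_derive_le0 f x (l : R) : is_derive x 1 f l ->
  (\forall y \near x, (y - x) * (f y - f x) <= 0) -> l <= 0.
Proof.
move=> D H; rewrite -(@derive_val _ _ _ _ _ _ _ D).
have : derivable f x 1 by [].
move=> /limr_le; apply; near=> h.
have h0 : h != 0 by near: h; exact: nbhs_dnbhs_neq.
rewrite /GRing.scale /= mulr1.
have -> : h^-1 * (f (h + x) - f x) = h^-1 ^+ 2 * ((h + x - x) * (f (h + x) - f x)).
  by field.
rewrite mulr_ge0_le0 ?exprn_even_ge0 //; near: h.
by move: H; rewrite (near_shift 0) subr0 => H; exact: cvg_within.
Unshelve. all: by end_near. Qed.

Lemma half_period_derive_nincr P f df x y :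
  (forall x, is_derive x 1 f (df x)) ->
  (forall x, half_period P x -> df x <= 0) ->
  0 <= x -> x <= y -> ((2 * y)%:E <= P)%E -> f y <= f x.
Proof.
move=> dfE df0 x0 xy yP.
have cf : continuous f.
  by move=> z; apply/differentiable_continuous/derivable1_diffP; have [] := dfE z.
apply: (@ler0_derive1_le_cc _ f x y); rewrite ?in_itv/= ?lexx ?xy //.
- move=> z; rewrite in_itv/= => /andP[xz zy].
  rewrite derive1E derive_val; apply: df0; split; first lra.
  by apply: lt_le_trans yP; rewrite lte_fin; lra.
- exact: continuous_subspaceT.
Qed.

Lemma even_periodic_fold P f x : (0 < P)%E -> eperiodic P f ->
  (forall y, f (- y) = f y) ->
  exists y, [/\ 0 <= y, ((2 * y)%:E <= P)%E & f x = f y].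
Proof.
move=> P0 fper feven.
have fnorm : f x = f `|x| by case: (ger0P x) => _; rewrite ?feven.
case: P P0 fper => [p||] //= p0 fper; last by exists `|x|; rewrite normr_ge0 leey.
move: p0; rewrite lte_fin => p0.
set n := Num.truncn (`|x| / p).
have := truncn_itv (divr_ge0 (normr_ge0 x) (ltW p0)); rewrite -/n => /andP[].
rewrite ler_pdivlMr // ltr_pdivrMr // -natr1 mulrDl mul1r => h1 h2.
have fn : f x = f (`|x| - n%:R * p).
  by rewrite fnorm -(periodicn (fper _ erefl) n (`|x| - n%:R * p)) -[p *+ n]mulr_natl subrK.
have [h|h] := leP (`|x| - n%:R * p) (p / 2).
  by exists (`|x| - n%:R * p); rewrite lee_fin; split=> //; lra.
exists (p - (`|x| - n%:R * p)); rewrite lee_fin; split; [lra|lra|].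
by rewrite fn -feven -(fper _ erefl) addrC.
Qed.

Lemma is_derive_even f df : (forall x, is_derive x 1 f (df x)) ->
  (forall x, f (- x) = f x) -> forall x, df (- x) = - df x.
Proof.
move=> dfE feven x.
have D : is_derive x 1 (fun y : R => - y) (-1) by apply: is_deriveN.
have := is_derive1_comp (dfE (- x)) D.
have -> : f \o (fun y => - y) = f by apply/funext => y /=; exact: feven.
move=> D'; have := @derive_val _ _ _ _ _ _ _ D'.
by rewrite (@derive_val _ _ _ _ _ _ _ (dfE x)) mulrN1 => ->; rewrite opprK.
Qed.

Lemma is_derive_periodic f df p : (forall x, is_derive x 1 f (df x)) ->
  periodic f p -> periodic df p.
Proof.
move=> dfE fper x.
have D : is_derive x 1 (fun y : R => y + p) 1.
  by apply: is_derive_eq; rewrite addr0.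
have := is_derive1_comp (g := fun y : R => y + p) (dfE (x + p)) D.
have -> : f \o (fun y => y + p) = f by apply/funext => y /=; exact: fper.
move=> D'; have := @derive_val _ _ _ _ _ _ _ D'.
by rewrite (@derive_val _ _ _ _ _ _ _ (dfE x)) mulr1 => ->.
Qed.

End half_period.

Section even_monotone.
Context {R : realType} {P : \bar R} {phi dphi : R -> R}.
Hypothesis P0 : (0 < P)%E.
Hypothesis dphiE : forall x : R, is_derive x 1 phi (dphi x).
Hypothesis phi_even : forall x, phi (- x) = phi x.
Hypothesis phi_mono : forall x y : R, left_half_period P x ->
  left_half_period P y -> x <= y -> phi x <= phi y.
Implicit Types x y : R.

Lemma half_period_derive_le0 x : half_period P x -> dphi x <= 0.
Proof.
move=> hx; have nincr y z : half_period P y -> half_period P z -> y <= z -> phi z <= phi y.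
  move=> hy hz yz; rewrite -phi_even -(phi_even y).
  by apply: phi_mono; rewrite ?lerN2//; apply/left_half_periodE => //; rewrite opprK.
apply: (is_derive_le0 (dphiE x)).
apply: filterS (half_period_near hx) => y hy.
have [xy|yx] := leP x y.
  by rewrite mulr_ge0_le0 ?subr_ge0 // subr_le0; exact: nincr.
by rewrite mulr_le0_ge0 ?subr_le0 ?(ltW yx) // subr_ge0; apply: nincr => //; exact: ltW.
Qed.

Lemma half_period_nincr x y : 0 <= x -> x <= y -> ((2 * y)%:E <= P)%E ->
  phi y <= phi x.
Proof. exact: half_period_derive_nincr dphiE half_period_derive_le0. Qed.

Lemma even_periodic_le x : eperiodic P phi -> phi x <= phi 0.
Proof.
move=> /(even_periodic_fold x P0)/(_ phi_even)[y [y0 yP ->]].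
exact: half_period_nincr.
Qed.

(** Otherwise [phi] is constant on the open half period, hence on its closure, and folding makes it
    constant everywhere. The drop is wanted strictly inside, where [profile_gap] applies. *)
Lemma even_periodic_nonconst : eperiodic P phi ->
  ~ (exists c : R, forall x : R, phi x = c) ->
  exists a b : R, [/\ half_period P a, half_period P b, a <= b & phi b < phi a].
Proof.
move=> phi_per nc; apply: contrapT => H; apply: nc.
have [h hh] := half_period_small P0.
have lt x : half_period P x -> ((2 * x)%:E <= P)%E by case=> _ /ltW.
have eqh x y : half_period P x -> half_period P y -> x <= y -> phi x = phi y.
  move=> hx hy xy; apply/eqP; rewrite eq_le (half_period_nincr _ xy) ?lt//; last first.
    by case: hx => /ltW.
  by rewrite andbT leNgt; apply/negP => yx; apply: H; exists x, y.
have eqh' x y : half_period P x -> half_period P y -> phi x = phi y.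
  by move=> hx hy; have [/eqh->//|/ltW/eqh->] := leP x y.
have dphi0 x : half_period P x -> 0 <= dphi x.
  move=> hx; rewrite -oppr_le0; apply: (@is_derive_le0 _ (fun y => - phi y) x).
  apply: filterS (half_period_near hx) => y hy.
  by rewrite (eqh' y x) // subrr mulr0.
have ndecr x y : 0 <= x -> x <= y -> ((2 * y)%:E <= P)%E -> phi x <= phi y.
  move=> x0 xy yP; rewrite -lerN2.
  apply: (@half_period_derive_nincr _ P (fun z => - phi z) (fun z => - dphi z)) => // z hz.
  by rewrite oppr_le0; exact: dphi0.
exists (phi 0) => x.
have [y [y0 yP ->]] := even_periodic_fold x P0 phi_per phi_even.
by apply/eqP; rewrite eq_le half_period_nincr // ndecr.
Qed.

End even_monotone.

(** * Positivity and profile of the Whitham kernel *)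

Section whitham_profile.
Context {R : realType} {K : R -> R}.
Hypothesis hK : is_whitham_kernel K.
Implicit Types (P : \bar R) (g k : R -> R) (x y a b p : R).

(** If [K] vanished on the positive axis, evenness would make it zero off the origin, against its
    integral 1. *)
Lemma whitham_kernel_gt0 x : 0 < x -> 0 < K x.
Proof.
apply: exp_monotone_gt0; first exact: whitham_kernel_exp_monotone.
apply: contrapT => K0.
have {}K0 y : y != 0 -> K y = 0.
  have Kpos z : 0 < z -> K z = 0.
    by move=> z0; apply: contrapT => /eqP Kz; apply: K0; exists z.
  rewrite neq_lt => /orP[y0|/Kpos//].
  by rewrite -(whitham_kernel_even y hK) Kpos // oppr_gt0.
suff E : (\int[@lebesgue_measure R]_y (K y)%:E = 0)%E.
  have := Rintegral_whitham_kernel hK.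
  by rewrite /Rintegral E => /eqP; rewrite eq_sym oner_eq0.
rewrite -(integral0 (@lebesgue_measure R) setT); apply: ae_eq_integral => //.
- by have [/measurable_int] := hK.
- exists [set 0]; split => //; first exact: lebesgue_measure_set1.
  by move=> y /=; apply: contra_notP => /eqP/K0 -> _.
Qed.

Lemma half_sum_periodization p z : 
  periodization K p z = half_sum K p z + half_sum K p (p - z).
Proof.
rewrite /periodization /half_sum; congr (_ + limn (series _)).
apply/funext => n; rewrite -(whitham_kernel_even _ hK); congr K.
by rewrite -natr1; ring.
Qed.

Lemma derivable_periodization p x : 0 < x -> x < p ->
  derivable (periodization K p) x 1.
Proof.
move=> x0 xp.
have -> : periodization K p = fun z => half_sum K p z + half_sum K p (p - z).
  by apply/funext => z; exact: half_sum_periodization.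
have p0 : 0 < p by lra.
have hA := half_sum_exp_monotone (whitham_kernel_exp_monotone hK) p0.
apply: derivableD; first exact: exp_monotone_derivable.
have D : derivable (half_sum K p) (p - x) 1.
  by apply: exp_monotone_derivable => //; lra.
have D' : is_derive x 1 (fun z : R => p - z) (-1).
  by apply: is_derive_eq; rewrite add0r mul1r.
by have [] := is_derive1_comp (g := fun z : R => p - z) (derivableP D) D'.
Qed.

(** Hides the distinction between finite and infinite period: the estimates of the derivative below
    draw on the kernel only through [k] and this lower bound. *)
Lemma whitham_profile P : (0 < P)%E ->
  exists k, [/\ kernel_profile P k,
    forall p, P = p%:E -> k = periodization K p
  & forall g (G : R), continuous g -> (forall y, `|g y| <= G) ->
    (forall y, g (- y) = - g y) -> eperiodic P g ->
    (forall y, half_period P y -> 0 <= g y) ->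
    forall x a b (kappa : R), half_period P x -> 0 < a -> a <= b ->
    half_period P b ->
    (forall y, a <= y -> y <= b -> y != x -> kappa <= k `|x - y| - k (x + y)) ->
    kappa * \int[lebesgue_measure]_(y in `[a, b]) g y <= conv_op K g x].
Proof.
move=> P0.
have eK := whitham_kernel_exp_monotone hK.
have gap k x y : kernel_profile P k -> half_period P x -> half_period P y ->
    y != x -> 0 <= k `|x - y| - k (x + y).
  move=> kP [x0 xP] [y0 yP] yx.
  have [kappa /ltW kappa0] := profile_gap kP x0 xP y0 (lexx y) yP.
  by move=> /(_ y (lexx y) (lexx y) yx); exact: le_trans.
have iK := whitham_kernel_integrable hK.
have Kev x := whitham_kernel_even x hK.
case: P P0 gap => [p||] // p0 gap; last first.
  have kP := kernel_profile_pinfty eK whitham_kernel_gt0.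
  exists K; split=> // g G cg gG godd _ g0 x a b kappa hx a0 ab hb H.
  apply: (convolution_lower_pinfty iK Kev cg gG godd) => //.
  - by case: hx.
  - by move=> y y0; apply: g0; split; rewrite ?ltry.
  - by move=> y y0 yx; apply: gap => //; split; rewrite ?ltry.
have {}p0 : 0 < p by rewrite -lte_fin.
have hA := half_sum_exp_monotone eK p0.
have Apos x : 0 < x -> 0 < half_sum K p x.
  apply: exp_monotone_gt0 => //; exists p => //; rewrite gt_eqF //.
  rewrite (half_sum_split 1 eK p0 p0) big_nat1 ltr_wpDr // ?exp_monotone_ge0 //.
    lra.
  by apply: whitham_kernel_gt0; lra.
have kP := kernel_profile_fin hA Apos p0.
have hE y : 0 < y -> y < p / 2 -> half_period p%:E y.
  by move=> y0 yp; split; rewrite ?lte_fin; lra.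
exists (fun z => half_sum K p z + half_sum K p (p - z)); split=> //.
  by move=> q [<-]; apply/funext => z; rewrite half_sum_periodization.
move=> g G cg gG godd gper g0 x a b kappa [x0 xp] a0 ab [b0 bp] H.
move: xp bp; rewrite !lte_fin => xp bp.
apply: (convolution_lower_periodic iK Kev cg gG godd p0 (gper p erefl) eK) => //.
- by lra.
- by lra.
- by move=> y y0 yp; apply: g0; exact: hE.
- by move=> y y0 yp yx; apply: (gap _ _ _ kP) => //; apply: hE => //; lra.
Qed.

End whitham_profile.

(** * Comparison principles for the convolution operator *)

Section whitham_convolution.
Context {R : realType} {K : R -> R}.
Hypothesis hK : is_whitham_kernel K.
Implicit Types (f g : R -> R) (x y a b c B : R).

Let iK : rintegrable K := whitham_kernel_integrable hK.

Lemma conv_opN f B x : continuous f -> (forall y, `|f y| <= B) ->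
  conv_op K (fun y => - f y) x = - conv_op K f x.
Proof.
move=> cf fB; rewrite -mulN1r -rintegralZ; last exact: rintegrable_conv fB.
by apply: eq_Rintegral => y _; ring.
Qed.

Lemma conv_op_cst c x : conv_op K (fun=> c) x = c.
Proof.
rewrite /conv_op; under eq_Rintegral do rewrite mulrC.
rewrite rintegralZ; last exact: rintegrable_reflect.
by rewrite Rintegral_reflect // Rintegral_whitham_kernel // mulr1.
Qed.

Lemma whitham_kernel_ge0 y : y != 0 -> 0 <= K y.
Proof.
rewrite neq_lt => /orP[y0|/(whitham_kernel_gt0 hK)/ltW//].
rewrite -(whitham_kernel_even y hK) ltW // (whitham_kernel_gt0 hK) //.
by rewrite oppr_gt0.
Qed.

Lemma le_conv_op f g B B' x : continuous f -> continuous g ->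
  (forall y, `|f y| <= B) -> (forall y, `|g y| <= B') ->
  (forall y, f y <= g y) -> conv_op K f x <= conv_op K g x.
Proof.
move=> cf cg fB gB fg; apply: (@le_rintegral_off1 _ _ _ x).
- exact: rintegrable_conv fB.
- exact: rintegrable_conv gB.
- move=> y yx; apply: ler_wpM2l => //; apply: whitham_kernel_ge0.
  by rewrite subr_eq0 eq_sym.
Qed.

Lemma conv_op_lt0 f B a b c : continuous f -> (forall y, `|f y| <= B) ->
  (forall y, f y <= 0) -> 0 < a -> a < b -> 0 < c ->
  (forall y, a <= y -> y <= b -> f y <= - c) -> conv_op K f 0 < 0.
Proof.
move=> cf fB f0 a0 ab c0 fc.
have Kb : 0 < K b by apply: (whitham_kernel_gt0 hK); lra.
apply: (@le_lt_trans _ _ (\int[lebesgue_measure]_y (bool_ind (y \in `[a, b]) * - (K b * c)))).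
  apply: (@le_rintegral_off1 _ _ _ 0).
  - exact: rintegrable_conv fB.
  - apply: (@rintegrable_continuous_ind _ (fun=> - (K b * c))); exact: cst_continuous.
  - move=> y y0; rewrite sub0r (whitham_kernel_even _ hK) in_itv /=.
    have Ky := whitham_kernel_ge0 y0; have fy := f0 y.
    rewrite /bool_ind; have [/andP[ay yb]|_] := boolP (a <= y <= b); last first.
      by rewrite mul0r mulr_ge0_le0.
    have y0' : 0 < y by lra.
    have /= Kby := exp_monotone_nincr (whitham_kernel_exp_monotone hK) y0' yb.
    have := fc y ay yb; rewrite mul1r; nra.
have D z : is_derive (z : R) 1 (fun z : R => - (K b * c) * z) (- (K b * c)).
  by apply: is_derive_eq; rewrite /GRing.scale /= mulr1.
rewrite (@Rintegral_ind _ (fun=> _)) (Rintegral_itv_FTC (ltW ab) _ D); last first.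
  exact: cst_continuous.
have := mulr_gt0 Kb c0; nra.
Qed.

End whitham_convolution.

Lemma is_derive_right_quotient {R : realType} (f : R -> R) (x l : R) :
  is_derive x 1 f l -> h^-1 * (f (x + h) - f x) @[h --> 0^'+] --> l.
Proof.
move=> D; apply: cvg_dnbhs_at_right.
have [/cvg_ex[l' H] Dl] := D.
have <- : l' = l by rewrite -Dl; apply/esym/cvg_lim.
move: H; apply: cvg_trans; apply: near_eq_cvg; apply: nearW => h /=.
by rewrite /GRing.scale /= mulr1 (addrC h).
Qed.

(** * Sign, speed, crest and trough of a solution *)

Section whitham_solution.
Context {R : realType} {K : R -> R} {P : \bar R} {mu : R} {phi dphi : R -> R}.
Hypothesis hK : is_whitham_kernel K.
Hypothesis P0 : (0 < P)%E.
Hypothesis phi_per : eperiodic P phi.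
Hypothesis phi_nonconst : ~ (exists c : R, forall x : R, phi x = c).
Hypothesis phi_even : forall x : R, phi (- x) = phi x.
Hypothesis phi_mono : forall x y : R, left_half_period P x ->
  left_half_period P y -> x <= y -> phi x <= phi y.
Hypothesis dphiE : forall x : R, is_derive x 1 phi (dphi x).
Hypothesis dphi_cont : continuous dphi.
Variables B B' : R.
Hypothesis phiB : forall x, `|phi x| <= B.
Hypothesis dphiB : forall x, `|dphi x| <= B'.
Hypothesis phiE : forall x, conv_op K phi x = phi x * (mu - phi x).
Implicit Types x y a b c d h : R.

Let iK : rintegrable K := whitham_kernel_integrable hK.

Let phi_cont : continuous phi.
Proof.
by move=> z; apply/differentiable_continuous/derivable1_diffP; have [] := dphiE z.
Qed.

Let dphi_odd x : dphi (- x) = - dphi x.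
Proof. exact: is_derive_even dphiE phi_even x. Qed.

Lemma whitham_derive x : (mu - 2 * phi x) * dphi x = conv_op K dphi x.
Proof.
have D1 := is_derive_conv_op x iK dphiE dphi_cont phiB dphiB.
have D2 : is_derive x 1 (fun y : R => phi y * (mu - phi y))
    (phi x * (0 - dphi x) + (mu - phi x) * dphi x).
  by have dx := dphiE x; apply: is_derive_eq; rewrite /GRing.scale /=; ring.
rewrite -(@derive_val _ _ _ _ _ _ _ D1).
have -> : conv_op K phi = fun y => phi y * (mu - phi y) by apply/funext.
by rewrite (@derive_val _ _ _ _ _ _ _ D2); ring.
Qed.

Section profile.
Variable k : R -> R.
Hypothesis kP : kernel_profile P k.
Hypothesis kE : forall (g : R -> R) (G : R), continuous g -> (forall y, `|g y| <= G) ->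
    (forall y, g (- y) = - g y) -> eperiodic P g ->
    (forall y, half_period P y -> 0 <= g y) ->
    forall x a b (kappa : R), half_period P x -> 0 < a -> a <= b ->
    half_period P b ->
    (forall y, a <= y -> y <= b -> y != x -> kappa <= k `|x - y| - k (x + y)) ->
    kappa * \int[lebesgue_measure]_(y in `[a, b]) g y <= conv_op K g x.

(** Applied to [- phi'], which is odd, nonnegative on the half period, and integrates over [[a, b]]
    to the drop of [phi]. *)
Lemma slope_lower_bound x a b (kappa : R) : half_period P x -> 0 < a -> a <= b ->
  half_period P b ->
  (forall y, a <= y -> y <= b -> y != x -> kappa <= k `|x - y| - k (x + y)) ->
  kappa * (phi a - phi b) <= - ((mu - 2 * phi x) * dphi x).
Proof.
move=> hx a0 ab hb H.
have cN : continuous (fun y => - dphi y).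
  by move=> y; apply: cvgN; exact: dphi_cont.
have DN y : is_derive (y : R) 1 (fun z => - phi z) (- dphi y).
  exact: is_deriveN.
rewrite whitham_derive -(conv_opN hK _ dphi_cont dphiB).
have -> : phi a - phi b = \int[lebesgue_measure]_(y in `[a, b]) (- dphi y).
  by rewrite (Rintegral_itv_FTC ab cN DN) opprK addrC.
apply: (kE cN (G := B')) => //.
- by move=> y; rewrite normrN.
- by move=> y; rewrite dphi_odd.
- by move=> p Pp y; congr (- _); exact: is_derive_periodic dphiE (phi_per Pp) y.
- by move=> y hy; rewrite oppr_ge0 (half_period_derive_le0 P0 dphiE phi_even phi_mono).
Qed.

(** The product of [mu - 2 phi] and [- phi'] is positive and its second factor is already
    nonnegative, so both factors are positive. *)
Lemma half_period_strict x : half_period P x -> dphi x < 0 /\ phi x < mu / 2.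
Proof.
move=> hx.
have [a [b [ha hb ab lt]]] :=
  even_periodic_nonconst P0 dphiE phi_even phi_mono phi_per phi_nonconst.
have [[x0 xP] [a0 _] [b0 bP]] := And3 hx ha hb.
have [kappa kappa0 H] := profile_gap kP x0 xP a0 ab bP.
have := slope_lower_bound hx a0 ab hb H.
have pos : 0 < kappa * (phi a - phi b) by rewrite mulr_gt0 // subr_gt0.
move=> /(lt_le_trans pos); rewrite -mulrN => pos'.
have dx := half_period_derive_le0 P0 dphiE phi_even phi_mono hx.
have dx' : 0 < - dphi x.
  rewrite oppr_gt0 lt_neqAle dx andbT; apply: contraTneq pos' => ->.
  by rewrite oppr0 mulr0 ltxx.
by move: pos'; rewrite pmulr_lgt0 // => h; split; lra.
Qed.

Lemma half_period_at_right : \forall x \near 0^'+, half_period P x.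
Proof.
have [y hy] := half_period_small P0; have [y0 _] := hy.
near=> x; apply: half_periodS hy _ _; first by near: x; exact: nbhs_right_gt.
by near: x; exact: nbhs_right_ltW.
Unshelve. all: by end_near. Qed.

Lemma crest_le : phi 0 <= mu / 2.
Proof.
have H : phi x @[x --> 0^'+] --> phi 0 by exact/cvg_at_right_filter/phi_cont.
apply: (cvgr_to_le H).
by apply: filterS half_period_at_right => x /half_period_strict[_ /ltW].
Qed.

Let phi_le x : phi x <= phi 0.
Proof. exact: (even_periodic_le P0 dphiE phi_even phi_mono). Qed.

Lemma le_mean c x : (forall y, c <= phi y) -> c <= phi x * (mu - phi x).
Proof.
move=> cphi; rewrite -phiE -[leLHS](conv_op_cst hK c x).
by apply: (@le_conv_op _ _ hK _ _ `|c| B) => //; exact: cst_continuous.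
Qed.

Lemma ge_mean c x : (forall y, phi y <= c) -> phi x * (mu - phi x) <= c.
Proof.
move=> phic; rewrite -phiE -[leRHS](conv_op_cst hK c x).
by apply: (@le_conv_op _ _ hK _ _ B `|c|) => //; exact: cst_continuous.
Qed.

(** For [mu <= 0], comparing [L phi = phi (mu - phi)] with the maximum of [phi] gives
    [phi 0 <= mu - 1], and comparing it with the infimum gives [phi >= mu - 1]; then [phi] would be
    constant. *)
Lemma wave_speed_gt0 : 0 < mu.
Proof.
rewrite ltNge; apply/negP => mu0; apply: phi_nonconst.
have M0 := crest_le.
have [y hy] := half_period_small P0; have [y0 _] := hy.
(* A crest at height 0 would give [L phi 0 = 0], although [phi <= 0] is bounded away from 0 on an
   interval. *)
have Mlt0 : phi 0 < 0.
  rewrite lt_neqAle; apply/andP; split; last lra.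
  apply/eqP => M0'.
  have hy2 : half_period P (y / 2) by apply: half_periodS hy _ _; lra.
  have [_ lt2] := half_period_strict hy2.
  have lt : phi (y / 2) < 0 by lra.
  have : conv_op K phi 0 < 0.
    apply: (@conv_op_lt0 _ _ hK _ B (y / 2) y (- phi (y / 2))) => //.
    - by move=> z; rewrite -[leRHS]M0'.
    - by lra.
    - by lra.
    - by rewrite oppr_gt0.
    - move=> z yz zy; rewrite opprK.
      apply: (half_period_nincr P0 dphiE phi_even phi_mono) => //; first lra.
      by apply: ltW; case: (half_periodS hy _ zy) => //; lra.
  by rewrite phiE M0' mul0r ltxx.
have Mmu : phi 0 <= mu - 1.
  have := ge_mean 0 phi_le; rewrite -[X in _ <= X]mulr1.
  by rewrite ler_nM2l // lerBrDl -lerBrDr.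
suff low x : mu - 1 <= phi x.
  exists (mu - 1) => x; apply/eqP; rewrite eq_le low andbT.
  exact: le_trans (phi_le x) Mmu.
(* For infinite period the infimum need not be attained, so a point nearly attaining it is used. *)
pose E := range phi; pose i := inf E.
have hE : has_inf E.
  split; first by exists (phi 0), 0.
  by exists (- B) => _ [z _ <-]; have := phiB z; rewrite ler_norml => /andP[].
have iphi z : i <= phi z by apply: ge_inf; [case: hE|exists z].
apply: le_trans (iphi x); rewrite leNgt; apply/negP => ilt.
have i0 : i < 0 by lra.
(* [delta] is the amount by which [i <= i * (mu - i)] would fail, and above [i] the map
   [u * (mu - u)] grows with slope at most [mu - 2 * i]; [z] is chosen so close that less than half
   of [delta] is regained. *)
pose delta := i * (i + 1 - mu).
have delta0 : 0 < delta by rewrite /delta nmulr_rgt0 //; lra.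
have mi : 0 < mu - 2 * i by lra.
have e0 : 0 < delta / (2 * (mu - 2 * i)) by rewrite divr_gt0 // mulr_gt0.
have [_ [z _ <-] lt] := inf_adherent e0 hE; rewrite -/i in lt.
have := le_mean z iphi; have iz := iphi z.
have : (phi z - i) * (mu - 2 * i) < delta / 2.
  rewrite -ltr_pdivlMr // (_ : delta / 2 / _ = delta / (2 * (mu - 2 * i))).
    by lra.
  by field; rewrite gt_eqF.
rewrite /delta; nra.
Qed.

Lemma dphi0 : dphi 0 = 0.
Proof. by have := dphi_odd 0; rewrite oppr0; lra. Qed.

(** The slope bound at [x = h] is taken over [[2 h, c - h]], where [|h - y| = y - h] is positive and
    [y + h <= c]; then it is divided by [h]. *)
Lemma crest_bound c d (l : R) : is_derive (0 : R) 1 dphi l -> half_period P c ->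
  c < d -> (d%:E < P)%E ->
  2 * ((k c - k d) / (d - c)) * (phi 0 - phi c) <= (mu - 2 * phi 0) * - l.
Proof.
move=> D hc cd dP; have [c0 _] := hc; set sigma := (k c - k d) / (d - c).
have H1 : 2 * sigma * (phi (2 * h) - phi (c - h)) @[h --> 0^'+] -->
    2 * sigma * (phi 0 - phi c).
  apply: cvg_at_right_filter; rewrite -[in phi 0](mulr0 2) -[in phi c](subr0 c).
  apply: cvgMl_tmp; apply: cvgB.
  - apply: (@continuous_comp _ _ _ (fun h : R => 2 * h) phi); last exact: phi_cont.
    exact: mulrl_continuous.
  - apply: (@continuous_comp _ _ _ (fun h : R => c - h) phi); last exact: phi_cont.
    by apply: cvgB; [exact: cvg_cst|exact: cvg_id].
have H2 : (mu - 2 * phi h) * - (h^-1 * (dphi (0 + h) - dphi 0)) @[h --> 0^'+] -->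
    (mu - 2 * phi 0) * - l.
  apply: cvgM; last by apply: cvgN; exact: is_derive_right_quotient.
  apply: cvg_at_right_filter; apply: cvgB; first exact: cvg_cst.
  by apply: cvgMl_tmp; exact: phi_cont.
apply: (ler_cvg_to H1 H2); near=> h.
have h0 : 0 < h by near: h; exact: nbhs_right_gt.
have h3 : h < c / 3 by near: h; apply: nbhs_right_lt; lra.
have hh : half_period P h by near: h; exact: half_period_at_right.
have hch : half_period P (c - h) by apply: (half_periodS hc); lra.
have h20 : 0 < 2 * h by lra.
have h2c : 2 * h <= c - h by lra.
have H y : 2 * h <= y -> y <= c - h -> y != h ->
    2 * h * sigma <= k `|h - y| - k (h + y).
  move=> hy yc _; rewrite distrC gtr0_norm; last lra.
  by rewrite (addrC h); apply: (profile_slope kP) => //; lra.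
have := slope_lower_bound hh h20 h2c hch H.
rewrite add0r dphi0 subr0 => H'.
rewrite -(ler_pM2l h0).
rewrite [leLHS](_ : _ = 2 * h * sigma * (phi (2 * h) - phi (c - h))); last by ring.
by apply: le_trans H' _; rewrite le_eqVlt; apply/orP; left; apply/eqP; field; rewrite gt_eqF.
Unshelve. all: by end_near. Qed.

Let profile_drop c : half_period P c -> exists d : R,
  [/\ c < d, (d%:E < P)%E & 0 < (k c - k d) / (d - c)].
Proof.
move=> hc; have [c0 _] := hc; have [d cd [d0 dP]] := half_period_larger hc.
have [_ kdec _] := kP; exists d; split=> //.
  by apply: le_lt_trans dP; rewrite lee_fin; lra.
by rewrite divr_gt0 ?subr_gt0 //; apply: kdec => //; exact: ltW.
Qed.

(** At height [mu / 2] the right-hand side of [crest_bound] would vanish for any finite second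
    derivative, while the left-hand side is positive. *)
Lemma crest_concave (l : R) : is_derive (0 : R) 1 dphi l ->
  l < 0 /\ phi 0 < mu / 2.
Proof.
move=> D; have [a [b [ha hb ab lt]]] :=
  even_periodic_nonconst P0 dphiE phi_even phi_mono phi_per phi_nonconst.
have [d [bd dP sigma0]] := profile_drop hb.
have := crest_bound D hb bd dP.
have pos : 0 < 2 * ((k b - k d) / (d - b)) * (phi 0 - phi b).
  apply: mulr_gt0; first exact: mulr_gt0.
  by rewrite subr_gt0; exact: lt_le_trans lt (phi_le a).
move=> /(lt_le_trans pos); have := crest_le; rewrite le_eqVlt => /predU1P[->|M].
  by rewrite (_ : mu - 2 * (mu / 2) = 0) ?mul0r ?ltxx //; field.
by rewrite pmulr_rgt0 ?oppr_gt0 //; lra.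
Qed.

Section finite_period.
Variable p : R.
Hypothesis Pp : P = p%:E.

Let p0 : 0 < p.
Proof. by rewrite -lte_fin -Pp. Qed.

Lemma dphi_half : dphi (p / 2) = 0.
Proof.
have := is_derive_periodic dphiE (phi_per Pp) (- (p / 2)); rewrite dphi_odd.
by rewrite (_ : - (p / 2) + p = p / 2); [lra|field].
Qed.

(** Mirrors [crest_bound] at [x = p / 2 - h]: the symmetry of [k] about [p / 2] turns [k (x + y)]
    into [k (p / 2 - y + h)]. *)
Lemma trough_bound c d (l : R) : is_derive (p / 2) 1 dphi l -> half_period P c ->
  c < d -> (d%:E < P)%E ->
  2 * ((k c - k d) / (d - c)) * (phi (p / 2 - c) - phi (p / 2)) <=
    (mu - 2 * phi (p / 2)) * l.
Proof.
move=> D hc cd dP; have [c0 cP] := hc; set sigma := (k c - k d) / (d - c).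
have {}cP : 2 * c < p by rewrite -lte_fin -Pp.
have H1 : 2 * sigma * (phi (p / 2 - (c - h)) - phi (p / 2 - 2 * h)) @[h --> 0^'+] -->
    2 * sigma * (phi (p / 2 - c) - phi (p / 2)).
  apply: cvg_at_right_filter.
  rewrite -[in phi (p / 2 - c)](subr0 c) -[in phi (p / 2)](subr0 (p / 2)).
  rewrite -[X in _ - phi (p / 2 - X)](mulr0 2).
  apply: cvgMl_tmp; apply: cvgB.
  - apply: (@continuous_comp _ _ _ (fun h : R => p / 2 - (c - h)) phi); last exact: phi_cont.
    by apply: cvgB; [exact: cvg_cst|apply: cvgB; [exact: cvg_cst|exact: cvg_id]].
  - apply: (@continuous_comp _ _ _ (fun h : R => p / 2 - 2 * h) phi); last exact: phi_cont.
    by apply: cvgB; [exact: cvg_cst|exact: mulrl_continuous].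
have H2 : (mu - 2 * phi (p / 2 - h)) *
      - (h^-1 * (dphi (p / 2 - (0 + h)) - dphi (p / 2 - 0))) @[h --> 0^'+] -->
    (mu - 2 * phi (p / 2)) * l.
  apply: cvgM.
    apply: cvg_at_right_filter; rewrite -[in phi (p / 2)](subr0 (p / 2)).
    apply: cvgB; first exact: cvg_cst.
    apply: cvgMl_tmp.
    apply: (@continuous_comp _ _ _ (fun h : R => p / 2 - h) phi); last exact: phi_cont.
    by apply: cvgB; [exact: cvg_cst|exact: cvg_id].
  rewrite -[l]opprK; apply: cvgN.
  apply: (@is_derive_right_quotient _ (fun h => dphi (p / 2 - h)) 0).
  rewrite -mulrN1.
  apply: (is_derive1_comp (g := fun h : R => p / 2 - h)); first by rewrite subr0.
  by apply: is_derive_eq; rewrite add0r mul1r.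
apply: (ler_cvg_to H1 H2); near=> h.
have h0 : 0 < h by near: h; exact: nbhs_right_gt.
have h3 : h < c / 3 by near: h; apply: nbhs_right_lt; lra.
have half y : 0 < y -> 2 * y < p -> half_period P y.
  by move=> y0 yp; split=> //; rewrite Pp lte_fin.
have hh : half_period P (p / 2 - h) by apply: half; lra.
have hb : half_period P (p / 2 - 2 * h) by apply: half; lra.
have a0 : 0 < p / 2 - (c - h) by lra.
have ab : p / 2 - (c - h) <= p / 2 - 2 * h by lra.
have H y : p / 2 - (c - h) <= y -> y <= p / 2 - 2 * h -> y != p / 2 - h ->
    2 * h * sigma <= k `|p / 2 - h - y| - k (p / 2 - h + y).
  move=> ay yb _; rewrite gtr0_norm; last lra.
  have [_ _ refl] := kP.
  rewrite (_ : p / 2 - h + y = p - (p / 2 - y + h)); last by field.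
  rewrite (refl _ _ Pp); [|lra|lra].
  rewrite (_ : p / 2 - h - y = p / 2 - y - h); last by ring.
  by apply: (profile_slope kP) => //; lra.
have := slope_lower_bound hh a0 ab hb H.
rewrite add0r subr0 dphi_half subr0 => H'.
rewrite -(ler_pM2l h0).
rewrite [leLHS](_ : _ = 2 * h * sigma * (phi (p / 2 - (c - h)) - phi (p / 2 - 2 * h))); last by ring.
by apply: le_trans H' _; rewrite le_eqVlt; apply/orP; left; apply/eqP; field; rewrite gt_eqF.
Unshelve. all: by end_near. Qed.

Let half_le x : phi (p / 2) <= phi x.
Proof.
have [y [y0 yP ->]] := even_periodic_fold x P0 phi_per phi_even.
move: yP; rewrite Pp lee_fin => yp; have q0 := p0.
apply: (half_period_nincr P0 dphiE phi_even phi_mono) => //; first lra.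
by rewrite Pp lee_fin; lra.
Qed.

Let half_periodP y : 0 < y -> y < p / 2 -> half_period P y.
Proof. by move=> y0 yp; split=> //; rewrite Pp lte_fin; lra. Qed.

Let half_quarter : half_period P (p / 4).
Proof. by have := p0; move=> q0; apply: half_periodP; lra. Qed.

Let half_lt : phi (p / 2) < mu / 2.
Proof. exact: le_lt_trans (half_le _) (half_period_strict half_quarter).2. Qed.

Lemma trough_convex (l : R) : is_derive (p / 2) 1 dphi l -> 0 < l.
Proof.
move=> D; have [a [b [ha hb ab lt]]] :=
  even_periodic_nonconst P0 dphiE phi_even phi_mono phi_per phi_nonconst.
have [a0 aP] := ha; have {}aP : 2 * a < p by rewrite -lte_fin -Pp.
(* With this point as [c], the drop in [trough_bound] is the one from [a] to the trough. *)
have hc : half_period P (p / 2 - a) by apply: half_periodP; lra.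
have [d [cd dP sigma0]] := profile_drop hc.
have := trough_bound D hc cd dP; rewrite subKr.
have pos : 0 < 2 * ((k (p / 2 - a) - k d) / (d - (p / 2 - a))) * (phi a - phi (p / 2)).
  apply: mulr_gt0; first exact: mulr_gt0.
  by rewrite subr_gt0; exact: le_lt_trans (half_le b) lt.
by move=> /(lt_le_trans pos); rewrite pmulr_rgt0 // subr_gt0; have := half_lt; lra.
Qed.

(** With [c = p / 4] in both bounds, the drops add up to the full height [phi 0 - phi (p / 2)]. This
    is at least a quarter of [mu - 2 phi (p / 2)], the larger of the two coefficients on the right;
    dividing by it leaves half the chord slope. *)
Lemma crest_trough_gap (l0 l1 : R) : is_derive (0 : R) 1 dphi l0 ->
  is_derive (p / 2) 1 dphi l1 -> derivable k (p / 4) 1 ->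
  mu <= 1 -> mu / 4 <= phi 0 -> 2^-1 * `|derive1 k (p / 4)| <= l1 - l0.
Proof.
move=> D0 D1 Dk mu1 M4; have q0 := p0.
have [_ M0] := crest_concave D0.
(* A positive minimum [m] would satisfy [m <= m (mu - m)], hence [1 <= mu - m < 1]. *)
have m0 : phi (p / 2) <= 0.
  rewrite leNgt; apply/negP => m0.
  have := le_mean (p / 2) half_le; rewrite -[leLHS]mulr1 ler_pM2l //; lra.
have l00 : l0 < 0 by have [] := crest_concave D0.
have l10 := trough_convex D1.
have mM : phi (p / 2) <= phi 0 by exact: phi_le.
have bound d : p / 4 < d -> d < p / 2 ->
    0 < (k (p / 4) - k d) / (d - p / 4) <= 2 * (l1 - l0).
  move=> cd dp; have dP : (d%:E < P)%E by rewrite Pp lte_fin; lra.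
  have := crest_bound D0 half_quarter cd dP.
  have := trough_bound D1 half_quarter cd dP.
  rewrite (_ : p / 2 - p / 4 = p / 4); last by field.
  set s := (k _ - k _) / _ => H1 H0.
  have s0 : 0 < s.
    have [_ kdec _] := kP; rewrite divr_gt0 ?subr_gt0 // kdec //; first lra.
    by rewrite Pp lee_fin; lra.
  rewrite s0 /=.
  have mm : 0 < mu - 2 * phi (p / 2) by have := half_lt; lra.
  have H2 : s * (mu - 2 * phi (p / 2)) / 2 <= (mu - 2 * phi (p / 2)) * (l1 - l0).
    have h1 : 2 * s * (phi 0 - phi (p / 2)) <= (mu - 2 * phi 0) * - l0 + (mu - 2 * phi (p / 2)) * l1.
      by lra.
    (* From [mu <= 4 phi 0] and [phi (p / 2) <= 0]. *)
    have h2 : s * (mu - 2 * phi (p / 2)) <= s * (4 * (phi 0 - phi (p / 2))).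
      by rewrite ler_pM2l //; lra.
    have h3 : (mu - 2 * phi 0) * - l0 <= (mu - 2 * phi (p / 2)) * - l0.
      by rewrite ler_pM2r; lra.
    by lra.
  rewrite -(ler_pM2l mm); lra.
have Q := is_derive_right_quotient (derivableP Dk).
rewrite derive1E; set L := 'D_1 k (p / 4) in Q *.
have near_bound : \forall h \near 0^'+, - (2 * (l1 - l0)) <= h^-1 * (k (p / 4 + h) - k (p / 4)) <= 0.
  near=> h.
  have h0 : 0 < h by near: h; exact: nbhs_right_gt.
  have h4 : h < p / 4 by near: h; apply: nbhs_right_lt; lra.
  have /bound : p / 4 < p / 4 + h by lra.
  rewrite [_ / (_ - _)](_ : _ = - (h^-1 * (k (p / 4 + h) - k (p / 4)))).
    by move=> /(_ ltac:(lra))/andP[? ?]; apply/andP; split; lra.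
  by rewrite addrAC subrr add0r; ring.
have L0 : L <= 0.
  by apply: (cvgr_to_le Q); apply: filterS near_bound => h /andP[].
have LL : - (2 * (l1 - l0)) <= L.
  by apply: (cvgr_to_ge Q); apply: filterS near_bound => h /andP[].
rewrite ler0_norm //; lra.
Unshelve. all: by end_near. Qed.

End finite_period.

End profile.

End whitham_solution.

Theorem theorem4p9 (R : realType) (K : R -> R) (hK : is_whitham_kernel K)
    (P : \bar R) (hP : (0 < P)%E) (mu : R) (phi : R -> R)
    (hper : eperiodic P phi)
    (hnonconst : ~ (exists c : R, forall x : R, phi x = c))
    (heven : forall x : R, phi (- x) = phi x)
    (hBUC1 : BUC 1 phi)
    (hsol : steady_whitham_solution K mu phi)
    (hmono : forall x y : R, left_half_period P x -> left_half_period P y ->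
       x <= y -> phi x <= phi y) :
  [/\ forall x : R, left_half_period P x ->
        0 < derive1 phi x /\ phi x < mu / 2,
      0 < mu
    & BUC 2 phi ->
      [/\ forall x : R, phi x < mu / 2,
          derive1n 2 phi 0 < 0,
          forall p : R, P = p%:E ->
            0 < derive1n 2 phi (p / 2) /\ 0 < derive1n 2 phi (- (p / 2))
        & forall p : R, P = p%:E -> mu <= 1 -> mu / 4 <= phi 0 ->
            2^-1 * `|derive1 (periodization K p) (p / 4)| <=
              derive1n 2 phi (p / 2) - derive1n 2 phi 0]].
Proof.
have [dphi_der dphi_unif] := hBUC1; have [_ phi_bound sol] := hsol.
have dphiE (x : R) : is_derive x 1 phi (derive1 phi x).
  by rewrite derive1E; apply/derivableP; exact: (dphi_der 0).
have [dphi_bound /unif_continuous_continuous dphi_cont] := dphi_unif 1 isT.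
have [B phiB] := bounded_fun_bound phi_bound.
have [B' dphiB] := bounded_fun_bound dphi_bound.
have phiE x : conv_op K phi x = phi x * (mu - phi x).
  by have := sol x; rewrite expr2; lra.
have [k [kP kp kE]] := whitham_profile hK hP.
have strict := half_period_strict hK hP hper hnonconst heven hmono dphiE
  dphi_cont phiB dphiB phiE kP kE.
split.
- move=> x /(left_half_periodE _ hP)/strict[].
  by rewrite (is_derive_even dphiE heven) heven oppr_lt0.
- exact: (wave_speed_gt0 hK hP hper hnonconst heven hmono dphiE dphi_cont phiB
    dphiB phiE kP kE).
move=> [ddphi_der _].
have ddphiE (x : R) : is_derive x 1 (derive1 phi) (derive1n 2 phi x).
  by rewrite /= derive1E; apply/derivableP; exact: (ddphi_der 1).
have crest := crest_concave hK hP hper hnonconst heven hmono dphiE dphi_cont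
  phiB dphiB phiE kP kE (ddphiE 0).
split.
- move=> x; apply: le_lt_trans crest.2.
  exact: (even_periodic_le hP dphiE heven hmono x hper).
- exact: crest.1.
- move=> p Pp.
  have trough := trough_convex hK hP hper hnonconst heven hmono dphiE dphi_cont
    phiB dphiB phiE kP kE Pp (ddphiE (p / 2)).
  split; first exact: trough.
  rewrite -(is_derive_periodic ddphiE (is_derive_periodic dphiE (hper p Pp))).
  by rewrite (_ : - (p / 2) + p = p / 2) //; field.
- move=> p Pp mu1 crest_high; have p0 : 0 < p by rewrite -lte_fin -Pp.
  have Dk : derivable k (p / 4) 1.
    by rewrite (kp p Pp); apply: derivable_periodization => //; lra.
  have := crest_trough_gap hK hP hper hnonconst heven hmono dphiE dphi_cont
    phiB dphiB phiE kP kE Pp (ddphiE 0) (ddphiE (p / 2)) Dk mu1 crest_high.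
  by rewrite (kp p Pp).
Qed.
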